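(* For all integers $n\ge 0$, $$f(2750n+825)\equiv 0 \pmod{55}\quad\text{and}\quad f(2750n+1925)\equiv 0 \pmod{55}.$$
   Context: For $n\ge 0$, let $f(n)$ denote the number of 1-shell totally symmetric plane partitions of weight $n$. Equivalently, $f$ is defined by the generating function $$\sum_{n\ge 0}f(n)q^n=1+\sum_{n\ge 1}q^{3n-2}\prod_{i=0}^{n-2}\left(1+q^{6i+3}\right).$$ (A plane partition is an array of nonnegative integers $\pi_{i,j}$ weakly decreasing in both indices; it is totally symmetric if invariant under all permutations of the three axes; it is 1-shell if its first row/column is a self-conjugate partition and all other nonzero entries equal 1; its weight is the sum of its entries.) *)

(* Defs.v *)
From mathcomp Require Import all_boot all_algebra.

Set Implicit Arguments.
Unset Strict Implicit.
Unset Printing Implicit Defensive.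

(* A plane partition of weight n has at most n nonzero rows, at most n nonzero
   columns, and entries at most n, so it is given by an n x n array with entries
   in {0, ..., n}; rows and columns are numbered from 0. *)
Definition array n := 'M['I_n.+1]_n.

Definition is_plane_partition n (p : array n) : bool :=
  [forall i1 : 'I_n, forall i2 : 'I_n, forall j : 'I_n,
     (i1 <= i2) ==> (p i2 j <= p i1 j)] &&
  [forall i : 'I_n, forall j1 : 'I_n, forall j2 : 'I_n,
     (j1 <= j2) ==> (p i j2 <= p i j1)].

(* The solid diagram {(x, y, z) | z < p x y}; since entries are at most n, it is
   contained in {0, ..., n-1}^3. *)
Definition in_diagram n (p : array n) (x y z : 'I_n) : bool := z < p x y.

Definition totally_symmetric n (p : array n) : bool :=
  [forall x : 'I_n, forall y : 'I_n, forall z : 'I_n,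
     [&& in_diagram p x z y == in_diagram p x y z,
         in_diagram p y x z == in_diagram p x y z,
         in_diagram p y z x == in_diagram p x y z,
         in_diagram p z x y == in_diagram p x y z
       & in_diagram p z y x == in_diagram p x y z]].

(* The k-th part of the conjugate of l is the number of parts of l larger
   than k (parts numbered from 0). *)
Definition self_conjugate n (l : 'I_n -> 'I_n.+1) : bool :=
  [forall k : 'I_n, #|[set j : 'I_n | k < l j]| == l k].

Definition one_shell n (p : array n) : bool :=
  [&& [forall i : 'I_n, (i == 0 :> nat) ==> self_conjugate (fun j => p i j)],
      [forall j : 'I_n, (j == 0 :> nat) ==> self_conjugate (fun i => p i j)]
    & [forall i : 'I_n, forall j : 'I_n,
         [&& 0 < i, 0 < j & p i j != 0 :> nat] ==> (p i j == 1 :> nat)]].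

Definition weight n (p : array n) : nat := \sum_(i < n) \sum_(j < n) p i j.

Definition f (n : nat) : nat :=
  #|[set p : array n | [&& is_plane_partition p, totally_symmetric p,
                           one_shell p & weight p == n]]|.

(* Main.v *)
Require Import Defs.
From HB Require Import structures.
From mathcomp Require Import all_boot all_order all_algebra finfield.
From mathcomp Require Import boolp classical_sets functions cardinality fsbigop.
From mathcomp Require Import ring zify.

(** Peeling off principal hooks of the self-conjugate first layer shows that f(3s+1) is the
    coefficient of q^s in H(q) = sum_k q^k (1+q)(1+q^3)...(1+q^(2k-1)), and that f vanishes at
    the other positive arguments. H is a mock theta function whose even part is an eta quotient:
    H(q) + H(-q) = 2 f_4^3 / f_2^2, where f_k = prod_i (1 - q^(ki)). Hence f(6m+1) = g(m) with
    sum_m g(m) q^m = f_2^3 / f_1^2, and the claim concerns m = 1375k + 1054 and m = 1375k + 779.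

    Modulo 5, g = f_1^3 f_2^3 / f_5, and Jacobi's formula for f_1^3 shows that the exponents
    4 mod 5 do not occur.

    Modulo 11, g = F / f_11 with F = f_1^9 f_2^3. The operator 1 - (8 theta + 5)^10, with
    theta = q d/dq, extracts from F the exponents 9 mod 11. In terms of E_2(q^2), phi(q)^4 and
    phi(-q)^4, together with E_10 = 1 and E_12 = E_2 modulo 11, it maps F to 9 q^9 f_1^33 f_2^99.
    Therefore sum_e g(11e+9) q^e = 9 f_1^2 f_2^9 modulo 11.

    Finally -48 q^5 (f_1^2 f_2^9)(q^6) is the theta series of u^2 + v^2 + 6 x^2 with a harmonic
    weight of degree 4. The vectors of norm 25n, for n = 2, 3 modulo 5, are the images of the
    vectors of norm n under seven similitudes, and summing the weights shows that the coefficient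
    at 25n is 1419 = 11 * 129 times the coefficient at n. The remaining values 6e + 5 are
    of this form. *)

Set Implicit Arguments.
Unset Strict Implicit.
Unset Printing Implicit Defensive.

Import GRing.Theory.
Local Open Scope ring_scope.

(** * Formal power series *)

(** No theory of modular forms is used: all identities are between formal power series. Finite
    dimensionality is replaced by functional equations under q -> q^2 and q -> -q, which determine a
    series from its first coefficients, and modulo 11 by polynomial identities in three generators.
    The shifts come from eta(z) = q^(1/24) f_1(q): F is q^(-5/8) eta(z)^9 eta(2z)^3, so 8 theta + 5
    acts on F as 8 theta acts on this eta product of weight 6. Its tenth power is the identity on
    exponents n with 8 n + 5 prime to 11 and kills those with n = 9 modulo 11. In the same way 4
    theta + 1 belongs to f_2^3, and the exponents 6 e + 5 to f_1^2 f_2^9. With m = 11 e + 9 the two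
    progressions become e = 125 k + 95 and e = 125 k + 70, so 6 e + 5 is 25 (30 k + 23) or 25 (30 k
    + 17). The residues 3 and 2 modulo 5 are not squares, which keeps the images of the seven
    similitudes disjoint. Six of these correspond to the isotropic lines of the form modulo 5; the
    seventh is multiplication by 5. *)

Record series (R : Type) := Series { coefs :> nat -> R }.

HB.instance Definition _ (R : Type) := gen_eqMixin (series R).
HB.instance Definition _ (R : Type) := gen_choiceMixin (series R).

Lemma seriesP (R : Type) (a b : series R) : (forall n, a n = b n) -> a = b.
Proof. by case: a b => [a] [b] /= ab; congr Series; apply/funext. Qed.

Section SeriesRing.
Variable R : comNzRingType.
Implicit Types (a b c : series R) (n : nat).

Definition trunc n a : {poly R} := \poly_(i < n.+1) a i.

Lemma coef_trunc n a i : (trunc n a)`_i = if (i <= n)%N then a i else 0.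
Proof. by rewrite coef_poly ltnS. Qed.

Definition szero : series R := Series (fun _ => 0).
Definition sopp a : series R := Series (fun n => - a n).
Definition sadd a b : series R := Series (fun n => a n + b n).
Definition sone : series R := Series (fun n => (n == 0)%:R).
Definition smul a b : series R :=
  Series (fun n => \sum_(i < n.+1) a i * b (n - i)%N).

Lemma smul_trunc a b n m : (n <= m)%N ->
  smul a b n = (trunc m a * trunc m b)`_n.
Proof.
move=> nm; rewrite coefM; apply: eq_bigr => i _.
by rewrite !coef_trunc (leq_trans (leq_ord i) nm) (leq_trans (leq_subr _ _) nm).
Qed.

Lemma coef_mul_eqr (p q r : {poly R}) n :
  (forall i, (i <= n)%N -> q`_i = r`_i) -> (p * q)`_n = (p * r)`_n.
Proof.
by move=> qr; rewrite !coefM; apply: eq_bigr => i _; rewrite qr ?leq_subr.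
Qed.

Lemma trunc_mul a b n i : (i <= n)%N ->
  (trunc n (smul a b))`_i = (trunc n a * trunc n b)`_i.
Proof. by move=> i_n; rewrite coef_trunc i_n (smul_trunc _ _ i_n). Qed.

Fact saddA : associative sadd.
Proof. by move=> a b c; apply: seriesP => n /=; rewrite addrA. Qed.
Fact saddC : commutative sadd.
Proof. by move=> a b; apply: seriesP => n /=; rewrite addrC. Qed.
Fact sadd0 : left_id szero sadd.
Proof. by move=> a; apply: seriesP => n /=; rewrite add0r. Qed.
Fact saddN : left_inverse szero sopp sadd.
Proof. by move=> a; apply: seriesP => n /=; rewrite addNr. Qed.

HB.instance Definition _ :=
  GRing.isZmodule.Build (series R) saddA saddC sadd0 saddN.

Fact smulC : commutative smul.
Proof.
by move=> a b; apply: seriesP => n; rewrite !(@smul_trunc _ _ n n) // mulrC.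
Qed.
Fact smulA : associative smul.
Proof.
move=> a b c; apply: seriesP => n; rewrite !(@smul_trunc _ _ n n) //.
rewrite (@coef_mul_eqr _ _ (trunc n b * trunc n c)); last exact: trunc_mul.
rewrite mulrA [_ * trunc n c]mulrC [trunc n (smul a b) * _]mulrC.
by apply: coef_mul_eqr => i i_n; rewrite trunc_mul.
Qed.
Fact smul1 : left_id sone smul.
Proof.
move=> a; apply: seriesP => n /=; rewrite big_ord_recl /= subn0 mul1r.
by rewrite big1 ?addr0 // => i _; rewrite mul0r.
Qed.
Fact smulDl : left_distributive smul sadd.
Proof.
move=> a b c; apply: seriesP => n /=.
by rewrite -big_split; apply: eq_bigr => i _; rewrite mulrDl.
Qed.
Fact sone_neq0 : sone != 0 :> series R.
Proof.
by apply/eqP => /(congr1 (fun s : series R => s 0)) /eqP; rewrite /= oner_eq0.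
Qed.

HB.instance Definition _ := GRing.Zmodule_isComNzRing.Build (series R)
  smulA smulC smul1 smulDl sone_neq0.

Lemma coefs0 n : (0 : series R) n = 0. Proof. by []. Qed.
Lemma coefs1 n : (1 : series R) n = (n == 0)%:R. Proof. by []. Qed.
Lemma coefsD a b n : (a + b) n = a n + b n. Proof. by []. Qed.
Lemma coefsN a n : (- a) n = - a n. Proof. by []. Qed.
Lemma coefsB a b n : (a - b) n = a n - b n. Proof. by []. Qed.
Lemma coefsM a b n : (a * b) n = \sum_(i < n.+1) a i * b (n - i)%N.
Proof. by []. Qed.
Lemma coefsMn a k n : (a *+ k) n = a n *+ k.
Proof. by elim: k => // k IH; rewrite !mulrS coefsD IH. Qed.
Lemma coefs_sum I (r : seq I) (P : pred I) (F : I -> series R) n :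
  (\sum_(i <- r | P i) F i) n = \sum_(i <- r | P i) F i n.
Proof. by apply: (big_morph (fun s : series R => s n)). Qed.
Lemma coefsM0 a b : (a * b) 0 = a 0 * b 0.
Proof. by rewrite coefsM big_ord1. Qed.

Definition qq : series R := Series (fun n => (n == 1)%:R).

Lemma coefs_qXM k a n : (qq ^+ k * a) n = if (k <= n)%N then a (n - k)%N else 0.
Proof.
elim: k n => [|k IH] n; first by rewrite mul1r subn0.
rewrite exprS -mulrA coefsM big_ord_recl /= mul0r add0r.
case: n => [|n]; first by rewrite big_ord0.
rewrite big_ord_recl [X in _ + X]big1 => [|i _]; last exact: mul0r.
by rewrite addr0 mul1r [LHS]IH subn1 ltnS subSS.
Qed.

Lemma coefs_qX k n : (qq ^+ k) n = (n == k)%:R.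
Proof. by rewrite -[qq ^+ k]mulr1 coefs_qXM /= subn_eq0 eqn_leq; case: (k <= n)%N; rewrite ?andbT ?andbF. Qed.

Lemma qXM_inj k : injective ( *%R (qq ^+ k)).
Proof.
move=> a b ab; apply: seriesP => n.
by have /(congr1 (fun s : series R => s (n + k)%N)) := ab; rewrite !coefs_qXM leq_addl addnK.
Qed.

(** The coefficient of q^n in [a * b] is [b n] plus a combination of lower coefficients of [b], so
    induction works over any coefficient ring. Quotients are handled this way below: multiply by a
    series of constant term 1, then cancel it. *)
Lemma sreg_eq0 a b : a 0 = 1 -> a * b = 0 -> b = 0.
Proof.
move=> a0 ab; apply: seriesP => n.
elim/ltn_ind: n => n IH.
have := congr1 (fun s : series R => s n) ab.
rewrite /= big_ord_recl /= subn0 a0 mul1r big1 ?addr0 // => i _.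
by rewrite IH ?mulr0 // /bump /=; move: (ltn_ord i); lia.
Qed.

Lemma sreg a b c : a 0 = 1 -> a * b = a * c -> b = c.
Proof.
by move=> a0 /eqP; rewrite -subr_eq0 -mulrBr => /eqP/(sreg_eq0 a0)/eqP; rewrite subr_eq0 => /eqP.
Qed.

(** Congruence modulo q^n. It carries all limit arguments in place of a topology. *)
Definition eqmodq n a b := forall i, (i < n)%N -> a i = b i.

Lemma eqmodq_refl n a : eqmodq n a a. Proof. by []. Qed.
Lemma eqmodq_sym n a b : eqmodq n a b -> eqmodq n b a.
Proof. by move=> ab i /ab. Qed.
Lemma eqmodq_trans n b a c : eqmodq n a b -> eqmodq n b c -> eqmodq n a c.
Proof. by move=> ab bc i i_n; rewrite ab ?bc. Qed.
Lemma eqmodqW n m a b : (n <= m)%N -> eqmodq m a b -> eqmodq n a b.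
Proof. by move=> nm ab i i_n; apply: ab; apply: leq_trans nm. Qed.
Lemma eqmodqD n a b c d : eqmodq n a b -> eqmodq n c d -> eqmodq n (a + c) (b + d).
Proof. by move=> ab cd i i_n; rewrite !coefsD ab ?cd. Qed.
Lemma eqmodqM n a b c d : eqmodq n a b -> eqmodq n c d -> eqmodq n (a * c) (b * d).
Proof.
move=> ab cd i i_n; rewrite !coefsM; apply: eq_bigr => j _.
by rewrite ab ?cd //; [apply: leq_ltn_trans i_n; lia | apply: leq_ltn_trans i_n; have := ltn_ord j; lia].
Qed.
Lemma eqmodq_qX0 n k a : (n <= k)%N -> eqmodq n (qq ^+ k * a) 0.
Proof. by move=> nk i i_n; rewrite coefs_qXM leqNgt (leq_trans i_n nk). Qed.
Lemma eqmodqP a b : (forall n, eqmodq n a b) -> a = b.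
Proof. by move=> ab; apply: seriesP => n; apply: (ab n.+1). Qed.

Lemma eqmodq_pow n a : a 0 = 0 -> eqmodq n (a ^+ n) 0.
Proof.
move=> a0; elim: n => // n IH i i_n; rewrite exprS coefsM big1 // => j _.
case: (posnP j) => [-> | j0]; first by rewrite a0 mul0r.
by rewrite IH ?mulr0 //; move: (ltn_ord j) i_n j0; lia.
Qed.

(* The Neumann series of the inverse; meaningful only when a 0 = 1. *)
Definition sinv a : series R := Series (fun n => (\sum_(k < n.+1) (1 - a) ^+ k) n).

Lemma sinvP a : a 0 = 1 -> a * sinv a = 1.
Proof.
move=> a0; apply: eqmodqP => n.
have b0 : (1 - a) 0 = 0 by rewrite coefsB a0 subrr.
have geo m : a * (\sum_(k < m) (1 - a) ^+ k) = 1 - (1 - a) ^+ m.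
  by rewrite -[RHS]opprB subrX1 -mulNr; congr (_ * _); rewrite opprB subKr.
have aux m i : (i < m)%N -> sinv a i = (\sum_(k < m) (1 - a) ^+ k) i.
  move=> im /=; rewrite !coefs_sum -[m](subnKC im) big_split_ord /= [X in _ = _ + X]big1 ?addr0 // => k _.
  by apply: (eqmodq_pow b0); rewrite /= addSn ltnS leq_addr.
apply: (@eqmodq_trans _ (a * \sum_(k < n) (1 - a) ^+ k)).
  by apply: eqmodqM => // i; apply: aux.
rewrite geo => i i_n; rewrite coefsB (eqmodq_pow b0 i_n) subr0 //.
Qed.

End SeriesRing.

Lemma sum_dvdn (V : nmodType) (F : nat -> V) k m : (0 < k)%N ->
  \sum_(i < m.+1) (if (k %| i)%N then F i else 0) =
  \sum_(j < (m %/ k).+1) F (k * j)%N.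
Proof.
move=> k0; elim: m => [|m IH]; first by rewrite div0n !big_ord1 dvdn0 muln0.
rewrite big_ord_recr /= IH; case: ifP => km.
  have E : (m.+1 %/ k = (m %/ k).+1)%N by rewrite divnS // km.
  by rewrite E [RHS]big_ord_recr /= -E mulnC (divnK km).
by rewrite divnS // km addr0.
Qed.

(** * Substitutions, extraction of residue classes of exponents, and q d/dq *)

Section Operators.
Variable R : comNzRingType.
Implicit Types (a b : series R) (n k : nat).

Definition dil k a : series R :=
  Series (fun n => if (k %| n)%N then a (n %/ k)%N else 0).

Lemma coefs_dil k a n :
  dil k a n = if (k %| n)%N then a (n %/ k)%N else 0.
Proof. by []. Qed.

Lemma coefs_dilM k a n : (0 < k)%N -> dil k a (k * n)%N = a n.
Proof. by move=> k0; rewrite /= dvdn_mulr // mulKn. Qed.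

Lemma coefs_dil0 k a : dil k a 0 = a 0.
Proof. by rewrite /= dvdn0 div0n. Qed.

(* For k = 0 this is the constant term, hence no condition on k. *)
Fact dil_zmod k : zmod_morphism (dil k).
Proof.
by move=> a b; apply: seriesP => n; rewrite /=; case: ifP; rewrite ?subr0.
Qed.

Definition ext k r a : series R := Series (fun n => a (k * n + r)%N).

(** Multiplication by a series in q^k shifts exponents by multiples of k only, so such a series
    behaves as a scalar for the extraction of one residue class modulo k. *)
Lemma ext_mul_dil k r a b : (r < k)%N -> ext k r (dil k b * a) = b * ext k r a.
Proof.
move=> rk; apply: seriesP => n; have k0 : (0 < k)%N by case: k rk.
rewrite /= (eq_bigr (fun i : 'I__ => if (k %| i)%N then
  b (i %/ k)%N * a (k * n + r - i)%N else 0)); last first.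
  by move=> i _; case: ifP; rewrite ?mul0r.
rewrite (sum_dvdn (fun i => b (i %/ k)%N * a (k * n + r - i)%N)) // mulnC divnMDl // divn_small // addn0.
apply: eq_bigr => j _; rewrite mulKn //; congr (_ * a _).
by rewrite mulnBr mulnC addnBAC // leq_mul2l orbC -ltnS ltn_ord.
Qed.

Fact dil_monoid k : monoid_morphism (dil k).
Proof.
split=> [|a b]; apply: seriesP => n.
  case: n => [|n]; first by rewrite coefs_dil0.
  rewrite coefs_dil; case: ifP => // kn.
  have k0 : (0 < k)%N by case: (k) kn; rewrite ?dvd0n.
  by rewrite coefs1 (negPf (_ : n.+1 %/ k != 0)%N) // -lt0n divn_gt0 // (dvdn_leq _ kn).
have [-> | k0] := posnP k.
  case: n => [|n]; first by rewrite coefsM0 !coefs_dil0 coefsM0.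
  rewrite coefs_dil dvd0n [RHS]coefsM big1 // => i _.
  by case: (posnP i) => [->|]; rewrite !coefs_dil !dvd0n ?mulr0 // lt0n => /negPf->; rewrite mul0r.
rewrite [RHS]coefsM.
rewrite (eq_bigr (fun i : 'I__ => if (k %| i)%N then
  a (i %/ k)%N * dil k b (n - i)%N else 0)); last first.
  by move=> i _; rewrite /=; case: ifP; rewrite ?mul0r.
rewrite (sum_dvdn (fun i => a (i %/ k)%N * dil k b (n - i)%N)) //.
case: (boolP (k %| n)%N) => kn; rewrite [LHS]/= ?kn ?(negPf kn).
  apply: eq_bigr => j _; rewrite mulKn //.
  have -> : (n - k * j = k * (n %/ k - j))%N by rewrite mulnBr [(k * (n %/ k))%N]mulnC divnK.
  by rewrite coefs_dilM.
rewrite big1 // => j _; rewrite /= dvdn_subl ?dvdn_mulr ?(negPf kn) ?mulr0 //.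
by rewrite mulnC; apply: leq_trans (leq_divM n k); rewrite leq_mul2r -ltnS ltn_ord orbT.
Qed.

HB.instance Definition _ k := GRing.isZmodMorphism.Build _ _ (dil k) (dil_zmod k).
HB.instance Definition _ k := GRing.isMonoidMorphism.Build _ _ (dil k) (dil_monoid k).

Lemma dil_dil k l a : (0 < k)%N -> (0 < l)%N -> dil k (dil l a) = dil (k * l) a.
Proof.
move=> k0 l0; apply: seriesP => n /=; case: ifP => [/dvdnP[m ->]|].
  rewrite mulnK // [(m * k)%N]mulnC dvdn_pmul2l // divnMl //.
by move=> kn; rewrite ifF //; apply: contraFF kn => /dvdnP[m ->]; rewrite mulnCA mulnA -mulnA dvdn_mulr.
Qed.

Lemma dil1 a : dil 1 a = a.
Proof. by apply: seriesP => n; rewrite /= dvd1n divn1. Qed.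

Lemma dil_qq k l : (0 < k)%N -> dil k (qq R ^+ l) = qq R ^+ (k * l).
Proof.
move=> k0; apply: seriesP => n; rewrite coefs_dil !coefs_qX; case: ifP => [/dvdnP[m ->]|].
  by rewrite mulnK // mulnC eqn_pmul2l.
by move=> kn; case: eqP => // nkl; rewrite nkl dvdn_mulr in kn.
Qed.

Lemma dil_inj k : (0 < k)%N -> injective (dil k).
Proof.
move=> k0 a b ab; apply: seriesP => n.
by rewrite -(coefs_dilM a n k0) ab coefs_dilM.
Qed.

Definition alt a : series R := Series (fun n => (-1) ^+ n * a n).

Fact alt_zmod : zmod_morphism alt.
Proof. by move=> a b; apply: seriesP => n; rewrite /= mulrBr. Qed.
Fact alt_monoid : monoid_morphism alt.
Proof.
split=> [|a b]; apply: seriesP => n; first by case: n => [|n]; rewrite /= ?mulr0 ?mulr1.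
rewrite [LHS]/= mulr_sumr; apply: eq_bigr => i _ /=.
by rewrite mulrACA -exprD subnKC // -ltnS.
Qed.
HB.instance Definition _ := GRing.isZmodMorphism.Build _ _ alt alt_zmod.
HB.instance Definition _ := GRing.isMonoidMorphism.Build _ _ alt alt_monoid.

Lemma alt_qq k : alt (qq R ^+ k) = (-1) ^+ k * qq R ^+ k.
Proof.
have -> : (-1) ^+ k * qq R ^+ k = (-1) ^+ (odd k) * qq R ^+ k by rewrite signr_odd.
apply: seriesP => n; rewrite [LHS]/= coefs_qX; case: eqP => [->|nk].
  by rewrite -signr_odd; case: odd; rewrite ?mulN1r ?mul1r ?coefsN coefs_qX eqxx.
by case: odd; rewrite ?mulN1r ?mul1r ?coefsN coefs_qX (introF eqP nk) ?mulr0 ?oppr0.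
Qed.

Lemma altK : involutive alt.
Proof. by move=> a; apply: seriesP => n; rewrite /= mulrA -exprMn mulrNN mulr1 expr1n mul1r. Qed.

Lemma alt_dil_even k a : ~~ odd k -> alt (dil k a) = dil k a.
Proof.
move=> k2; apply: seriesP => n /=; case: ifP; last by rewrite mulr0.
by move=> /dvdnP[m ->]; rewrite -signr_odd oddM (negPf k2) andbF mul1r.
Qed.

Definition theta a : series R := Series (fun n => a n *+ n).

Fact theta_zmod : zmod_morphism theta.
Proof. by move=> a b; apply: seriesP => n; rewrite /= mulrnBl. Qed.
HB.instance Definition _ := GRing.isZmodMorphism.Build _ _ theta theta_zmod.

Lemma thetaM a b : theta (a * b) = theta a * b + a * theta b.
Proof.
apply: seriesP => n; rewrite /= -sumrMnl -big_split; apply: eq_bigr => i _ /=.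
by rewrite mulrnAl mulrnAr -mulrnDr subnKC // -ltnS.
Qed.

Lemma theta1 : theta 1 = 0.
Proof. by apply: seriesP => -[|n]; rewrite /= ?mulr0n ?mul0rn. Qed.

Lemma theta_nat k : theta k%:R = 0.
Proof. by rewrite raddfMn /= theta1 mul0rn. Qed.

Lemma thetaX a k : theta (a ^+ k.+1) = a ^+ k * theta a *+ k.+1.
Proof.
elim: k => [|k IH]; first by rewrite mul1r.
by rewrite exprS thetaM IH -mulrnAr mulrA -exprS -mulrnAr mulrC -mulrDr -mulrS.
Qed.

Lemma theta_dil k a : theta (dil k a) = dil k (theta a) *+ k.
Proof.
apply: seriesP => n; rewrite coefsMn /=; case: ifP; last by rewrite !mul0rn.
by move=> /divnK {2}<-; rewrite mulrnA.
Qed.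

Lemma theta_qX k : theta (qq R ^+ k) = qq R ^+ k *+ k.
Proof. by apply: seriesP => n; rewrite coefsMn [LHS]/= !coefs_qX; case: eqP => [->|]; rewrite ?mul0rn. Qed.

Lemma theta_alt a : theta (alt a) = alt (theta a).
Proof. by apply: seriesP => n; rewrite /= mulrnAr. Qed.

End Operators.

Section Map.
Variables (R S : comNzRingType) (f : {rmorphism R -> S}).

Definition smap (a : series R) : series S := Series (fun n => f (a n)).

Fact smap_zmod : zmod_morphism smap.
Proof. by move=> a b; apply: seriesP => n; rewrite /= rmorphB. Qed.
Fact smap_monoid : monoid_morphism smap.
Proof.
split=> [|a b]; apply: seriesP => n /=; first by rewrite rmorph_nat.
by rewrite rmorph_sum; apply: eq_bigr => i _; rewrite rmorphM.
Qed.
HB.instance Definition _ := GRing.isZmodMorphism.Build _ _ smap smap_zmod.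
HB.instance Definition _ := GRing.isMonoidMorphism.Build _ _ smap smap_monoid.

Lemma smap_dil k a : smap (dil k a) = dil k (smap a).
Proof. by apply: seriesP => n /=; case: ifP => // _; rewrite rmorph0. Qed.
Lemma smap_qq : smap (qq R) = qq S.
Proof. by apply: seriesP => n /=; rewrite rmorph_nat. Qed.
Lemma smap_theta a : smap (theta a) = theta (smap a).
Proof. by apply: seriesP => n /=; rewrite rmorphMn. Qed.
End Map.

(** * Infinite sums and products *)

Section Sums.
Variable R : comNzRingType.
Implicit Types (a b c : series R).

Lemma eqmodq_cancel n a b c : a 0 = 1 -> eqmodq n (a * b) (a * c) -> eqmodq n b c.
Proof.
move=> a0 abc; have := eqmodqM (@eqmodq_refl _ n (sinv a)) abc.
by rewrite !mulrA [sinv a * a]mulrC sinvP // !mul1r.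
Qed.

Definition summable (I : choiceType) (F : I -> series R) :=
  forall n, exists r : seq I, forall i, i \notin r -> eqmodq n (F i) 0.

(* Meaningful only for summable families. *)
Definition ssum (I : choiceType) (F : I -> series R) : series R :=
  Series (fun n => \sum_(i \in [set: I]) F i n).

Lemma summable_uniq (I : choiceType) (F : I -> series R) n : summable F ->
  exists2 r : seq I, uniq r & forall i, i \notin r -> eqmodq n (F i) 0.
Proof.
by move=> /(_ n)[r Fr]; exists (undup r) => [|i]; rewrite ?undup_uniq // mem_undup => /Fr.
Qed.

(** The bridge to finite sums: modulo q^n any list that contains all terms of low order computes the
    infinite sum. *)
Lemma ssum_seq (I : choiceType) (F : I -> series R) n (r : seq I) : uniq r ->
  (forall i, i \notin r -> eqmodq n (F i) 0) -> eqmodq n (ssum F) (\sum_(i <- r) F i).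
Proof.
move=> ur Fr m mn; rewrite coefs_sum /=.
have -> : [set: I]%classic = [set` xpredT]%classic by apply/funext => i; apply/propext.
by rewrite -(@bigfs _ _ _ _ r xpredT) // => i _ /Fr ->.
Qed.

Lemma eq_ssum (I : choiceType) (F G : I -> series R) : F =1 G -> ssum F = ssum G.
Proof. by move=> /funext ->. Qed.

Lemma reindex_ssum (I J : choiceType) (h : I -> J) (F : J -> series R) :
  bijective h -> ssum F = ssum (F \o h).
Proof. by move=> bh; apply: seriesP => n; rewrite /= (@reindex_fsbigT _ _ _ _ _ h). Qed.

Lemma ssum0 (I : choiceType) : ssum (fun _ : I => 0) = 0.
Proof. by apply: seriesP => n; rewrite /= fsbig1. Qed.

Lemma summable_reindex (I J : choiceType) (h : I -> J) (F : J -> series R) :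
  bijective h -> summable F -> summable (F \o h).
Proof.
case=> g hK gK sF n; have [r Fr] := sF n; exists (map g r) => i ir.
by apply: Fr; apply: contra ir => /(map_f g); rewrite hK.
Qed.

Lemma summableMl (I : choiceType) c (F : I -> series R) :
  summable F -> summable (fun i => c * F i).
Proof.
move=> sF n; have [r Fr] := sF n; exists r => i /Fr Fi.
by rewrite -(mulr0 c); apply: eqmodqM.
Qed.

Lemma ssumMl (I : choiceType) c (F : I -> series R) : summable F ->
  ssum (fun i => c * F i) = c * ssum F.
Proof.
move=> sF; apply: eqmodqP => n; have [r ur Fr] := summable_uniq n sF.
apply: eqmodq_trans (_ : eqmodq n (\sum_(i <- r) c * F i) _).
  by apply: ssum_seq => // i /Fr Fi; rewrite -(mulr0 c); apply: eqmodqM.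
by rewrite -mulr_sumr; apply: eqmodqM => //; apply/eqmodq_sym/ssum_seq.
Qed.

Lemma summableD (I : choiceType) (F G : I -> series R) :
  summable F -> summable G -> summable (fun i => F i + G i).
Proof.
move=> sF sG n; have [r Fr] := sF n; have [s Gs] := sG n.
exists (r ++ s) => i; rewrite mem_cat negb_or => /andP[/Fr Fi /Gs Gi].
by rewrite -(addr0 0); apply: eqmodqD.
Qed.

Lemma ssumD (I : choiceType) (F G : I -> series R) : summable F -> summable G ->
  ssum (fun i => F i + G i) = ssum F + ssum G.
Proof.
move=> sF sG; apply: eqmodqP => n.
have [r Fr] := sF n; have [s Gs] := sG n; set t := undup (r ++ s).
have ut : uniq t by apply: undup_uniq.
have Ft i : i \notin t -> eqmodq n (F i) 0.
  by rewrite mem_undup mem_cat negb_or => /andP[/Fr].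
have Gt i : i \notin t -> eqmodq n (G i) 0.
  by rewrite mem_undup mem_cat negb_or => /andP[_ /Gs].
apply: eqmodq_trans (_ : eqmodq n (\sum_(i <- t) (F i + G i)) _).
  by apply: ssum_seq => // i it; rewrite -(addr0 0); apply: eqmodqD; [exact: Ft | exact: Gt].
by rewrite big_split; apply: eqmodqD; apply/eqmodq_sym/ssum_seq.
Qed.

Lemma ssum_pair (I J : choiceType) (F : I * J -> series R) : summable F ->
  ssum F = ssum (fun i => ssum (fun j => F (i, j))).
Proof.
move=> sF; apply: eqmodqP => n; have [r Fr] := sF n.
pose r1 := undup (map fst r); pose r2 := undup (map snd r).
have F1 i j : i \notin r1 -> eqmodq n (F (i, j)) 0.
  rewrite mem_undup => ir; apply: Fr; apply: contra ir => ijr.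
  by apply/mapP; exists (i, j).
have F2 i j : j \notin r2 -> eqmodq n (F (i, j)) 0.
  rewrite mem_undup => jr; apply: Fr; apply: contra jr => ijr.
  by apply/mapP; exists (i, j).
apply: eqmodq_trans (_ : eqmodq n (\sum_(p <- allpairs pair r1 r2) F p) _).
  apply: ssum_seq => [|[i j]]; first by apply: allpairs_uniq; rewrite ?undup_uniq // => -[? ?] [].
  move=> ijr; case: (boolP (i \in r1)) => ir; last exact: F1.
  by case: (boolP (j \in r2)) => jr; [rewrite allpairs_f in ijr | apply: F2].
rewrite big_allpairs; apply: eqmodq_sym.
apply: eqmodq_trans (ssum_seq (_ : uniq r1) _) _; first exact: undup_uniq.
  move=> i ir; apply: (@eqmodq_trans _ _ (\sum_(j <- [::]) F (i, j))); last by rewrite big_nil.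
  by apply: ssum_seq => // j _; apply: F1.
move=> m mn; rewrite !coefs_sum; apply: eq_bigr => i _.
by apply: ssum_seq mn => [|j]; [apply: undup_uniq | apply: F2].
Qed.

Lemma summable_mul (I J : choiceType) (F : I -> series R) (G : J -> series R) :
  summable F -> summable G -> summable (fun p : I * J => F p.1 * G p.2).
Proof.
move=> sF sG n; have [r Fr] := sF n; have [s Gs] := sG n.
exists (allpairs pair r s) => -[i j] ij /=.
case: (boolP (i \in r)) => [ir | /Fr Fi]; last by rewrite -(mul0r (G j)); apply: eqmodqM.
case: (boolP (j \in s)) => [js | /Gs Gi]; last by rewrite -(mulr0 (F i)); apply: eqmodqM.
by rewrite allpairs_f in ij.
Qed.

Lemma ssum_mul (I J : choiceType) (F : I -> series R) (G : J -> series R) :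
  summable F -> summable G ->
  ssum F * ssum G = ssum (fun p : I * J => F p.1 * G p.2).
Proof.
move=> sF sG; rewrite ssum_pair; last exact: summable_mul.
rewrite mulrC -ssumMl //; apply: eq_ssum => i.
by rewrite /= (ssumMl (F i) sG) mulrC.
Qed.

Lemma ssum_sum (I J : choiceType) (F : I + J -> series R) : summable F ->
  ssum F = ssum (F \o inl) + ssum (F \o inr).
Proof.
move=> sF; apply: eqmodqP => n; have [r ur Fr] := summable_uniq n sF.
pose r1 := pmap (fun u : I + J => if u is inl i then Some i else None) r.
pose r2 := pmap (fun u : I + J => if u is inr i then Some i else None) r.
have in1 i : (i \in undup r1) = (inl i \in r).
  rewrite mem_undup mem_pmap; apply/mapP/idP => [[[i'|//] ir [->]] //|ir].
  by exists (inl i).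
have in2 i : (i \in undup r2) = (inr i \in r).
  rewrite mem_undup mem_pmap; apply/mapP/idP => [[[//|i'] ir [->]] //|ir].
  by exists (inr i).
apply: (@eqmodq_trans _ _ (\sum_(u <- map inl (undup r1) ++ map inr (undup r2)) F u)).
  apply: ssum_seq => [|[i|j]]; last 2 first.
  - rewrite mem_cat negb_or => /andP[ir _]; apply: Fr; rewrite -in1.
    by apply: contra ir; apply: map_f.
  - rewrite mem_cat negb_or => /andP[_ ir]; apply: Fr; rewrite -in2.
    by apply: contra ir; apply: map_f.
  rewrite cat_uniq !map_inj_uniq ?undup_uniq /= ?andbT; try by move=> ? ? [].
  by apply/hasPn => u /mapP[j _ ->]; apply/mapP => -[].
rewrite big_cat !big_map; apply: eqmodqD; apply/eqmodq_sym/ssum_seq; rewrite ?undup_uniq //.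
  by move=> i; rewrite in1 => /Fr.
by move=> i; rewrite in2 => /Fr.
Qed.

Lemma summable_inl (I J : choiceType) (F : I + J -> series R) :
  summable F -> summable (F \o inl).
Proof.
move=> sF n; have [r Fr] := sF n.
exists (pmap (fun u : I + J => if u is inl i then Some i else None) r) => i.
by move=> ir; apply: Fr; apply: contra ir => ir; rewrite mem_pmap; apply/mapP; exists (inl i).
Qed.

Lemma summable_inr (I J : choiceType) (F : I + J -> series R) :
  summable F -> summable (F \o inr).
Proof.
move=> sF n; have [r Fr] := sF n.
exists (pmap (fun u : I + J => if u is inr i then Some i else None) r) => i.
by move=> ir; apply: Fr; apply: contra ir => ir; rewrite mem_pmap; apply/mapP; exists (inr i).
Qed.

(* The parameter c allows exponents that dominate |j| only up to a constant. *)
Lemma summable_int (F : int -> series R) (c : nat) :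
  (forall j, eqmodq (`|j| - c)%N (F j) 0) -> summable F.
Proof.
move=> Fj n; exists [seq i%:Z - (n + c)%:Z | i <- iota 0 (n + c).*2] => j jr.
apply: eqmodqW (Fj j); rewrite leqNgt; apply: contra jr => jn.
apply/mapP; exists (absz (j + (n + c)%:Z)); last by lia.
by rewrite mem_iota; lia.
Qed.

End Sums.

(** The hypothesis on [phi] is q-adic continuity at 0. Instances are dilation, sign change, twists
    and reduction of the coefficients. *)
Lemma ssum_morph (R S : comNzRingType) (phi : {additive series R -> series S})
    (I : choiceType) (F : I -> series R) :
  (forall n a, eqmodq n a 0 -> eqmodq n (phi a) 0) ->
  summable F -> phi (ssum F) = ssum (fun i => phi (F i)).
Proof.
move=> cphi sF; apply: eqmodqP => n; have [r ur Fr] := summable_uniq n sF.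
apply: (@eqmodq_trans _ _ (\sum_(i <- r) phi (F i))); last first.
  by apply/eqmodq_sym/ssum_seq => // i /Fr /cphi.
rewrite -raddf_sum => m mn; apply/eqP; rewrite -subr_eq0 -coefsB -raddfB; apply/eqP.
apply: (cphi n) mn => {}m mn; rewrite coefsB; apply/eqP; rewrite subr_eq0; apply/eqP.
exact: ssum_seq mn.
Qed.

Section Continuity.
Variables (R S : comNzRingType) (f : {rmorphism R -> S}).
Implicit Types (a : series R).

Lemma eqmodq_dil k n a b : (0 < k)%N -> eqmodq n a b -> eqmodq (k * n) (dil k a) (dil k b).
Proof.
move=> k0 ab i i_n; rewrite !coefs_dil; case: ifP => // ki.
by rewrite ab // ltn_divLR // mulnC.
Qed.

Lemma eqmodq_dil0 k n a : (0 < k)%N -> eqmodq n a 0 -> eqmodq n (dil k a) 0.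
Proof.
move=> k0 a0; rewrite -(rmorph0 (@dil R k)); apply: eqmodqW (eqmodq_dil k0 a0).
by rewrite leq_pmull.
Qed.

Lemma eqmodq_alt n a b : eqmodq n a b -> eqmodq n (alt a) (alt b).
Proof. by move=> ab i i_n; rewrite /= ab. Qed.

Lemma eqmodq_smap n a b : eqmodq n a b -> eqmodq n (smap f a) (smap f b).
Proof. by move=> ab i i_n; rewrite /= ab. Qed.

End Continuity.

(** * Infinite products with factors 1 + O(q^(i+1)) *)

Section InfiniteProducts.
Variable R : comNzRingType.
Implicit Types (a b e : series R) (u v : nat -> series R).
Local Notation q := (qq R).

Lemma eqmodq_prod1 n I (r : seq I) (F : I -> series R) :
  (forall i, eqmodq n (F i) 1) -> eqmodq n (\prod_(i <- r) F i) 1.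
Proof.
by move=> F1; elim/big_rec: _ => // i a _ a1; rewrite -(mulr1 1); apply: eqmodqM.
Qed.

Definition tame u := forall i, eqmodq i.+1 (u i) 1.

(* The factors u i with i >= n do not affect the coefficient of q^n of a tame product. *)
Definition iprod u : series R := Series (fun n => (\prod_(i < n) u i) n).

Lemma iprod_trunc u n m : tame u -> (n <= m)%N ->
  eqmodq n.+1 (iprod u) (\prod_(i < m) u i).
Proof.
move=> tu nm i i_n /=; have im : (i <= m)%N by apply: leq_trans nm.
rewrite -(subnKC im) big_split_ord /= -[LHS](congr1 (fun s : series R => s i) (mulr1 _)).
apply: (@eqmodqM _ i.+1) => //; apply: eqmodq_sym.
by apply: eqmodq_prod1 => j; apply: eqmodqW (tu _); rewrite ltnS leq_addr.
Qed.

Lemma iprod_coef0 u : iprod u 0 = 1.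
Proof. by rewrite /= big_ord0. Qed.

Lemma eq_iprod u v : u =1 v -> iprod u = iprod v.
Proof. by move=> /funext ->. Qed.

Lemma tameM u v : tame u -> tame v -> tame (fun i => u i * v i).
Proof. by move=> tu tv i; rewrite -(mulr1 1); apply: eqmodqM. Qed.

Lemma iprodM u v : tame u -> tame v -> iprod (fun i => u i * v i) = iprod u * iprod v.
Proof.
move=> tu tv; apply: eqmodqP => n; apply: (@eqmodqW _ _ n.+1) => //.
apply: eqmodq_trans (iprod_trunc (tameM tu tv) (leqnn n)) _.
by rewrite big_split; apply: eqmodqM; apply/eqmodq_sym/iprod_trunc.
Qed.

Lemma iprod_group k u : (0 < k)%N -> tame u ->
  iprod u = iprod (fun i => \prod_(j < k) u (k * i + j)%N).
Proof.
move=> k0 tu; set v := fun i => _.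
have tv : tame v.
  move=> i; apply: eqmodq_prod1 => j; apply: eqmodqW (tu _); rewrite ltnS.
  by apply: leq_trans (leq_addr _ _); rewrite leq_pmull.
apply: eqmodqP => n; apply: (@eqmodqW _ _ n.+1) => //.
apply: eqmodq_trans (iprod_trunc tu (leq_pmull n k0)) _.
apply: eqmodq_trans (eqmodq_sym (iprod_trunc tv (leqnn n))).
suff -> : \prod_(i < k * n) u i = \prod_(i < n) v i by [].
elim: n => [|n IH]; first by rewrite muln0 !big_ord0.
by rewrite mulnS addnC big_split_ord /= IH big_ord_recr.
Qed.

(** The q-Pochhammer symbol (- e q^r; q^d) with infinitely many factors. *)
Definition qprod e d r := iprod (fun i => 1 + e * q ^+ (d * i + r)).

Lemma tame_qprod e d r : (0 < d)%N -> (0 < r)%N ->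
  tame (fun i => 1 + e * q ^+ (d * i + r)).
Proof.
move=> d0 r0 i; rewrite -[X in eqmodq _ _ X]addr0; apply: eqmodqD => //.
rewrite mulrC; apply: eqmodq_qX0; rewrite -addn1 leq_add // leq_pmull //.
Qed.

Lemma qprod_coef0 e d r : qprod e d r 0 = 1.
Proof. exact: iprod_coef0. Qed.

Lemma qprod_split e d r : (0 < d)%N -> (0 < r)%N ->
  qprod e d r = qprod e (d.*2) r * qprod e (d.*2) (d + r).
Proof.
move=> d0 r0; rewrite /qprod (@iprod_group 2) //; last exact: tame_qprod.
rewrite -iprodM; try by apply: tame_qprod; rewrite ?double_gt0 ?addn_gt0 ?d0.
apply: eq_iprod => i; rewrite !big_ord_recl big_ord0 mulr1 /= /bump /=.
by congr ((1 + e * q ^+ _) * (1 + e * q ^+ _)); rewrite ?addn0 ?mulnDr; lia.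
Qed.

Lemma qprod_split3 e d r : (0 < d)%N -> (0 < r)%N ->
  qprod e d r = qprod e (3 * d) r * qprod e (3 * d) (d + r) * qprod e (3 * d) (2 * d + r).
Proof.
move=> d0 r0; have d3 : (0 < 3 * d)%N by rewrite muln_gt0.
have [r1 r2] : (0 < d + r)%N /\ (0 < 2 * d + r)%N by split; lia.
rewrite /qprod (@iprod_group 3) //; last exact: tame_qprod.
rewrite -!iprodM; try by [exact: tame_qprod|apply: tameM; exact: tame_qprod].
apply: eq_iprod => i; rewrite !big_ord_recl big_ord0 mulr1 mulrA /= /bump /=.
by congr ((1 + e * q ^+ _) * (1 + e * q ^+ _) * (1 + e * q ^+ _)); lia.
Qed.

Lemma qprod_sqr d r : (0 < d)%N -> (0 < r)%N ->
  qprod 1 d r * qprod (-1) d r = qprod (-1) d.*2 r.*2.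
Proof.
move=> d0 r0; rewrite -iprodM; try exact: tame_qprod.
apply: eq_iprod => i; have -> : (d.*2 * i + r.*2 = (d * i + r) * 2)%N by lia.
by rewrite exprM; ring.
Qed.

Lemma iprod_morph (phi : {rmorphism series R -> series R}) u :
  (forall n a b, eqmodq n a b -> eqmodq n (phi a) (phi b)) -> tame u ->
  phi (iprod u) = iprod (fun i => phi (u i)).
Proof.
move=> cphi tu; have tv : tame (fun i => phi (u i)).
  by move=> i; rewrite -(rmorph1 phi); apply: cphi.
apply: eqmodqP => n; apply: (@eqmodqW _ _ n.+1) => //.
apply: eqmodq_trans (cphi _ _ _ (iprod_trunc tu (leqnn n))) _.
by rewrite rmorph_prod; apply/eqmodq_sym/iprod_trunc.
Qed.

Lemma dil_continuous k : (0 < k)%N ->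
  forall n a b, eqmodq n a b -> eqmodq n (dil k a) (dil k b).
Proof. by move=> k0 n a b /(eqmodq_dil k0); apply: eqmodqW; rewrite leq_pmull. Qed.

Lemma dil_qprod k e d r : (0 < k)%N -> (0 < d)%N -> (0 < r)%N -> dil k e = e ->
  dil k (qprod e d r) = qprod e (k * d) (k * r).
Proof.
move=> k0 d0 r0 ke; rewrite /qprod (iprod_morph (dil_continuous k0)); last exact: tame_qprod.
apply: eq_iprod => i; rewrite rmorphD rmorph1 rmorphM /= ke dil_qq //.
by congr (1 + e * q ^+ _); lia.
Qed.

Lemma alt_qprod e d r : (0 < d)%N -> (0 < r)%N -> alt e = e -> ~~ odd d -> odd r ->
  alt (qprod e d r) = qprod (- e) d r.
Proof.
move=> d0 r0 ke d2 r2; rewrite /qprod (iprod_morph (@eqmodq_alt R)); last exact: tame_qprod.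
apply: eq_iprod => i; rewrite rmorphD rmorph1 rmorphM /= ke alt_qq.
rewrite -signr_odd oddD oddM (negPf d2) r2 /= expr1 mulN1r; ring.
Qed.

End InfiniteProducts.

Section Euler.
Variable R : comNzRingType.
Local Notation q := (qq R).

Definition euler k : series R := dil k (qprod (-1) 1 1).

Lemma eulerE k : (0 < k)%N -> euler k = qprod (-1) k k.
Proof. by move=> k0; rewrite /euler dil_qprod ?muln1 // rmorphN1. Qed.

Lemma euler_coef0 k : euler k 0 = 1.
Proof. by rewrite coefs_dil0 qprod_coef0. Qed.

Lemma dil_euler k l : (0 < k)%N -> (0 < l)%N -> dil k (euler l) = euler (k * l).
Proof. exact: dil_dil. Qed.

Lemma euler_odd k : (0 < k)%N -> euler k = qprod (-1) k.*2 k * euler k.*2.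
Proof.
by move=> k0; rewrite !eulerE ?double_gt0 // qprod_split // addnn.
Qed.

Lemma euler_plus k : (0 < k)%N -> qprod 1 k k * euler k = euler k.*2.
Proof. by move=> k0; rewrite !eulerE ?double_gt0 // qprod_sqr. Qed.

(** The sign change affects only the factors 1 - q^(2i+1), and the product of all (1 + q^(2i+1)) (1
    - q^(2i+1)) is f_2 / f_4. *)
Lemma alt_euler : alt (euler 1) * euler 1 * euler 4 = euler 2 ^+ 3.
Proof.
have alt2 : alt (euler 2) = euler 2 by apply: alt_dil_even.
have E1 : euler 1 = qprod (-1) 2 1 * euler 2 := @euler_odd 1 isT.
have E2 : euler 2 = qprod (-1) 4 2 * euler 4 := @euler_odd 2 isT.
have A : alt (qprod (-1) 2 1) = qprod 1 2 1 :> series R.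
  by rewrite alt_qprod ?rmorphN1 // opprK.
have S : qprod 1 2 1 * qprod (-1) 2 1 = qprod (-1) 4 2 :> series R.
  exact: (@qprod_sqr R 2 1).
rewrite {1 2}E1 rmorphM /= alt2 A.
transitivity ((qprod 1 2 1 * qprod (-1) 2 1 : series R) * euler 4 * euler 2 ^+ 2); first by ring.
by rewrite S -E2; ring.
Qed.

End Euler.

Lemma absz_triD n d :
  absz (((n + d)%N%:Z - n%:Z) * ((n + d)%N%:Z - n%:Z - 1)) = (d * d.-1)%N.
Proof.
have -> : (n + d)%N%:Z - n%:Z = d%:Z by lia.
case: d => [|d]; first by rewrite mul0r.
by rewrite (_ : d.+1%:Z - 1 = d%:Z) -?PoszM //; lia.
Qed.

Lemma absz_triB n d :
  absz ((n%:Z - (n + d)%N%:Z) * (n%:Z - (n + d)%N%:Z - 1)) = (d * d.+1)%N.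
Proof.
have -> : n%:Z - (n + d)%N%:Z = - d%:Z by lia.
by rewrite (_ : - d%:Z - 1 = - d.+1%:Z) ?mulrNN -?PoszM //; lia.
Qed.

(** * The triple product and classical theta identities *)

Section QBinomial.
Variable A : comNzRingType.
Implicit Types (P x y z : A) (m k n : nat).

(* Gaussian binomial coefficients in base P^2. *)
Fixpoint qbin P m k : A :=
  if m is m'.+1 then
    if k is k'.+1 then qbin P m' k + P ^+ (m' - k').*2 * qbin P m' k' else 1
  else (k == 0)%:R.

Lemma qbin0 P m : qbin P m 0 = 1.
Proof. by case: m. Qed.

Lemma qbin_small P m k : (m < k)%N -> qbin P m k = 0.
Proof.
elim: m k => [|m IH] [|k] //= mk.
by rewrite !IH ?mulr0 ?addr0 // ltnW.
Qed.

Definition qfact P n : A := \prod_(i < n) (1 - P ^+ i.+1.*2).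

Lemma qfactS P n : qfact P n.+1 = qfact P n * (1 - P ^+ n.+1.*2).
Proof. by rewrite /qfact big_ord_recr. Qed.

Lemma qbin_qfact P m k : (k <= m)%N ->
  qbin P m k * (qfact P k * qfact P (m - k)) = qfact P m.
Proof.
elim: m k => [|m IH] [|k] //=; rewrite ?subn0.
- by move=> _; rewrite /qfact big_ord0 !mulr1.
- by move=> _; rewrite [qfact P 0]/qfact big_ord0 !mul1r.
rewrite ltnS subSS => km; rewrite mulrDl.
have E2 : P ^+ (m - k).*2 * qbin P m k * (qfact P k.+1 * qfact P (m - k)) =
  P ^+ (m - k).*2 * (1 - P ^+ k.+1.*2) * qfact P m.
  by rewrite qfactS -(IH k km); ring.
have E1 : qbin P m k.+1 * (qfact P k.+1 * qfact P (m - k)) =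
  (1 - P ^+ (m - k).*2) * qfact P m.
  case: (ltnP k m) => mk; last first.
    have -> : (m - k = 0)%N by lia.
    by rewrite qbin_small // expr0 subrr !mul0r.
  have -> : (m - k = (m - k.+1).+1)%N by lia.
  by rewrite -(IH k.+1 mk) [qfact P (_ - _).+1]qfactS; ring.
rewrite E1 E2 qfactS; have -> : (m.+1.*2 = (m - k).*2 + k.+1.*2)%N by lia.
by rewrite exprD; move: (P ^+ _) (P ^+ _) => a b; ring.
Qed.

(** Rothe's q-binomial theorem, made homogeneous in x and z so that x can be specialized to a power
    of P where the usual form would call for a negative power. *)
Lemma qbinomial P x z m :
  \prod_(i < m) (x + P ^+ i.*2 * z) =
  \sum_(k < m.+1) qbin P m k * P ^+ (k * k.-1) * z ^+ k * x ^+ (m - k).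
Proof.
elim: m => [|m IH]; first by rewrite big_ord0 big_ord1 /= !mulr1.
rewrite big_ord_recr /= IH; set S := \sum_(k < m.+1) _.
have S1 : \sum_(k < m.+1) P ^+ (m - k).*2 * qbin P m k * P ^+ (k.+1 * k) *
    z ^+ k.+1 * x ^+ (m - k) = S * (P ^+ m.*2 * z).
  rewrite mulr_suml; apply: eq_bigr => k _.
  have -> : P ^+ (k.+1 * k) = P ^+ (k * k.-1) * P ^+ k.*2.
    by rewrite -exprD; congr (P ^+ _); case: (nat_of_ord k) => //= k'; lia.
  have -> : P ^+ m.*2 = P ^+ (m - k).*2 * P ^+ k.*2.
    by rewrite -exprD -doubleD subnK // -ltnS.
  by rewrite [z ^+ _.+1]exprS; ring.
have S2 : x ^+ m.+1 + \sum_(k < m.+1) qbin P m k.+1 * P ^+ (k.+1 * k) *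
    z ^+ k.+1 * x ^+ (m - k) = S * x.
  rewrite big_ord_recr /= qbin_small // !mul0r addr0.
  rewrite /S big_ord_recl mulrDl mulr_suml /= subn0 qbin0 !mul1r -exprSr.
  congr (_ + _); apply: eq_bigr => k _; rewrite /bump /= add1n.
  rewrite -[RHS]mulrA -exprSr; congr (_ * _ ^+ _).
  by have := ltn_ord k; lia.
rewrite mulrDr -S1 -S2 -addrA -big_split [RHS]big_ord_recl /= subn0 ?expr0 ?mulr1 ?mul1r.
by congr (_ + _); apply: eq_bigr => k _; rewrite /bump /= add1n subSS !mulrDl.
Qed.

(* The shifted form in which the exponent j^2 - j, j = k - n, is nonnegative for
   all integers j; P is cancelled from the homogeneous q-binomial theorem. *)
Lemma qbinomial_sym P y n : injective ( *%R P) ->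
  \prod_(i < n) (y + P ^+ i.+1.*2) * \prod_(i < n) (1 + P ^+ i.*2 * y) =
  \sum_(k < n.*2.+1) qbin P n.*2 k * P ^+ absz ((k%:Z - n%:Z) * (k%:Z - n%:Z - 1)) * y ^+ k.
Proof.
move=> Pinj; have PXinj m : injective ( *%R (P ^+ m)).
  elim: m => [|m IH] a b; first by rewrite !mul1r.
  by rewrite exprS -!mulrA => /Pinj/IH.
have prodP m : \prod_(i < m) P ^+ i.*2 = P ^+ (m * m.-1).
  elim: m => [|m IH]; first by rewrite big_ord0.
  by rewrite big_ord_recr /= IH -exprD; congr (P ^+ _); case: m {IH} => //= m; lia.
(* With x = P^(2n), the first n factors are P^(2i) (y + P^(2(n-i))) and the last n are P^(2n) (1 +
   P^(2i) y). The accumulated power of P is cancelled at the end. *)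
have := qbinomial P (P ^+ n.*2) y n.*2.
have -> : \prod_(i < n.*2) (P ^+ n.*2 + P ^+ i.*2 * y) =
  \prod_(i < n + n) (P ^+ n.*2 + P ^+ i.*2 * y) by rewrite addnn.
rewrite big_split_ord /=.
rewrite (eq_bigr (fun i : 'I_n => P ^+ i.*2 * (y + P ^+ (n - i).*2))) /=; last first.
  move=> i _; rewrite mulrDr addrC -exprD; congr (_ + P ^+ _).
  by have := ltn_ord i; lia.
rewrite big_split /= prodP (reindex_inj rev_ord_inj) /=.
rewrite (eq_bigr (fun i : 'I_n => y + P ^+ i.+1.*2)) /=; last first.
  by move=> i _; congr (_ + P ^+ _); have := ltn_ord i; lia.
rewrite [X in _ * X = _](eq_bigr (fun i : 'I_n => P ^+ n.*2 * (1 + P ^+ i.*2 * y))); last first.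
  by move=> i _; rewrite mulrDr mulr1 mulrA -exprD; congr (_ + P ^+ _ * _); lia.
rewrite big_split /= prodr_const card_ord -exprM mulrACA -exprD => E.
apply: (PXinj (n * n.-1 + n.*2 * n)%N); rewrite E mulr_sumr.
apply: eq_bigr => k _; rewrite -exprM.
have H : P ^+ (k * k.-1) * P ^+ (n.*2 * (n.*2 - k)) =
    P ^+ (n * n.-1 + n.*2 * n) * P ^+ absz ((k%:Z - n%:Z) * (k%:Z - n%:Z - 1)).
  rewrite -!exprD; congr (P ^+ _); move: (nat_of_ord k) (ltn_ord k) => {E PXinj}k.
  rewrite ltnS; case: (leqP n k) => [/subnKC <-|/ltnW/subnKC <-].
    move: (k - n)%N => d dn; rewrite absz_triD.
    have [m ->] : exists m, n = (d + m)%N by exists (n - d)%N; lia.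
    have -> : ((d + m).*2 - (d + m + d) = m)%N by lia.
    by case: d {dn} => [|d]; case: m => [|m] /=; nia.
  move: (n - k)%N => d _; rewrite absz_triB.
  have -> : ((k + d).*2 - k = k + d.*2)%N by lia.
  by case: d => [|d]; case: k => [|k] /=; nia.
rewrite [RHS]mulrA [_ * (qbin _ _ _ * _)]mulrCA -H.
by move: (P ^+ (k * _)) (P ^+ (n.*2 * _)) => a b; ring.
Qed.
End QBinomial.

Section TripleProduct.
Variable R : comNzRingType.
Local Notation q := (qq R).
Implicit Types (d s n : nat) (e : series R).

Lemma qfact_euler d n N : (0 < d)%N -> (N <= n)%N ->
  eqmodq N (qfact (q ^+ d) n) (euler R d.*2).
Proof.
move=> d0 Nn; rewrite eulerE ?double_gt0 //.
apply: eqmodqW (leqnSn N) _; apply: eqmodq_sym.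
have d2 : (0 < d.*2)%N by rewrite double_gt0.
have := iprod_trunc (@tame_qprod R (-1) _ _ d2 d2) Nn.
congr eqmodq; apply: eq_bigr => i _.
by rewrite -exprM mulN1r; congr (1 - q ^+ _); lia.
Qed.

(** Both k and n - k are at least N, so the three q-factorials in the Gaussian binomial agree with
    their common limit modulo q^N, and the quotient is the inverse of that limit. *)
Lemma qbin_limit d n N k : (0 < d)%N -> (N <= k)%N -> (N + k <= n)%N ->
  eqmodq N (euler R d.*2 * qbin (q ^+ d) n k) 1.
Proof.
move=> d0 Nk kn; apply: (@eqmodq_cancel _ _ (euler R d.*2)); first exact: euler_coef0.
have kn' : (k <= n)%N by lia.
apply: (@eqmodq_trans _ _ (qfact (q ^+ d) n)); last first.
  by rewrite mulr1; apply: qfact_euler => //; lia.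
rewrite -(qbin_qfact _ kn') mulrA mulrC; apply: eqmodqM => //.
by apply: eqmodqM; apply/eqmodq_sym/qfact_euler => //; lia.
Qed.

(** Exchange of limit and sum: for small |j| the binomial has reached its limit, and for large |j|
    the term vanishes modulo q^N because [c j] is divisible by q^(|j| (|j| - 1)). *)
Lemma qbin_sum_limit d (c : int -> series R) N n : (0 < d)%N -> (N.*2.+2 <= n)%N ->
  (forall j, eqmodq (absz j * (absz j).-1) (c j) 0) ->
  eqmodq N (euler R d.*2 * \sum_(k < n.*2.+1) qbin (q ^+ d) n.*2 k * c (k%:Z - n%:Z)) (ssum c).
Proof.
move=> d0 Nn cj; apply: eqmodq_sym.
have cN j : (N < (absz j).-1)%N -> eqmodq N (c j) 0.
  by move=> jN; apply: eqmodqW (cj j); nia.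
apply: (@eqmodq_trans _ _ (\sum_(j <- [seq k%:Z - n%:Z | k <- iota 0 n.*2.+1]) c j)).
  apply: ssum_seq => [|j jn]; first by rewrite map_inj_uniq ?iota_uniq // => a b /addIr [].
  apply: cN; rewrite ltnNge; apply: contra jn => jN; apply/mapP.
  exists (absz (j + n%:Z)); last by lia.
  by rewrite mem_iota; lia.
rewrite big_map mulr_sumr -(big_mkord xpredT (fun k => euler R d.*2 * (qbin (q ^+ d) n.*2 k * c (k%:Z - n%:Z)))).
move=> i iN; rewrite !coefs_sum /index_iota subn0 big_seq [RHS]big_seq.
apply: eq_bigr => k; rewrite mem_iota add0n => /andP[_ kn].
suff : eqmodq N (c (k%:Z - n%:Z)) (euler R d.*2 * (qbin (q ^+ d) n.*2 k * c (k%:Z - n%:Z))) by apply.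
rewrite mulrA; have [kN|kN] := leqP (absz (k%:Z - n%:Z)) N.+1.
  rewrite -[X in eqmodq _ X _]mul1r; apply: eqmodqM => //; apply: eqmodq_sym.
  by apply: qbin_limit => //; lia.
apply: (@eqmodq_trans _ _ 0); first by apply: cN; lia.
rewrite -[X in eqmodq _ X _](mulr0 (euler R d.*2 * qbin (q ^+ d) n.*2 k)).
by apply: eqmodqM => //; apply/eqmodq_sym/cN; lia.
Qed.

(** The absolute value only serves to land in [nat]: for natural numbers s <= d the quadratic
    expression is nonnegative at every integer. *)
Definition theta_exp (d s j : int) : nat := absz (d * j ^+ 2 + s * j).

(** The limit of the symmetric q-binomial theorem at P = q^d and y = e q^(d+s). The first factor of
    one product stays outside [qprod] so that s = d is allowed, where it becomes 1 + e. *)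
Theorem triple_product e d s : e * e = 1 -> (0 < d)%N -> (s <= d)%N ->
  ssum (fun j : int => e ^+ absz j * q ^+ theta_exp d s j) =
  euler R d.*2 * (1 + e * q ^+ (d - s)) *
  qprod e d.*2 (d.*2 + (d - s)) * qprod e d.*2 (d + s).
Proof.
move=> ee d0 sd; apply: eqmodqP => N; set c := fun j : int => _.
have eX m : e ^+ m * e ^+ m = 1 by rewrite -exprMn ee expr1n.
have cj j : eqmodq (absz j * (absz j).-1) (c j) 0.
  rewrite /c mulrC; apply: eqmodq_qX0; rewrite /theta_exp.
  by case: j => j /=; nia.
have [n Nn] : exists n, (N.*2.+2 <= n)%N by exists N.*2.+2.
apply: eqmodq_trans (eqmodq_sym (qbin_sum_limit d0 Nn cj)) _.
have -> : \sum_(k < n.*2.+1) qbin (q ^+ d) n.*2 k * c (k%:Z - n%:Z) =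
  \prod_(i < n) (1 + e * q ^+ (d.*2 * i + (d - s))) * \prod_(i < n) (1 + e * q ^+ (d.*2 * i + (d + s))).
  have qinj : injective ( *%R (q ^+ d)) by apply: qXM_inj.
  have := @qbinomial_sym _ (q ^+ d) (e * q ^+ (d + s)) n qinj.
  rewrite (eq_bigr (fun i : 'I_n => e * q ^+ (d + s) * (1 + e * q ^+ (d.*2 * i + (d - s))))); last first.
    move=> i _; rewrite mulrDr mulr1; congr (_ + _); rewrite mulrACA ee mul1r -exprM -exprD.
    by congr (q ^+ _); lia.
  rewrite big_split /= prodr_const card_ord exprMn -!exprM.
  rewrite [X in _ * X = _](eq_bigr (fun i : 'I_n => 1 + e * q ^+ (d.*2 * i + (d + s)))); last first.
    by move=> i _; rewrite mulrCA -exprM -exprD; congr (_ + _ * q ^+ _); lia.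
  move=> E; apply: (@qXM_inj _ ((d + s) * n)%N).
  suff F : e ^+ n * (q ^+ ((d + s) * n) * \sum_(k < n.*2.+1) qbin (q ^+ d) n.*2 k * c (k%:Z - n%:Z)) =
      e ^+ n * q ^+ ((d + s) * n) * \prod_(i < n) (1 + e * q ^+ (d.*2 * i + (d - s))) *
      \prod_(i < n) (1 + e * q ^+ (d.*2 * i + (d + s))).
    by rewrite -[LHS]mul1r -(eX n) -mulrA F !mulrA (eX n) mul1r.
  rewrite E mulrA mulr_sumr; apply: eq_bigr => k _; rewrite /c.
  rewrite exprMn -!exprM.
  have -> : e ^+ k = e ^+ n * e ^+ absz (k%:Z - n%:Z).
    case: (leqP n k) => nk.
      by rewrite -exprD; congr (_ ^+ _); lia.
    rewrite -{2}(subnKC (ltnW nk)) exprD -mulrA.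
    have -> : absz (k%:Z - n%:Z) = (n - k)%N by lia.
    by rewrite eX mulr1.
  have H : q ^+ (d * absz ((k%:Z - n%:Z) * (k%:Z - n%:Z - 1))) * q ^+ ((d + s) * k) =
      q ^+ ((d + s) * n) * q ^+ theta_exp d s (k%:Z - n%:Z).
    rewrite -!exprD; congr (q ^+ _); rewrite /theta_exp; move: (nat_of_ord k) => {}k.
    case: (leqP n k) => nk.
      rewrite -(subnKC nk); move: (k - n)%N => t; rewrite absz_triD.
      have -> : (n + t)%N%:Z - n%:Z = t%:Z by lia.
      by case: t => [|t] /=; nia.
    rewrite -(subnKC (ltnW nk)); move: (n - k)%N (subn_gt0 k n) => t; rewrite nk absz_triB.
    have -> : k%:Z - (k + t)%N%:Z = - t%:Z by lia.
    by case: t => [|t] // _; nia.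
  move: H; set a := q ^+ (d * _); set b := q ^+ ((d + s) * k).
  set u := q ^+ ((d + s) * n); set v := q ^+ theta_exp _ _ _.
  move: a b u v (e ^+ n) (e ^+ absz _) (qbin _ _ _) => a b u v x y z H.
  transitivity (z * (x * y) * (a * b)); last by ring.
  by rewrite H; ring.
rewrite [X in eqmodq N _ X](_ : _ = euler R d.*2 *
    ((1 + e * q ^+ (d - s)) * qprod e d.*2 (d.*2 + (d - s)) * qprod e d.*2 (d + s))); last by rewrite !mulrA.
apply: eqmodqM => //; apply: eqmodqM; last first.
  apply/eqmodq_sym/(@eqmodqW _ _ n.+1); first by lia.
  by apply: iprod_trunc => //; apply: tame_qprod; lia.
case: n Nn => // n Nn; rewrite big_ord_recl muln0; apply: eqmodqM => //.
apply/eqmodq_sym/(@eqmodqW _ _ n.+1); first by lia.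
apply: (@eqmodq_trans _ _ (\prod_(i < n) (1 + e * q ^+ (d.*2 * i + (d.*2 + (d - s)))))).
  by apply: iprod_trunc => //; apply: tame_qprod; lia.
suff -> : \prod_(i < n) (1 + e * q ^+ (d.*2 * i + (d.*2 + (d - s)))) =
  \prod_(i < n) (1 + e * q ^+ (d.*2 * lift ord0 i + (d - s))) by [].
by apply: eq_bigr => i _; congr (1 + e * q ^+ _); rewrite /= /bump /=; lia.
Qed.

Lemma qprod_first e d r : (0 < d)%N -> (0 < r)%N ->
  qprod e d r = (1 + e * q ^+ r) * qprod e d (d + r).
Proof.
move=> d0 r0; apply: eqmodqP => n; apply: (@eqmodqW _ _ n.+1) => //.
have rd : (0 < d + r)%N by rewrite addn_gt0 d0.
apply: eqmodq_trans (iprod_trunc (tame_qprod e d0 r0) (leqnSn n)) _.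
rewrite big_ord_recl muln0; apply: eqmodqM => //; apply: eqmodq_sym.
apply: eqmodq_trans (iprod_trunc (tame_qprod e d0 rd) (leqnn n)) _.
suff -> : \prod_(i < n) (1 + e * q ^+ (d * i + (d + r))) =
  \prod_(i < n) (1 + e * q ^+ (d * lift ord0 i + r)) by [].
by apply: eq_bigr => i _; congr (1 + e * q ^+ _); rewrite /= /bump /=; lia.
Qed.

Corollary triple_product_lt e d s : e * e = 1 -> (s < d)%N ->
  ssum (fun j : int => e ^+ absz j * q ^+ theta_exp d s j) =
  euler R d.*2 * qprod e d.*2 (d - s) * qprod e d.*2 (d + s).
Proof.
move=> ee sd; have d0 : (0 < d)%N by lia.
rewrite triple_product ?(ltnW sd) //; congr (_ * _); rewrite -mulrA -qprod_first //; lia.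
Qed.

Lemma summable_theta (c : int -> series R) d s : (0 < d)%N -> (s <= d)%N ->
  summable (fun j : int => c j * q ^+ theta_exp d s j).
Proof.
move=> d0 sd; apply: (@summable_int _ _ 2) => j; rewrite mulrC; apply: eqmodq_qX0.
by rewrite /theta_exp; case: j => j /=; nia.
Qed.

End TripleProduct.

Lemma qbin_morph (A B : comNzRingType) (f : {rmorphism A -> B}) (P : A) m k :
  f (qbin P m k) = qbin (f P) m k.
Proof.
elim: m k => [|m IH] [|k] //=; rewrite ?rmorph_nat ?rmorph1 ?rmorph0 //.
by rewrite rmorphD rmorphM rmorphXn !IH.
Qed.

(* Derivative at y = -1 of the symmetric q-binomial theorem. *)
Lemma qbinomial_sym_deriv (A : comNzRingType) (P : A) n : injective ( *%R P) ->
  qfact P n.+1 * qfact P n = - \sum_(k < n.+1.*2.+1)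
    qbin P n.+1.*2 k * ((-1) ^+ absz (k%:Z - n.+1%:Z) * (k%:Z - n.+1%:Z)%:~R *
      P ^+ absz ((k%:Z - n.+1%:Z) * (k%:Z - n.+1%:Z - 1))).
Proof.
move=> Pinj; have PCinj : injective ( *%R P%:P).
  by move=> a b ab; apply/polyP => i; apply: Pinj; rewrite -!coefCM ab.
have E := qbinomial_sym 'X n.+1 PCinj.
pose w k := qbin P n.+1.*2 k * P ^+ absz ((k%:Z - n.+1%:Z) * (k%:Z - n.+1%:Z - 1)).
have {}E : \prod_(i < n.+1) ('X + (P ^+ i.+1.*2)%:P) *
   ((1 + 'X) * \prod_(i < n) (1 + P ^+ i.+1.*2 *: 'X)) = \sum_(k < n.+1.*2.+1) w k *: 'X^k.
  rewrite (eq_bigr (fun i : 'I_n.+1 => 'X + P%:P ^+ i.+1.*2)); last by move=> i _; rewrite polyC_exp.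
  move: E; rewrite [X in _ * X = _]big_ord_recl expr0 mul1r.
  rewrite [X in _ * (_ * X)](_ : _ = \prod_(i < n) (1 + P ^+ i.+1.*2 *: 'X)); last first.
    by apply: eq_bigr => i _; rewrite -mul_polyC polyC_exp.
  move=> ->; apply: eq_bigr => k _; rewrite -mul_polyC /w polyCM polyC_exp.
  by rewrite (qbin_morph (@polyC A)).
set A0 := \prod_(i < n.+1) _ in E; set B0 := \prod_(i < n) _ in E.
have hA : A0.[-1] = (-1) ^+ n.+1 * qfact P n.+1.
  have -> : (-1) ^+ n.+1 = \prod_(i < n.+1) (-1 : A) by rewrite prodr_const card_ord.
  rewrite horner_prod -big_split.
  by apply: eq_bigr => i _; rewrite hornerD hornerX hornerC /=; ring.
have hB : B0.[-1] = qfact P n.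
  rewrite horner_prod; apply: eq_bigr => i _.
  by rewrite hornerD hornerZ hornerX hornerC; ring.
have Z : \sum_(k < n.+1.*2.+1) w k * (-1) ^+ k = 0.
  have := congr1 (fun p => p.[-1]) E; rewrite !hornerM hornerD hornerX hornerC subrr.
  rewrite mul0r mulr0 horner_sum => E0; rewrite [RHS]E0; apply: eq_bigr => k _.
  by rewrite hornerZ hornerXn.
(* The factor 1 + X vanishes at -1, so the product rule leaves only the term in which it is
   differentiated. *)
have D : A0.[-1] * B0.[-1] = \sum_(k < n.+1.*2.+1) w k * ((-1) ^+ k.-1 *+ k).
  have <- : (A0 * ((1 + 'X) * B0))^`().[-1] = A0.[-1] * B0.[-1].
    rewrite !derivM derivD derivX -[1]/(1%:P) derivC.
    by rewrite !(hornerD, hornerM, hornerX, hornerC); ring.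
  rewrite E.
  rewrite raddf_sum horner_sum; apply: eq_bigr => k _.
  by rewrite /= derivZ derivXn hornerZ hornerMn hornerXn.
have sgnE k : (-1) ^+ absz (k%:Z - n.+1%:Z) = (-1) ^+ n.+1 * (-1) ^+ k :> A.
  rewrite -exprD -signr_odd -[RHS]signr_odd; congr (_ ^+ nat_of_bool _).
  by case: (leqP n.+1 k) => nk; lia.
transitivity ((-1) ^+ n.+1 * (A0.[-1] * B0.[-1])).
  by rewrite hA hB !mulrA -exprMn mulrNN mulr1 expr1n mul1r.
rewrite D mulr_sumr -sumrN.
(* Adding a multiple of the vanishing value at -1 turns the factor k produced by the derivative into
   k - (n+1), the centred index. *)
have Z' : \sum_(k < n.+1.*2.+1) (-1) ^+ n.+1 * n.+1%:R * (w k * (-1) ^+ k) = 0.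
  by rewrite -mulr_sumr Z mulr0.
rewrite -[LHS]addr0 -[X in _ + X]Z' -big_split.
apply: eq_bigr => k _; rewrite sgnE /w intrB -!pmulrn.
case: (nat_of_ord k) => [|j] /=; first by rewrite mulr0n; ring.
by rewrite -mulr_natr [(-1) ^+ j.+1]exprS; ring.
Qed.

Lemma series_mulrnI k (a b : series int) : a *+ k.+1 = b *+ k.+1 -> a = b.
Proof.
move=> E; apply: seriesP => n; have := congr1 (fun s => coefs s n) E.
by rewrite !coefsMn => /(Num.Theory.pmulrnI (ltn0Sn k)).
Qed.

(** * Theta series with and without linear weights as products of f_1, f_2, f_4 *)

Section ThetaIdentities.
Local Notation q := (qq int).
Local Notation f k := (euler int k).

(** Taking the limit after differentiating a finite identity avoids power series in a second
    variable. The change j -> -j turns the exponent j (j - 1) into j (j + 1). *)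
Lemma jacobi :
  ssum (fun j : int => (-1) ^+ absz j * j%:~R * q ^+ theta_exp 1 1 j) = f 2 ^+ 3.
Proof.
set c := fun j : int => _.
pose c' (j : int) : series int := (-1) ^+ absz j * j%:~R * q ^+ absz (j * (j - 1)).
have qinj : injective ( *%R q) by have := @qXM_inj int 1; rewrite expr1.
have -> : ssum c = - ssum c'.
  rewrite (@reindex_ssum _ _ _ (fun j : int => - j)); last by exists (fun j : int => - j) => j; rewrite opprK.
  have -> : - ssum c' = (-1) * ssum c' by rewrite mulN1r.
  rewrite -ssumMl.
    apply: eq_ssum => j; rewrite /= /c /c' abszN /theta_exp.
    have -> : 1 * (- j) ^+ 2 + 1 * - j = j * (j - 1) by ring.
    by rewrite rmorphN; ring.
  apply: (@summable_int _ _ 2) => j; rewrite /c' mulrC; apply: eqmodq_qX0.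
  by case: j => j; nia.
apply: eqmodqP => N.
have [n Nn] : exists n, (N.*2.+2 <= n.+1)%N by exists N.*2.+2; lia.
have cj j : eqmodq (absz j * (absz j).-1) (c' j) 0.
  by rewrite /c' mulrC; apply: eqmodq_qX0; case: j => j; nia.
have L := @qbin_sum_limit int 1 c' N n.+1 isT Nn cj.
apply: eqmodq_sym; apply: (@eqmodq_trans _ _ (- (f 2 * \sum_(k < n.+1.*2.+1)
    qbin (q ^+ 1) n.+1.*2 k * c' (k%:Z - n.+1%:Z)))); last first.
  by move=> i iN; rewrite !coefsN L.
rewrite expr1 -mulrN -(qbinomial_sym_deriv _ qinj) exprS; apply: eqmodqM => //.
rewrite expr2; apply: eqmodq_sym; apply: eqmodqM; rewrite -[X in qfact X _]expr1;
  by apply: (@qfact_euler int 1) => //; lia.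
Qed.

Lemma gauss : ssum (fun j : int => (-1) ^+ absz j * q ^+ theta_exp 1 0 j) * f 2 = f 1 ^+ 2.
Proof.
rewrite (@triple_product_lt _ _ 1 0) ?mulrNN ?mulr1 //= subn0 addn0.
have -> : f 1 = qprod (-1) 2 1 * f 2 := @euler_odd int 1 isT.
by ring.
Qed.

Lemma pentagonal : ssum (fun j : int => (-1) ^+ absz j * q ^+ theta_exp 3 1 j) = f 2.
Proof.
rewrite (@triple_product_lt _ _ 3 1) ?mulrNN ?mulr1 //= !eulerE //.
by rewrite [RHS]qprod_split3 //= mulrC -mulrA [RHS]mulrC mulrA mulrC [in RHS]mulrC; ring.
Qed.

(** The factor 2 is the 1 + e of the triple product at e = 1 and s = d. *)
Lemma psi2 : ssum (fun j : int => q ^+ theta_exp 1 1 j) * f 2 = f 4 ^+ 2 *+ 2.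
Proof.
have -> : ssum (fun j : int => q ^+ theta_exp 1 1 j) =
          ssum (fun j : int => 1 ^+ absz j * q ^+ theta_exp 1 1 j).
  by apply: eq_ssum => j; rewrite expr1n mul1r.
rewrite (@triple_product _ _ 1 1) ?mulr1 //= addn0.
have <- : qprod 1 2 2 * f 2 = f 4 := @euler_plus int 2 isT.
by ring.
Qed.

(* Reindexing of Z^2 along the three cosets of an index-3 sublattice. *)
Lemma ssum_cosets3 (F : int * int -> series int) (h : int -> int -> int -> int * int) r0 r1 r2 :
  bijective (fun u : int * int + int * int + int * int => match u with
    | inl (inl p) => h r0 p.1 p.2 | inl (inr p) => h r1 p.1 p.2 | inr p => h r2 p.1 p.2 end) ->
  summable F ->
  ssum F = ssum (fun m => ssum (fun c => F (h r0 m c))) +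
           ssum (fun m => ssum (fun c => F (h r1 m c))) +
           ssum (fun m => ssum (fun c => F (h r2 m c))).
Proof.
move=> bh sF; rewrite (reindex_ssum F bh).
have sG := summable_reindex bh sF.
rewrite ssum_sum //; have sG1 := summable_inl sG.
rewrite (ssum_sum sG1) (ssum_pair (summable_inl sG1)) (ssum_pair (summable_inr sG1)).
by rewrite (ssum_pair (summable_inr sG)).
Qed.

Lemma ssum_odd_involution (h : int -> int) (F : int -> series int) :
  involutive h -> summable F -> (forall j, F (h j) = - F j) -> ssum F = 0.
Proof.
move=> hK sF hF; have bh : bijective h by exists h.
have : ssum F = - ssum F.
  rewrite {1}(reindex_ssum F bh) -mulN1r -ssumMl //; apply: eq_ssum => j /=.
  by rewrite hF mulN1r.
move=> E; apply: seriesP => n.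
have : ssum F n = - ssum F n by rewrite {1}E coefsN.
by rewrite coefs0; lia.
Qed.

Definition sg (x : int) : series int := (-1) ^+ absz x.

Lemma sgD x y : sg (x + y) = sg x * sg y.
Proof.
rewrite /sg -exprD -signr_odd -[RHS]signr_odd; congr (_ ^+ nat_of_bool _).
by lia.
Qed.

Lemma sgN x : sg (- x) = sg x.
Proof. by rewrite /sg abszN. Qed.

Lemma sg_even x : sg (2 * x) = 1.
Proof. by rewrite /sg -signr_odd (_ : odd _ = false) //; lia. Qed.

Lemma sg_sqr x : sg x * sg x = 1.
Proof. by rewrite -sgD -mulr2n -mulr_natl sg_even. Qed.

Lemma theta_exp_ge0 (d s : nat) (j : int) : (s <= d)%N -> 0 <= d%:Z * j ^+ 2 + s%:Z * j.
Proof. by case: j => j sd; nia. Qed.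

Lemma theta_expM (d s d' s' : nat) (j j' x : int) : (s <= d)%N -> (s' <= d')%N ->
  x = d%:Z * j ^+ 2 + s%:Z * j + (d'%:Z * j' ^+ 2 + s'%:Z * j') ->
  q ^+ theta_exp d s j * q ^+ theta_exp d' s' j' = q ^+ absz x.
Proof.
move=> sd sd' ->; rewrite -exprD; congr (q ^+ _); rewrite /theta_exp.
by have := theta_exp_ge0 j sd; have := theta_exp_ge0 j' sd'; lia.
Qed.

Lemma theta_expMM (d s d' s' e t e' t' : nat) (j j' k k' : int) :
  (s <= d)%N -> (s' <= d')%N -> (t <= e)%N -> (t' <= e')%N ->
  d%:Z * j ^+ 2 + s%:Z * j + (d'%:Z * j' ^+ 2 + s'%:Z * j') =
  e%:Z * k ^+ 2 + t%:Z * k + (e'%:Z * k' ^+ 2 + t'%:Z * k') ->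
  q ^+ theta_exp d s j * q ^+ theta_exp d' s' j' =
  q ^+ theta_exp e t k * q ^+ theta_exp e' t' k'.
Proof.
by move=> sd sd' te te' E; rewrite (theta_expM sd sd' (esym E)) (theta_expM te te' erefl).
Qed.

Lemma ssum_odd (c : int -> series int) : summable c -> (forall j, c (- j) = - c j) -> ssum c = 0.
Proof. by move=> sc cN; apply: (ssum_odd_involution _ sc cN) => j; rewrite opprK. Qed.

Lemma dil_theta k (c : int -> int) (e : int -> nat) : (0 < k)%N ->
  summable (fun j => (c j)%:~R * q ^+ e j) ->
  dil k (ssum (fun j => (c j)%:~R * q ^+ e j)) = ssum (fun j => (c j)%:~R * q ^+ (k * e j)).
Proof.
move=> k0 sc; rewrite (@ssum_morph _ _ (@dil int k)) //; last first.
  by move=> n a; apply: eqmodq_dil0.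
by apply: eq_ssum => j; rewrite /= rmorphM rmorph_int /= dil_qq.
Qed.

Lemma sgE x : sg x = ((-1) ^+ absz x)%:~R.
Proof. by rewrite rmorphXn rmorphN1. Qed.

Lemma pentagonal4 : ssum (fun j : int => sg j * q ^+ theta_exp 6 2 j) = f 4.
Proof.
have <- : dil 2 (f 2) = f 4 by rewrite dil_euler.
rewrite -pentagonal (eq_ssum (G := fun j => ((-1) ^+ absz j)%:~R * q ^+ theta_exp 3 1 j)); last first.
  by move=> j; rewrite -sgE.
rewrite dil_theta //; last exact: summable_theta.
by apply: eq_ssum => j; rewrite sgE; congr (_ * q ^+ _); rewrite /theta_exp; lia.
Qed.

(** By [jacobi] the left side is a sum over (a, b) with weight a; the weight may be replaced by a +
    2 b, since the part with 2 b is odd in b. On the coset a + 2 b = 3 m + r, parametrized by a = m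
    + r + 2 c and b = m - c, the exponent a^2 + a + 2 b^2 has no term in m c and the weight depends
    on m alone, so the sum factors. The coset r = 1 vanishes under c -> -1 - c; r = 0 and r = -1
    contribute 3 m and 3 m + 1. *)
Lemma quintuple_T2_aux :
  f 2 ^+ 3 * ssum (fun b : int => sg b * q ^+ theta_exp 2 0 b) =
  f 4 * ssum (fun m : int => (6 * m + 1)%:~R * q ^+ theta_exp 3 1 m).
Proof.
have s11 c : summable (fun j => c j * q ^+ theta_exp 1 1 j) by apply: summable_theta.
have s20 c : summable (fun j => c j * q ^+ theta_exp 2 0 j) by apply: summable_theta.
have s31 c : summable (fun j => c j * q ^+ theta_exp 3 1 j) by apply: summable_theta.
pose F (p : int * int) := (sg p.1 * q ^+ theta_exp 1 1 p.1) * (sg p.2 * q ^+ theta_exp 2 0 p.2) * (p.1 + 2 * p.2)%:~R.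
have sF : summable F.
  move=> n; have [r Fr] := summable_mul (s11 sg) (s20 sg) n; exists r => p /Fr Fp.
  by rewrite -(mul0r (p.1 + 2 * p.2)%:~R); apply: eqmodqM.
transitivity (ssum F).
  rewrite -jacobi (ssum_mul (s11 (fun j => sg j * j%:~R)) (s20 sg)).
  have -> : ssum F = ssum (fun p : int * int =>
     (sg p.1 * p.1%:~R * q ^+ theta_exp 1 1 p.1) * (sg p.2 * q ^+ theta_exp 2 0 p.2) +
     (sg p.1 * q ^+ theta_exp 1 1 p.1) * (sg p.2 * (2 * p.2)%:~R * q ^+ theta_exp 2 0 p.2)).
    by apply: eq_ssum => p; rewrite /F rmorphD; ring.
  rewrite ssumD; first last.
  - exact: (summable_mul (s11 sg) (s20 (fun b => sg b * (2 * b)%:~R))).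
  - exact: (summable_mul (s11 (fun j => sg j * j%:~R)) (s20 sg)).
  rewrite -(ssum_mul (s11 sg) (s20 (fun b => sg b * (2 * b)%:~R))).
  rewrite [X in _ + _ * X]ssum_odd ?mulr0 ?addr0 // => j.
  by rewrite sgN /theta_exp sqrrN !mul0r !addr0 mulrN rmorphN; ring.
pose h (r m c : int) : int * int := (m + r + 2 * c, m - c).
have s62 c : summable (fun j => c j * q ^+ theta_exp 6 2 j) by apply: summable_theta.
have FE r m c (u v : series int) : sg r * (u * v) = q ^+ theta_exp 1 1 (m + r + 2 * c) * q ^+ theta_exp 2 0 (m - c) ->
    F (h r m c) = ((3 * m + r)%:~R * u) * (sg c * v).
  move=> E; rewrite /F /h /= mulrACA -E.
  have -> : m + r + 2 * c + 2 * (m - c) = 3 * m + r by ring.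
  rewrite !sgD sg_even sgN mulr1.
  transitivity ((sg m * sg m) * (sg r * sg r) * ((3 * m + r)%:~R * u * (sg c * v))); first by ring.
  by rewrite !sg_sqr !mul1r.
have sgn1 : sg 1 = -1 by rewrite /sg expr1.
have T0 : ssum (fun m : int => ssum (fun c => F (h 0 m c))) =
    f 4 * ssum (fun m : int => (3 * m)%:~R * q ^+ theta_exp 3 1 m).
  rewrite -ssumMl //; apply: eq_ssum => m.
  rewrite -pentagonal4 mulrC -ssumMl //; apply: eq_ssum => c.
  rewrite (@FE 0 m c (q ^+ theta_exp 3 1 m) (q ^+ theta_exp 6 2 c)) ?addr0 //.
  by rewrite /sg expr0 mul1r; apply: theta_expMM => //; ring.
have T1 : ssum (fun m : int => ssum (fun c => F (h 1 m c))) = 0.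
  rewrite (_ : (fun m : int => _) = fun=> 0) ?ssum0 //; apply/funext => m.
  rewrite (eq_ssum (G := fun c => (- (3 * m + 1)%:~R * (q ^+ 2 * q ^+ absz (3 * m ^+ 2 + 3 * m))) * (sg c * q ^+ theta_exp 6 6 c))).
    rewrite ssumMl; last exact: summable_theta.
    rewrite (@ssum_odd_involution (fun c => - 1 - c)) ?mulr0 //.
    - by move=> c; ring.
    - exact: summable_theta.
    - by move=> c; rewrite sgD !sgN sgn1 /theta_exp mulN1r mulNr; do 3! congr (_ _); congr (absz _); ring.
  move=> c; rewrite (@FE 1 m c (- (q ^+ 2 * q ^+ theta_exp 3 3 m)) (q ^+ theta_exp 6 6 c)); first by rewrite /theta_exp; ring.
  rewrite sgn1 mulN1r mulNr opprK -mulrA.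
  rewrite (theta_expM (x := 3 * m ^+ 2 + 3 * m + (6 * c ^+ 2 + 6 * c))) //.
  rewrite (theta_expM (x := 2 + (3 * m ^+ 2 + 3 * m + (6 * c ^+ 2 + 6 * c)))) //; last by ring.
  rewrite -exprD; congr (q ^+ _).
  by have := @theta_exp_ge0 3 3 m isT; have := @theta_exp_ge0 6 6 c isT; lia.
have T2 : ssum (fun m : int => ssum (fun c => F (h (-1) m c))) =
    f 4 * ssum (fun m : int => (3 * m + 1)%:~R * q ^+ theta_exp 3 1 m).
  rewrite (@reindex_ssum _ _ _ (fun m : int => - m)); last by exists (fun m : int => - m) => m; rewrite opprK.
  rewrite -ssumMl //; apply: eq_ssum => m /=.
  rewrite -pentagonal4 mulrC -ssumMl // (@reindex_ssum _ _ _ (fun m : int => - m)); last by exists (fun m : int => - m) => j; rewrite opprK.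
  apply: eq_ssum => c /=.
  rewrite (@FE (-1) (- m) (- c) (- q ^+ theta_exp 3 1 m) (q ^+ theta_exp 6 2 c)).
    have -> : 3 * - m + -1 = - (3 * m + 1) by ring.
    by rewrite sgN rmorphN mulrNN.
  by rewrite sgN sgn1 mulN1r mulNr opprK; apply: theta_expMM => //; ring.
rewrite (@ssum_cosets3 F h 0 1 (-1)) //; last first.
  pose g (p : int * int) : int * int + int * int + int * int :=
    let k := p.1 + 2 * p.2 in let m := ((k + 1) %/ 3)%Z in
    let r := k - 3 * m in let u := (m, m - p.2) in
    if r == 0 then inl (inl u) else if r == 1 then inl (inr u) else inr u.
  exists g.
    move=> [[[m c]|[m c]]|[m c]]; rewrite /g /h /=.
    - have -> : (((m + 0 + 2 * c + 2 * (m - c)) + 1) %/ 3)%Z = m by lia.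
      rewrite ifT; last by lia.
      by congr (inl (inl (_, _))); lia.
    - have -> : (((m + 1 + 2 * c + 2 * (m - c)) + 1) %/ 3)%Z = m by lia.
      rewrite ifF; last by lia.
      rewrite ifT; last by lia.
      by congr (inl (inr (_, _))); lia.
    - have -> : (((m + -1 + 2 * c + 2 * (m - c)) + 1) %/ 3)%Z = m by lia.
      rewrite ifF; last by lia.
      rewrite ifF; last by lia.
      by congr (inr (_, _)); lia.
  move=> [a b]; rewrite /g /=; case: ifP => r0; last case: ifP => r1; rewrite /h /=; congr (_, _); lia.
rewrite T0 T1 T2 addr0 -mulrDr -ssumD //; congr (_ * _); apply: eq_ssum => m.
by rewrite -mulrDl -rmorphD; congr (_%:~R * _); ring.
Qed.
Lemma dil2_jacobi :
  ssum (fun j : int => sg j * j%:~R * q ^+ theta_exp 2 2 j) = f 4 ^+ 3.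
Proof.
have <- : dil 2 (f 2) = f 4 by rewrite dil_euler.
rewrite -rmorphXn -jacobi (eq_ssum (F := fun j => _ * _ * q ^+ theta_exp 1 1 j)
  (G := fun j => ((-1) ^+ absz j * j)%:~R * q ^+ theta_exp 1 1 j)); last first.
  by move=> j; rewrite [in RHS]rmorphM rmorphXn rmorphN1.
rewrite /= dil_theta //; last exact: summable_theta.
apply: eq_ssum => j; rewrite sgE -rmorphM; congr (_ * q ^+ _); rewrite /theta_exp; lia.
Qed.

(** The method of [quintuple_T2_aux] with weight 2 (a + b + 1) = 2 a + (2 b + 1) + 1: the last two
    parts vanish under b -> -1 - b and a -> -1 - a. Here a = m - c and b = 2 m + r + c; the cosets r
    = 0 and r = 1 contribute equally and r = 2 vanishes. *)
Lemma quintuple_T1_aux :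
  f 4 ^+ 3 * ssum (fun b : int => q ^+ theta_exp 1 1 b) =
  f 2 * ssum (fun m : int => sg m * (3 * m + 1)%:~R * q ^+ theta_exp 6 4 m) *+ 2.
Proof.
have s11 c : summable (fun j => c j * q ^+ theta_exp 1 1 j) by apply: summable_theta.
have s22 c : summable (fun j => c j * q ^+ theta_exp 2 2 j) by apply: summable_theta.
have s31 c : summable (fun j => c j * q ^+ theta_exp 3 1 j) by apply: summable_theta.
have s64 c : summable (fun j => c j * q ^+ theta_exp 6 4 j) by apply: summable_theta.
have s11' : summable (fun j => q ^+ theta_exp 1 1 j).
  by have := s11 (fun=> 1); rewrite (_ : (fun j => 1 * _) = (fun j => q ^+ theta_exp 1 1 j)) //; apply/funext => j; rewrite mul1r.
pose F (p : int * int) := (sg p.1 * q ^+ theta_exp 2 2 p.1) * q ^+ theta_exp 1 1 p.2 * (2 * (p.1 + p.2 + 1))%:~R.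
have sF : summable F.
  move=> n; have [r Fr] := summable_mul (s22 sg) s11' n; exists r => p /Fr Fp.
  by rewrite -(mul0r (2 * (p.1 + p.2 + 1))%:~R); apply: eqmodqM.
have N1 : involutive (fun j : int => - 1 - j) by move=> j; ring.
have sgn1 : sg 1 = -1 by rewrite /sg expr1.
have E : f 4 ^+ 3 * ssum (fun b : int => q ^+ theta_exp 1 1 b) *+ 2 = ssum F.
  have -> : ssum F = ssum (fun p : int * int =>
     ((sg p.1 * (2 * p.1)%:~R) * q ^+ theta_exp 2 2 p.1) * q ^+ theta_exp 1 1 p.2 +
     (((sg p.1 * q ^+ theta_exp 2 2 p.1) * ((2 * p.2 + 1)%:~R * q ^+ theta_exp 1 1 p.2)) +
     ((sg p.1 * q ^+ theta_exp 2 2 p.1) * q ^+ theta_exp 1 1 p.2))).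
    by apply: eq_ssum => p; rewrite /F; ring.
  have m1 := summable_mul (s22 (fun j => sg j * (2 * j)%:~R)) s11'.
  have m2 := summable_mul (s22 sg) (s11 (fun j => (2 * j + 1)%:~R)).
  have m3 := summable_mul (s22 sg) s11'.
  rewrite ssumD //; last exact: summableD.
  rewrite ssumD // -(ssum_mul (s22 (fun j => sg j * (2 * j)%:~R)) s11').
  rewrite -(ssum_mul (s22 sg) (s11 (fun j => (2 * j + 1)%:~R))) -(ssum_mul (s22 sg) s11').
  rewrite (@ssum_odd_involution _ (fun j => (2 * j + 1)%:~R * _) N1) //; last first.
    move=> j; rewrite /theta_exp -mulNr -rmorphN; congr (_%:~R * q ^+ absz _); ring.
  rewrite (@ssum_odd_involution _ (fun j => sg j * _) N1) //; last first.
    move=> j; rewrite /theta_exp sgD !sgN sgn1 mulN1r -mulNr; congr (_ * q ^+ absz _); ring.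
  rewrite mulr0 mul0r !addr0 -dil2_jacobi -mulrnAl; congr (_ * _).
  rewrite -mulr_natl -ssumMl //; apply: eq_ssum => j; ring.
pose h (r m c : int) : int * int := (m - c, 2 * m + r + c).
have FE r m c (u v : series int) : u * v = q ^+ theta_exp 2 2 (m - c) * q ^+ theta_exp 1 1 (2 * m + r + c) ->
    F (h r m c) = (sg m * (2 * (3 * m + r + 1))%:~R * u) * (sg c * v).
  move=> H; rewrite /F /h /= sgD sgN.
  have -> : m - c + (2 * m + r + c) + 1 = 3 * m + r + 1 by ring.
  transitivity (sg m * sg c * (2 * (3 * m + r + 1))%:~R * (u * v)); last by ring.
  by rewrite H; ring.
have T0 : ssum (fun m : int => ssum (fun c => F (h 0 m c))) =
    f 2 * ssum (fun m : int => sg m * (3 * m + 1)%:~R * q ^+ theta_exp 6 4 m) *+ 2.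
  rewrite -mulrnAl -ssumMl //; apply: eq_ssum => m.
  rewrite (@reindex_ssum _ _ _ (fun m : int => - m)); last by exists (fun m : int => - m) => j; rewrite opprK.
  rewrite -pentagonal mulrnAl mulrC -mulrnAl -ssumMl //; apply: eq_ssum => c /=.
  rewrite (@FE 0 m (- c) (q ^+ theta_exp 6 4 m) (q ^+ theta_exp 3 1 c)).
    by rewrite sgN /sg; ring.
  by apply: theta_expMM => //; ring.
have T1 : ssum (fun m : int => ssum (fun c => F (h 1 m c))) =
    f 2 * ssum (fun m : int => sg m * (3 * m + 1)%:~R * q ^+ theta_exp 6 4 m) *+ 2.
  rewrite (@reindex_ssum _ _ _ (fun j : int => - 1 - j)); last by exists (fun j : int => - 1 - j).
  rewrite -mulrnAl -ssumMl //; apply: eq_ssum => m.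
  rewrite -pentagonal mulrnAl mulrC -mulrnAl -ssumMl //; apply: eq_ssum => c /=.
  rewrite (@FE 1 (- 1 - m) c (q ^+ theta_exp 6 4 m) (q ^+ theta_exp 3 1 c)).
    have -> : 2 * (3 * (- 1 - m) + 1 + 1) = - (2 * (3 * m + 1)) by ring.
    by rewrite sgD !sgN sgn1 /sg rmorphN; ring.
  by apply: theta_expMM => //; ring.
have T2 : ssum (fun m : int => ssum (fun c => F (h 2 m c))) = 0.
  rewrite (_ : (fun m : int => _) = fun=> 0) ?ssum0 //; apply/funext => m.
  rewrite (eq_ssum (G := fun c => (sg m * (2 * (3 * m + 2 + 1))%:~R * q ^+ theta_exp 6 0 (m + 1)) * (sg c * q ^+ theta_exp 3 3 c))).
    rewrite ssumMl; last exact: summable_theta.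
    rewrite (@ssum_odd_involution (fun c => - 1 - c)) ?mulr0 //; first exact: summable_theta.
    by move=> c; rewrite sgD !sgN sgn1 /theta_exp mulN1r mulNr; do 3! congr (_ _); congr (absz _); ring.
  by move=> c; apply: FE; apply: theta_expMM => //; ring.
have E2 : ssum F = (f 2 * ssum (fun m : int => sg m * (3 * m + 1)%:~R * q ^+ theta_exp 6 4 m) *+ 2) *+ 2.
  rewrite (@ssum_cosets3 F h 0 1 2) //; first by rewrite T0 T1 T2 addr0 -mulr2n.
  pose g (p : int * int) : int * int + int * int + int * int :=
    let k := p.1 + p.2 in let m := (k %/ 3)%Z in
    let r := k - 3 * m in let u := (m, m - p.1) in
    if r == 0 then inl (inl u) else if r == 1 then inl (inr u) else inr u.
  exists g.
    move=> [[[m c]|[m c]]|[m c]]; rewrite /g /h /=.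
    - have -> : ((m - c + (2 * m + 0 + c)) %/ 3)%Z = m by lia.
      rewrite ifT; last by lia.
      by congr (inl (inl (_, _))); lia.
    - have -> : ((m - c + (2 * m + 1 + c)) %/ 3)%Z = m by lia.
      rewrite ifF; last by lia.
      rewrite ifT; last by lia.
      by congr (inl (inr (_, _))); lia.
    - have -> : ((m - c + (2 * m + 2 + c)) %/ 3)%Z = m by lia.
      rewrite ifF; last by lia.
      rewrite ifF; last by lia.
      by congr (inr (_, _)); lia.
  move=> [a b]; rewrite /g /=; case: ifP => r0; last case: ifP => r1; rewrite /h /=; congr (_, _); lia.
apply: (@series_mulrnI 1); exact: etrans E E2.
Qed.

End ThetaIdentities.

(** * Ramanujan's phi(q), phi(-q) and two weighted theta series as eta quotients *)

Section EtaQuotients.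
Local Notation q := (qq int).
Local Notation f k := (euler int k).

Lemma coefsX0 (R : comNzRingType) (a : series R) n : a 0 = 1 -> (a ^+ n) 0 = 1.
Proof. by move=> a0; elim: n => // n IH; rewrite exprS coefsM0 a0 IH mulr1. Qed.

Lemma coefsM1 (R : comNzRingType) (a b : series R) : a 0 = 1 -> b 0 = 1 -> (a * b) 0 = 1.
Proof. by move=> a0 b0; rewrite coefsM0 a0 b0 mulr1. Qed.

Lemma alt_coef0 (R : comNzRingType) (a : series R) : alt a 0 = a 0.
Proof. by rewrite /= mul1r. Qed.

Lemma alt_theta_exp (c : int -> int) d s :
  summable (fun j => (c j)%:~R * q ^+ theta_exp d s j) ->
  alt (ssum (fun j => (c j)%:~R * q ^+ theta_exp d s j)) =
  ssum (fun j => (c j)%:~R * ((-1) ^+ theta_exp d s j * q ^+ theta_exp d s j)).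
Proof.
move=> sc; rewrite (@ssum_morph _ _ (@alt int)) //; last first.
  by move=> n a /eqmodq_alt; rewrite rmorph0.
by apply: eq_ssum => j; rewrite /= rmorphM rmorph_int /= alt_qq.
Qed.

Definition phi_minus : series int := ssum (fun j : int => sg j * q ^+ theta_exp 1 0 j).
Definition phi : series int := ssum (fun j : int => q ^+ theta_exp 1 0 j).

Lemma phi_minusE : phi_minus * f 2 = f 1 ^+ 2. Proof. exact: gauss. Qed.

Lemma alt_phi_minus : alt phi_minus = phi.
Proof.
rewrite /phi_minus (eq_ssum (G := fun j => ((-1) ^+ absz j)%:~R * q ^+ theta_exp 1 0 j)); last first.
  by move=> j; rewrite sgE.
rewrite alt_theta_exp; last exact: summable_theta.
apply: eq_ssum => j; rewrite rmorphXn rmorphN1 mulrA -exprD -signr_odd.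
have -> : theta_exp 1 0 j = (absz j * absz j)%N.
  by rewrite /theta_exp mul0r addr0 mul1r expr2 abszM.
by rewrite oddD oddM andbb addbb mul1r.
Qed.

Lemma alt_phi : alt phi = phi_minus.
Proof. by rewrite -alt_phi_minus altK. Qed.

Lemma phiE : phi * (f 1 ^+ 2 * f 4 ^+ 2) = f 2 ^+ 5.
Proof.
apply: (@sreg _ (f 2)); first exact: euler_coef0.
have alt2 : alt (f 2) = f 2 by apply: alt_dil_even.
have E : phi * f 2 = alt (f 1) ^+ 2.
  by rewrite -alt_phi_minus -{1}alt2 -rmorphM phi_minusE rmorphXn.
transitivity (phi * f 2 * (f 1 ^+ 2 * f 4 ^+ 2)); first by ring.
rewrite E; transitivity ((alt (f 1) * f 1 * f 4) ^+ 2); first by ring.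
by rewrite alt_euler; ring.
Qed.

Lemma phi_mul : phi * phi_minus = dil 2 phi_minus ^+ 2.
Proof.
apply: (@sreg _ (f 1 ^+ 2 * f 2 * f 4 ^+ 2)).
  by rewrite !coefsM1 ?coefsX0 ?euler_coef0.
have E : dil 2 phi_minus * f 4 = f 2 ^+ 2.
  have := congr1 (dil 2) phi_minusE; rewrite rmorphM rmorphXn /= !dil_euler //.
transitivity ((phi * (f 1 ^+ 2 * f 4 ^+ 2)) * (phi_minus * f 2)); first by ring.
rewrite phiE phi_minusE.
transitivity (f 1 ^+ 2 * f 2 * (dil 2 phi_minus * f 4) ^+ 2); last by ring.
by rewrite E; ring.
Qed.

Lemma ssum_cosets2 (F : int * int -> series int) : summable F ->
  ssum F = ssum (fun p => F (p.1 + p.2, p.1 - p.2)) +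
           ssum (fun p => F (p.1 + p.2 + 1, p.1 - p.2)).
Proof.
move=> sF.
pose h (u : int * int + int * int) : int * int :=
  match u with inl p => (p.1 + p.2, p.1 - p.2) | inr p => (p.1 + p.2 + 1, p.1 - p.2) end.
have bh : bijective h.
  pose g (p : int * int) : int * int + int * int := let u := ((p.1 + p.2) %/ 2)%Z in
    if ((p.1 + p.2) %% 2)%Z == 0 then inl (u, u - p.2) else inr (u, u - p.2).
  exists g.
    move=> [[a b]|[a b]]; rewrite /g /h /=.
      by rewrite ifT; last lia; congr (inl (_, _)); lia.
    by rewrite ifF; last lia; congr (inr (_, _)); lia.
  by move=> [a b]; rewrite /g /=; case: ifP => r; rewrite /h /=; congr (_, _); lia.
by rewrite (reindex_ssum F bh) ssum_sum //; apply: summable_reindex.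
Qed.

Lemma summable_sqr : summable (fun j : int => q ^+ theta_exp 1 0 j).
Proof.
have := @summable_theta int (fun=> 1) 1 0 isT isT.
by congr summable; apply/funext => j; rewrite mul1r.
Qed.

(** For s = 1 and s = -1 the factor 1 + s (-1)^(a+b) is 2 or 0, so the sum is restricted to pairs
    with a + b even, respectively odd. *)
Lemma phi_sqr_coset s : s * s = 1 ->
  phi ^+ 2 + s * phi_minus ^+ 2 =
  ssum (fun p : int * int => (1 + s * sg (p.1 + p.2)) * (q ^+ theta_exp 1 0 p.1 * q ^+ theta_exp 1 0 p.2)).
Proof.
move=> ss; have s1 := summable_sqr.
have s2 : summable (fun j : int => sg j * q ^+ theta_exp 1 0 j) by exact: summable_theta.
rewrite !expr2 (ssum_mul s1 s1) (ssum_mul s2 s2) -ssumMl; last exact: (summable_mul s2 s2).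
rewrite -ssumD; try by [exact: (summable_mul s1 s1) | apply: summableMl; exact: (summable_mul s2 s2)].
by apply: eq_ssum => p; rewrite sgD; ring.
Qed.

Lemma summable_phi_coset s :
  summable (fun p : int * int => (1 + s * sg (p.1 + p.2)) * (q ^+ theta_exp 1 0 p.1 * q ^+ theta_exp 1 0 p.2)).
Proof.
move=> n; have [r Fr] := summable_mul summable_sqr summable_sqr n; exists r => p /Fr Fp.
rewrite -(mulr0 (1 + s * sg (p.1 + p.2))).
exact: (eqmodqM (@eqmodq_refl _ _ _) Fp).
Qed.

Lemma dil2_phi : dil 2 phi = ssum (fun j : int => q ^+ theta_exp 2 0 j).
Proof.
rewrite (@ssum_morph _ _ (@dil int 2)) //; first last.
- exact: summable_sqr.
- by move=> n a; apply: eqmodq_dil0.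
by apply: eq_ssum => j; rewrite /= dil_qq //; congr (q ^+ _); rewrite /theta_exp; lia.
Qed.

Lemma phi_sqrD : phi ^+ 2 + phi_minus ^+ 2 = dil 2 phi ^+ 2 *+ 2.
Proof.
rewrite -[phi_minus ^+ 2]mul1r phi_sqr_coset ?mulr1 // ssum_cosets2; last exact: summable_phi_coset.
rewrite [X in _ + X](_ : _ = 0) ?addr0; last first.
  rewrite -[RHS](ssum0 int (int * int)%type); apply: eq_ssum => p /=.
  have -> : p.1 + p.2 + 1 + (p.1 - p.2) = 2 * p.1 + 1 by ring.
  by rewrite sgD sg_even /sg expr1 !mul1r subrr mul0r.
rewrite dil2_phi expr2.
have s20 : summable (fun j : int => q ^+ theta_exp 2 0 j).
  have := @summable_theta int (fun=> 1) 2 0 isT isT.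
  by congr summable; apply/funext => j; rewrite mul1r.
rewrite (ssum_mul s20 s20) -mulr_natl -ssumMl; last exact: (summable_mul s20 s20).
apply: eq_ssum => p /=.
have -> : p.1 + p.2 + (p.1 - p.2) = 2 * p.1 by ring.
rewrite sg_even; congr (_ * _); first by ring.
by apply: theta_expMM => //; ring.
Qed.

(** Twice Ramanujan's psi(q^2), since the sum runs over all integers. *)
Definition psi2sum : series int := ssum (fun j : int => q ^+ theta_exp 1 1 j).

Lemma phi_sqrB : phi ^+ 2 - phi_minus ^+ 2 = q * dil 2 psi2sum ^+ 2 *+ 2.
Proof.
rewrite -[phi_minus ^+ 2]mul1r -mulNr phi_sqr_coset ?mulrNN ?mulr1 // ssum_cosets2; last exact: summable_phi_coset.
rewrite [X in X + _](_ : _ = 0) ?add0r; last first.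
  rewrite -[RHS](ssum0 int (int * int)%type); apply: eq_ssum => p /=.
  have -> : p.1 + p.2 + (p.1 - p.2) = 2 * p.1 by ring.
  by rewrite sg_even mulr1 subrr mul0r.
have s11 d : (0 < d)%N -> summable (fun j : int => q ^+ theta_exp d d j).
  move=> d0; have := @summable_theta int (fun=> 1) d d d0 (leqnn d).
  by congr summable; apply/funext => j; rewrite mul1r.
have -> : dil 2 psi2sum = ssum (fun j : int => q ^+ theta_exp 2 2 j).
  rewrite (@ssum_morph _ _ (@dil int 2)) //; first last.
  - exact: s11.
  - by move=> n a; apply: eqmodq_dil0.
  by apply: eq_ssum => j; rewrite /= dil_qq //; congr (q ^+ _); rewrite /theta_exp; lia.
have s22 := s11 2 isT; rewrite expr2 (ssum_mul s22 s22) -mulrnAl -ssumMl; last exact: (summable_mul s22 s22).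
apply: eq_ssum => p /=.
have -> : p.1 + p.2 + 1 + (p.1 - p.2) = 2 * p.1 + 1 by ring.
rewrite sgD sg_even /sg expr1 mul1r mulN1r opprK mulrnAl -mulr_natl; congr (_ * _).
rewrite (theta_expM (j := p.1 + p.2 + 1) (j' := p.1 - p.2) (x := (p.1 + p.2 + 1) ^+ 2 + (p.1 - p.2) ^+ 2)) //; last by ring.
rewrite (theta_expM (x := 2 * p.1 ^+ 2 + 2 * p.1 + (2 * p.2 ^+ 2 + 2 * p.2))) // -exprS; congr (q ^+ _).
have -> : (p.1 + p.2 + 1) ^+ 2 + (p.1 - p.2) ^+ 2 = 2 * p.1 ^+ 2 + 2 * p.1 + (2 * p.2 ^+ 2 + 2 * p.2) + 1 by ring.
by have := @theta_exp_ge0 2 2 p.1 isT; have := @theta_exp_ge0 2 2 p.2 isT; lia.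
Qed.

(** Jacobi's phi(q)^4 - phi(-q)^4 = 16 q psi(q^2)^4, obtained by factoring the left side as a
    difference of squares. *)
Lemma phi_quarticB : (phi ^+ 4 - phi_minus ^+ 4) * f 2 ^+ 4 = q * f 4 ^+ 8 *+ 16.
Proof.
apply: (@sreg _ (f 4 ^+ 2 * f 8 ^+ 4)); first by rewrite !coefsM1 ?coefsX0 ?euler_coef0.
have E1 : dil 2 psi2sum * f 4 = f 8 ^+ 2 *+ 2.
  by have := congr1 (dil 2) psi2; rewrite rmorphM rmorphMn rmorphXn /= !dil_euler.
have E2 : dil 2 phi * (f 2 ^+ 2 * f 8 ^+ 2) = f 4 ^+ 5.
  by have := congr1 (dil 2) phiE; rewrite rmorphXn rmorphM /= [dil 2 (_ * _)]rmorphM !rmorphXn /= !dil_euler.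
transitivity ((phi ^+ 2 - phi_minus ^+ 2) * (phi ^+ 2 + phi_minus ^+ 2) * (f 4 ^+ 2 * f 8 ^+ 4 * f 2 ^+ 4)); first by ring.
rewrite phi_sqrD phi_sqrB.
transitivity (q * (dil 2 psi2sum * f 4) ^+ 2 * (dil 2 phi * (f 2 ^+ 2 * f 8 ^+ 2)) ^+ 2 *+ 4); first by ring.
by rewrite E1 E2; ring.
Qed.

Definition theta_T1 : series int := ssum (fun m : int => (3 * m + 1)%:~R * q ^+ theta_exp 3 2 m).
Definition theta_T2 : series int := ssum (fun m : int => (6 * m + 1)%:~R * q ^+ theta_exp 3 1 m).

Lemma theta_T2E : f 4 ^+ 2 * theta_T2 = f 2 ^+ 5.
Proof.
have E : ssum (fun b : int => sg b * q ^+ theta_exp 2 0 b) * f 4 = f 2 ^+ 2.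
  rewrite (@triple_product_lt _ _ 2 0) ?mulrNN ?mulr1 //= subn0 addn0.
  have -> : f 2 = qprod (-1) 4 2 * f 4 := @euler_odd int 2 isT.
  by ring.
transitivity (f 4 * (f 4 * theta_T2)); first by ring.
by rewrite -quintuple_T2_aux mulrC -mulrA E; ring.
Qed.

(** The auxiliary identity evaluates the sum [S] with alternating signs. Since m (3 m + 2) has the
    parity of m, the substitution q -> -q removes the signs, and [alt_euler] eliminates f_1(-q). *)
Lemma theta_T1E : theta_T1 * f 2 = f 1 ^+ 2 * f 4 ^+ 2.
Proof.
pose S := ssum (fun m : int => ((-1) ^+ absz m * (3 * m + 1))%:~R * q ^+ theta_exp 3 2 m).
have sS : summable (fun m : int => ((-1) ^+ absz m * (3 * m + 1))%:~R * q ^+ theta_exp 3 2 m).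
  exact: summable_theta.
have ES : S * f 1 ^+ 2 = f 2 ^+ 5.
  apply: (dil_inj (_ : 0 < 2)%N) => //; rewrite rmorphM /= !rmorphXn /= !dil_euler //.
  have -> : dil 2 S = ssum (fun m : int => sg m * (3 * m + 1)%:~R * q ^+ theta_exp 6 4 m).
    rewrite dil_theta //; apply: eq_ssum => m; rewrite rmorphM sgE.
    by congr (_ * q ^+ _); rewrite /theta_exp; lia.
  apply: (@series_mulrnI 1); have := quintuple_T1_aux => /(congr1 ( *%R^~ (f 2))).
  rewrite -mulrA psi2 => E; rewrite (_ : f 4 ^+ 5 *+ 2 = f 4 ^+ 3 * (f 4 ^+ 2 *+ 2)); last by ring.
  by rewrite E; ring.
have aS : alt S = theta_T1.
  rewrite alt_theta_exp //; apply: eq_ssum => m; rewrite mulrA; congr (_ * _).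
  rewrite rmorphM rmorphXn rmorphN1 mulrAC -exprD -signr_odd.
  have -> : theta_exp 3 2 m = (absz m * absz (3 * m + 2)%R)%N.
    by rewrite /theta_exp -abszM; congr absz; ring.
  have O : odd (absz (3 * m + 2)) = odd (absz m) by lia.
  by rewrite oddD oddM O andbb addbb mul1r.
have alt2 : alt (f 2) = f 2 by apply: alt_dil_even.
have E := congr1 (@alt int) ES; rewrite rmorphM !rmorphXn /= aS alt2 in E.
apply: (@sreg _ (f 2 ^+ 5)); first by rewrite coefsX0 ?euler_coef0.
transitivity (theta_T1 * (f 2 ^+ 3) ^+ 2); first by ring.
rewrite -alt_euler; transitivity (theta_T1 * alt (f 1) ^+ 2 * (f 1 ^+ 2 * f 4 ^+ 2)); first by ring.
by rewrite E.
Qed.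

End EtaQuotients.

(** * Eisenstein series of level 4 *)

Section LogarithmicDerivatives.
Variable R : comNzRingType.
Implicit Types a b l m : series R.

(** The quotient theta(a) / a, kept as a relation; identities between eta quotients become linear in
    [l]. *)
Definition is_logder a l := theta a = a * l.

Lemma logderM a b l m : is_logder a l -> is_logder b m -> is_logder (a * b) (l + m).
Proof. by rewrite /is_logder thetaM => -> ->; ring. Qed.

Lemma logderX a l n : is_logder a l -> is_logder (a ^+ n) (l *+ n).
Proof.
move=> al; elim: n => [|n IH]; first by rewrite /is_logder theta1 mulr0n mulr0.
by rewrite exprS mulrS; apply: logderM.
Qed.

Lemma logder_uniq a l m : a 0 = 1 -> is_logder a l -> is_logder a m -> l = m.
Proof. by rewrite /is_logder => a0 -> /(sreg a0). Qed.

Lemma logder_cancel a b l m : a 0 = 1 ->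
  is_logder (a * b) m -> is_logder a l -> is_logder b (m - l).
Proof.
move=> a0; rewrite /is_logder thetaM => E al; apply: (sreg a0).
by rewrite al in E; transitivity (a * l * b + a * theta b - a * b * l); [ring | rewrite E; ring].
Qed.

Lemma logder_exists a : a 0 = 1 -> is_logder a (sinv a * theta a).
Proof. by move=> a0; rewrite /is_logder mulrA sinvP // mul1r. Qed.

Lemma logder_dil k a l : is_logder a l -> is_logder (dil k a) (dil k l *+ k).
Proof. by rewrite /is_logder theta_dil => ->; rewrite rmorphM mulrnAr. Qed.

Lemma logder_alt a l : is_logder a l -> is_logder (alt a) (alt l).
Proof. by rewrite /is_logder theta_alt => ->; rewrite rmorphM. Qed.

Lemma logder_coef0 a l : a 0 = 1 -> is_logder a l -> l 0 = 0.
Proof.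
move=> a0 /(congr1 (fun s => coefs s 0)); rewrite coefsM0 a0 mul1r => <-.
by rewrite /= mulr0n.
Qed.

Lemma coefsM_1 a b : (a * b) 1 = a 0 * b 1 + a 1 * b 0.
Proof. by rewrite coefsM big_ord_recl big_ord1. Qed.

Lemma coefsX_1 a n : a 0 = 1 -> (a ^+ n) 1 = a 1 *+ n.
Proof.
move=> a0; elim: n => // n IH.
by rewrite exprS coefsM_1 IH a0 mul1r (coefsX0 _ a0) mulr1 -mulrSr.
Qed.

Lemma coefs_dil_1 k a : (1 < k)%N -> dil k a 1 = 0.
Proof. by move=> k1; rewrite /= dvdn1 ifF //; case: eqP k1 => // ->. Qed.

End LogarithmicDerivatives.

Section LogderEuler.
Local Notation q := (qq int).
Local Notation f k := (euler int k).
Local Notation x := phi.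
Local Notation y := phi_minus.

(** Equals k (E_2(q^k) - 1) / 24, that is, minus k times the sum of sigma(n) q^(kn). *)
Definition el k : series int := sinv (f k) * theta (f k).
Local Notation L := el.

Lemma el_logder k : is_logder (f k) (L k).
Proof. by apply/logder_exists/euler_coef0. Qed.

Lemma dil_el k l : (0 < k)%N -> (0 < l)%N -> dil k (L l) *+ k = L (k * l).
Proof.
move=> k0 l0; apply: (logder_uniq (euler_coef0 _ _) _ (el_logder (k * l))).
by rewrite -dil_euler //; apply/logder_dil/el_logder.
Qed.

Lemma alt_el : alt (L 1) = L 2 *+ 3 - L 1 - L 4.
Proof.
have E : is_logder (alt (f 1) * f 1 * f 4) (L 2 *+ 3).
  by rewrite alt_euler; apply/logderX/el_logder.
apply: (@logder_uniq _ (alt (f 1))); first by rewrite alt_coef0 euler_coef0.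
  exact/logder_alt/el_logder.
rewrite -addrA -opprD; apply: (@logder_cancel _ (f 1 * f 4)); first by rewrite coefsM1 ?euler_coef0.
  by rewrite mulrC mulrA.
by apply: logderM; apply: el_logder.
Qed.

Lemma alt_el_even k : ~~ odd k -> alt (L k) = L k.
Proof.
move=> k2; have altk : alt (f k) = f k by apply: alt_dil_even.
apply: (@logder_uniq _ (f k)); first exact: euler_coef0; last exact: el_logder.
by rewrite -{1}altk; apply/logder_alt/el_logder.
Qed.

Lemma phi_minus_coef0 : y 0 = 1.
Proof.
have := congr1 (fun s => coefs s 0) phi_minusE.
by rewrite coefsM0 euler_coef0 mulr1 coefsX0 ?euler_coef0.
Qed.

Lemma phi_coef0 : x 0 = 1.
Proof. by rewrite -alt_phi_minus alt_coef0 phi_minus_coef0. Qed.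

Lemma euler1_coef1 : f 1 1 = -1.
Proof.
rewrite /euler dil1 /qprod.
rewrite (iprod_trunc (@tame_qprod int (-1) 1 1 isT isT) (leqnn 1)) // big_ord1.
by rewrite mulN1r coefsD coefsN coefs1 coefs_qX.
Qed.

Lemma phi_minus_coef1 : y 1 = -2.
Proof.
have := congr1 (fun s => coefs s 1) phi_minusE.
rewrite coefsM_1 coefs_dil_1 // euler_coef0 coefsX_1 ?euler_coef0 // euler1_coef1.
by rewrite mulr0 mulr1 add0r => ->.
Qed.

Lemma phi_coef1 : x 1 = 2.
Proof. by rewrite -alt_phi_minus -[LHS]/((-1) ^+ 1 * y 1) phi_minus_coef1. Qed.

Lemma phi_minus_logder : is_logder y (L 1 *+ 2 - L 2).
Proof.
apply: (@logder_cancel _ (f 2)); first exact: euler_coef0; last exact: el_logder.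
by rewrite mulrC phi_minusE; apply/logderX/el_logder.
Qed.

Lemma phi_logder : is_logder x (L 2 *+ 5 - (L 1 *+ 2 + L 4 *+ 2)).
Proof.
apply: (@logder_cancel _ (f 1 ^+ 2 * f 4 ^+ 2)).
- by rewrite coefsM1 ?coefsX0 ?euler_coef0.
- by rewrite mulrC phiE; apply/logderX/el_logder.
by apply: logderM; apply/logderX/el_logder.
Qed.

(* Both sides of phi_quarticB_el satisfy the same functional equation under q -> q^2, and
   dil_eps says so for their difference; it determines eps by its coefficient of q. *)
Definition eps : series int := L 2 *+ 24 - L 1 *+ 16 - L 4 *+ 8 - x ^+ 4 + y ^+ 4.

Lemma el_coef0 k : L k 0 = 0.
Proof. exact: logder_coef0 (euler_coef0 _ _) (el_logder k). Qed.

Lemma el1_coef1 : L 1 1 = -1.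
Proof.
have := congr1 (fun s => coefs s 1) (el_logder 1).
by rewrite coefsM_1 euler_coef0 el_coef0 mulr0 addr0 mul1r => <-; rewrite /= -[RHS]euler1_coef1.
Qed.

Lemma el_coef1 k : (1 < k)%N -> L k 1 = 0.
Proof.
move=> k1; have := @dil_el k 1 (ltnW k1) isT; rewrite muln1 => <-.
by rewrite coefsMn coefs_dil_1 // mul0rn.
Qed.

(** Logarithmic differentiation of [phi_sqrD]; [dil_phi_minus_logder] treats [phi_mul] in the same
    way. Together they express the logarithmic derivatives at q^2 through those at q. *)
Lemma dil_phi_logder :
  (x ^+ 2 + y ^+ 2) * dil 2 (L 2 *+ 5 - (L 1 *+ 2 + L 4 *+ 2)) *+ 2 =
  x ^+ 2 * (L 2 *+ 5 - (L 1 *+ 2 + L 4 *+ 2)) + y ^+ 2 * (L 1 *+ 2 - L 2).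
Proof.
have lx := phi_logder; have ly := phi_minus_logder.
move: (_ - (_ + _)) lx (L 1 *+ 2 - L 2) ly => lx Ex ly Ey.
have E : is_logder (dil 2 x ^+ 2) (dil 2 lx *+ 2 *+ 2) by apply/logderX/logder_dil.
have := congr1 (@theta int) phi_sqrD; rewrite raddfMn /= E raddfD /=.
rewrite (logderX 2 Ex) (logderX 2 Ey) => {}E.
apply: (@series_mulrnI 1); transitivity ((x ^+ 2 + y ^+ 2) * (dil 2 lx *+ 2 *+ 2)); first by ring.
by rewrite phi_sqrD mulrnAl -E; ring.
Qed.

Lemma dil_phi_minus_logder :
  dil 2 (L 1 *+ 2 - L 2) *+ 4 =
  (L 2 *+ 5 - (L 1 *+ 2 + L 4 *+ 2)) + (L 1 *+ 2 - L 2).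
Proof.
apply: (@logder_uniq _ (x * y)); first by rewrite coefsM1 ?phi_coef0 ?phi_minus_coef0.
  rewrite phi_mul (mulrnA _ 2 2); apply/logderX/logder_dil; exact: phi_minus_logder.
by apply: logderM; [exact: phi_logder | exact: phi_minus_logder].
Qed.

Lemma dil_phi_quartic : dil 2 (x ^+ 4) *+ 4 = (x ^+ 2 + y ^+ 2) ^+ 2.
Proof. by rewrite phi_sqrD rmorphXn /=; ring. Qed.

Lemma dil_phi_minus_quartic : dil 2 (y ^+ 4) = x ^+ 2 * y ^+ 2.
Proof. by rewrite rmorphXn /= -[4%N]/(2 * 2)%N exprM -phi_mul; ring. Qed.

Lemma dil_eps : (x ^+ 2 + y ^+ 2) * dil 2 eps *+ 4 = (x ^+ 2 - y ^+ 2) * eps.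
Proof.
pose lx := L 2 *+ 5 - (L 1 *+ 2 + L 4 *+ 2); pose ly := L 1 *+ 2 - L 2.
have -> : eps = (lx - ly) *+ 4 - x ^+ 4 + y ^+ 4 by rewrite /eps /lx /ly; ring.
rewrite rmorphD rmorphB rmorphMn rmorphB /= dil_phi_minus_quartic.
have := dil_phi_logder; have := dil_phi_minus_logder; have := dil_phi_quartic.
rewrite -/lx -/ly; move: (dil 2 lx) (dil 2 ly) (dil 2 (x ^+ 4)) => lx2 ly2 X EX Ey Ex.
transitivity (((x ^+ 2 + y ^+ 2) * lx2 *+ 2) *+ 8 - (x ^+ 2 + y ^+ 2) * (ly2 *+ 4) *+ 4 -
  (x ^+ 2 + y ^+ 2) * (X *+ 4) + (x ^+ 2 + y ^+ 2) * (x ^+ 2 * y ^+ 2) *+ 4); first by ring.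
by rewrite Ex Ey EX; ring.
Qed.

Lemma eps_eq0 : eps = 0.
Proof.
have x0 := phi_coef0; have y0 := phi_minus_coef0.
have B0 : (x ^+ 2 - y ^+ 2) 0 = 0 by rewrite coefsB !coefsX0 // subrr.
have B1 : (x ^+ 2 - y ^+ 2) 1 = 8.
  by rewrite coefsB !coefsX_1 // phi_coef1 phi_minus_coef1.
have e0 : eps 0 = 0.
  by rewrite /eps coefsD !coefsB !coefsMn !el_coef0 !mul0rn !coefsX0.
have e1 : eps 1 = 0.
  rewrite /eps coefsD !coefsB !coefsMn el1_coef1 !el_coef1 // !mul0rn !coefsX_1 //.
  by rewrite phi_coef1 phi_minus_coef1.
apply: seriesP => n; rewrite coefs0; elim/ltn_ind: n => -[|[|n]] IH //.
have En : eqmodq n.+2 eps 0 by move=> i i_n; rewrite IH.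
(* In [dil_eps] at q^(n+3) the left side is 0, because dilation doubles orders, and the right side
   is 8 times [eps n.+2], because x^2 - y^2 starts with 8 q. *)
have : (((x ^+ 2 + y ^+ 2) * dil 2 eps) *+ 4) n.+3 = 0.
  rewrite coefsMn; have -> : ((x ^+ 2 + y ^+ 2) * dil 2 eps) n.+3 = 0; last by rewrite mul0rn.
  have E2 : eqmodq (2 * n.+2) (dil 2 eps) 0.
    by rewrite -(rmorph0 (@dil int 2)); apply: eqmodq_dil.
  by rewrite (eqmodqM (@eqmodq_refl _ _ (x ^+ 2 + y ^+ 2)) E2) ?mulr0 //; lia.
rewrite dil_eps coefsM big_ord_recl big_ord_recl big1 => [|i _]; last first.
  by rewrite IH ?mulr0 //= /bump; lia.
by rewrite B0 mul0r add0r addr0 B1 subn1 => /eqP; rewrite mulf_eq0 => /eqP.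
Qed.

Lemma phi_quarticB_el : x ^+ 4 - y ^+ 4 = L 2 *+ 24 - L 1 *+ 16 - L 4 *+ 8.
Proof. by rewrite -[RHS](subrK (x ^+ 4 - y ^+ 4)); have := eps_eq0; rewrite /eps => E; rewrite -[LHS]add0r -E; ring. Qed.

(* Jacobi's four-square theorem in the form phi^4 = (4 E_2(q^4) - E_2(q)) / 3. *)
Theorem four_squares : x ^+ 4 = 1 + (L 4 - L 1) *+ 8.
Proof.
pose e := 1 + (L 4 - L 1) *+ 8 - x ^+ 4.
have aL := alt_el; have a2 := @alt_el_even 2 isT; have a4 := @alt_el_even 4 isT.
have ae : alt e = 1 + (L 4 *+ 2 - L 2 *+ 3 + L 1) *+ 8 - y ^+ 4.
  rewrite /e rmorphB rmorphD rmorph1 rmorphMn rmorphB /= aL a4 rmorphXn /= alt_phi.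
  by ring.
have eB : alt e = e.
  by rewrite ae -[y ^+ 4](subKr (x ^+ 4)) phi_quarticB_el /e; ring.
have d2 : dil 2 e *+ 2 = 1 *+ 2 + (L 8 - L 2) *+ 8 - dil 2 (x ^+ 4) *+ 2.
  by rewrite /e rmorphB rmorphD rmorph1 rmorphMn rmorphB /= -(@dil_el 2 4) // -(@dil_el 2 1) //; ring.
have d2' : dil 2 e *+ 2 = 1 *+ 2 + (L 8 *+ 2 - L 4 *+ 3 + L 2) *+ 8 - dil 2 (y ^+ 4) *+ 2.
  rewrite -eB ae rmorphB rmorphD rmorph1 rmorphMn rmorphD rmorphB !rmorphMn /=.
  have := @dil_el 2 4 isT isT; have := @dil_el 2 2 isT isT; have := @dil_el 2 1 isT isT.
  by move: (dil 2 _) (dil 2 _) (dil 2 _) (dil 2 _) => u v w t /= <- <- <-; ring.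
(* Since [e] is even, [dil 2 e] has two expressions, one from [e] and one from [alt e]. Twice the
   first minus the second is e + alt e = 2 e. *)
have de : dil 2 e = e.
  apply: (@series_mulrnI 1); transitivity ((dil 2 e *+ 2) *+ 2 - dil 2 e *+ 2); first by ring.
  rewrite (congr2 (fun u v => u *+ 2 - v) d2 d2') dil_phi_minus_quartic.
  transitivity (1 *+ 2 + (L 4 - L 2) *+ 24 - dil 2 (x ^+ 4) *+ 4 + x ^+ 2 * y ^+ 2 *+ 2); first by ring.
  rewrite dil_phi_quartic; transitivity (e + alt e); last by rewrite eB mulr2n.
  by rewrite ae /e; ring.
suff e0 : e = 0 by rewrite -[LHS]addr0 -e0 /e; ring.
have e00 : e 0 = 0.
  by rewrite /e coefsB coefsD coefsMn coefsB !el_coef0 coefsX0 ?phi_coef0.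
(* A series fixed by q -> q^2 equals its constant term, here 0. *)
apply: seriesP => n; elim/ltn_ind: n => n IH.
rewrite -de coefs_dil; case: ifP => // _.
case: n IH => [|n] IH; first by rewrite div0n.
by apply: IH; rewrite ltn_Pdiv.
Qed.

(* Y k = k E_2(q^k). *)
#[local] Opaque el.
Definition Y k : series int := k%:R + L k *+ 24.

Lemma dil_Y k : (0 < k)%N -> dil 2 (Y k) *+ 2 = Y (2 * k).
Proof.
move=> k0; rewrite /Y; have -> : dil 2 (k%:R + L k *+ 24) = k%:R + dil 2 (L k) *+ 24.
  by rewrite rmorphD; congr (_ + _); [exact: rmorph_nat | exact: rmorphMn].
transitivity ((2 * k)%N%:R + (dil 2 (L k) *+ 2) *+ 24 : series int).
  have -> : (2 * k)%N%:R = k%:R *+ 2 :> series int by rewrite mulnC mulrnA.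
  by move: (k%:R) (dil 2 _) => t u; ring.
by congr (_ + _ *+ 24); apply: dil_el.
Qed.

Lemma Y4_Y1 : Y 4 - Y 1 = x ^+ 4 *+ 3.
Proof. by rewrite four_squares /Y; ring. Qed.

Lemma Y4_Y2 : Y 4 - Y 2 = x ^+ 4 + y ^+ 4.
Proof.
have E := phi_quarticB_el; have -> : y ^+ 4 = x ^+ 4 - (x ^+ 4 - y ^+ 4) by ring.
by rewrite E four_squares /Y; ring.
Qed.

Lemma Y1E : Y 1 = Y 4 - x ^+ 4 *+ 3.
Proof. by rewrite -Y4_Y1 subKr. Qed.

Lemma Y2E : Y 2 = Y 4 - (x ^+ 4 + y ^+ 4).
Proof. by rewrite -Y4_Y2 subKr. Qed.

Lemma theta_phi_quartic : theta (x ^+ 4) *+ 6 = x ^+ 4 * (Y 4 + x ^+ 4 - y ^+ 4 *+ 5).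
Proof.
transitivity (x ^+ 4 * (Y 2 *+ 5 - Y 1 *+ 2 - Y 4 *+ 2)).
  by rewrite (logderX 4 phi_logder) /Y; ring.
by rewrite Y1E Y2E; ring.
Qed.

Lemma theta_phi_minus_quartic : theta (y ^+ 4) *+ 6 = y ^+ 4 * (Y 4 + y ^+ 4 - x ^+ 4 *+ 5).
Proof.
transitivity (y ^+ 4 * (Y 1 *+ 2 - Y 2)).
  by rewrite (logderX 4 phi_minus_logder) /Y; ring.
by rewrite Y1E Y2E; ring.
Qed.

(* Ramanujan's equation for E_2(q^2). *)
Theorem theta_Y2 :
  theta (Y 2) *+ 12 = Y 2 ^+ 2 - (y ^+ 8 - y ^+ 4 * x ^+ 4 + x ^+ 8) *+ 4.
Proof.
set b := y ^+ 4; set c := x ^+ 4.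
have -> : y ^+ 8 = b ^+ 2 by rewrite -exprM.
have -> : x ^+ 8 = c ^+ 2 by rewrite -exprM.
pose d := theta (Y 2) *+ 12 - Y 2 ^+ 2 + (b ^+ 2 - b * c + c ^+ 2) *+ 4.
suff d0 : d = 0 by rewrite -[LHS]subr0 -d0 /d; ring.
have Y42 : Y 4 = Y 2 + c + b by rewrite Y2E /b /c; ring.
have E4 : dil 2 (Y 2) *+ 2 = Y 4 by rewrite dil_Y.
have Et : dil 2 (theta (Y 2)) *+ 4 = theta (Y 4).
  by rewrite -E4 raddfMn /= theta_dil; ring.
have Ec : dil 2 c *+ 4 = b + c + x ^+ 2 * y ^+ 2 *+ 2.
  by rewrite dil_phi_quartic /b /c; ring.
have Eb : dil 2 b = x ^+ 2 * y ^+ 2 := dil_phi_minus_quartic.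
have Eb2 : (x ^+ 2 * y ^+ 2) ^+ 2 = b * c by rewrite /b /c; ring.
(* Every ingredient of [d] is known at q^2, which gives 4 d(q^2) = d(q). The constant term is then
   0, and halving exponents kills all the others. *)
have dd : dil 2 d *+ 4 = d.
  have -> : dil 2 d = dil 2 (theta (Y 2)) *+ 12 - dil 2 (Y 2) ^+ 2 +
    (dil 2 b ^+ 2 - dil 2 b * dil 2 c + dil 2 c ^+ 2) *+ 4 by rewrite /d; ring.
  rewrite Eb.
  transitivity ((dil 2 (theta (Y 2)) *+ 4) *+ 12 - (dil 2 (Y 2) *+ 2) ^+ 2 +
    ((x ^+ 2 * y ^+ 2) ^+ 2 *+ 16 - (x ^+ 2 * y ^+ 2) * (dil 2 c *+ 4) *+ 4 + (dil 2 c *+ 4) ^+ 2)); first by ring.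
  rewrite Et E4 Ec; move: (x ^+ 2 * y ^+ 2) Eb2 => u Eu.
  have -> : theta (Y 4) *+ 12 = theta (Y 2) *+ 12 + (b * (Y 4 + b - c *+ 5) + c * (Y 4 + c - b *+ 5)) *+ 2.
    by rewrite -theta_phi_quartic -theta_phi_minus_quartic Y42 !raddfD /=; ring.
  transitivity (theta (Y 2) *+ 12 + (b * (Y 4 + b - c *+ 5) + c * (Y 4 + c - b *+ 5)) *+ 2 - Y 4 ^+ 2 +
    (u ^+ 2 *+ 12 + (b + c) ^+ 2)); first by ring.
  by rewrite Eu Y42 /d; ring.
apply: seriesP => n; rewrite coefs0; elim/ltn_ind: n => n IH.
have := congr1 (fun s => coefs s n) dd; rewrite coefsMn coefs_dil; case: ifP => _ E; last by rewrite -E mul0rn.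
case: n IH E => [|n] IH; first by rewrite div0n; lia.
by rewrite IH ?ltn_Pdiv // mul0rn.
Qed.

(** Up to the factor 4 the right side is the Wronskian of q^(1/3) T1 and q^(1/12) T2, where 4 (1/3 -
    1/12) = 1 accounts for the first term. Since T1 and T2 are eta quotients it equals T1 T2 (1 + 8
    L1 - 24 L2 + 16 L4), and the last factor is phi(-q)^4. *)
Lemma euler_pow10 :
  f 1 ^+ 10 = theta_T1 * theta_T2 + (theta_T2 * theta theta_T1 - theta_T1 * theta theta_T2) *+ 4.
Proof.
have E1 : is_logder theta_T1 (L 1 *+ 2 + L 4 *+ 2 - L 2).
  apply: (@logder_cancel _ (f 2)); first exact: euler_coef0; last exact: el_logder.
  by rewrite mulrC theta_T1E; apply: logderM; apply/logderX/el_logder.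
have E2 : is_logder theta_T2 (L 2 *+ 5 - L 4 *+ 2).
  apply: (@logder_cancel _ (f 4 ^+ 2)); first by rewrite coefsX0 ?euler_coef0.
    by rewrite theta_T2E; apply/logderX/el_logder.
  exact/logderX/el_logder.
have b8 : y ^+ 4 = 1 + L 1 *+ 8 - L 2 *+ 24 + L 4 *+ 16.
  by rewrite -[LHS](subKr (x ^+ 4)) phi_quarticB_el four_squares; ring.
transitivity (theta_T1 * theta_T2 * y ^+ 4); last by rewrite E1 E2 b8; ring.
apply: (@sreg _ (f 2 ^+ 5 * f 4 ^+ 2)); first by rewrite coefsM1 ?coefsX0 ?euler_coef0.
transitivity ((theta_T1 * f 2) * (f 4 ^+ 2 * theta_T2) * (y * f 2) ^+ 4); last by ring.
by rewrite theta_T1E theta_T2E phi_minusE; ring.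
Qed.

End LogderEuler.

(** * Congruences modulo 11 and 5 *)

Section Twists.
Variable R : comNzRingType.
Implicit Types (g h : nat -> R) (a : series R).

Definition twist g a : series R := Series (fun n => g n * a n).

Fact twist_zmod g : zmod_morphism (twist g).
Proof. by move=> a b; apply: seriesP => n; rewrite /= mulrBr. Qed.
HB.instance Definition _ g := GRing.isZmodMorphism.Build _ _ (twist g) (twist_zmod g).

Lemma twist_comp g h a : twist g (twist h a) = twist (fun n => g n * h n) a.
Proof. by apply: seriesP => n; rewrite /= mulrA. Qed.

Lemma eq_twist g h a : g =1 h -> twist g a = twist h a.
Proof. by move=> gh; apply: seriesP => n; rewrite /= gh. Qed.

Lemma eqmodq_twist g n a : eqmodq n a 0 -> eqmodq n (twist g a) 0.
Proof. by move=> an i i_n; rewrite /= an // mulr0. Qed.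

Lemma twist_linear k l a :
  twist (fun n => (k * n + l)%:R) a = k%:R * theta a + l%:R * a.
Proof.
apply: seriesP => n; rewrite coefsD !mulr_natl !coefsMn /=.
by rewrite natrD mulrDl !mulr_natl mulrnA mulrnAC.
Qed.

Lemma twist_iter k l m a :
  iter m (twist (fun n => (k * n + l)%:R)) a = twist (fun n => (k * n + l)%:R ^+ m) a.
Proof.
elim: m => [|m IH] /=; first by apply: seriesP => n; rewrite /= expr0 mul1r.
by rewrite IH twist_comp; apply: eq_twist => n; rewrite exprS.
Qed.

End Twists.

Lemma smap_twist (R S : comNzRingType) (f : {rmorphism R -> S}) g a :
  smap f (twist g a) = twist (f \o g) (smap f a).
Proof. by apply: seriesP => n; rewrite /= rmorphM. Qed.

Lemma coefs_intrM (R : comNzRingType) (m : int) (a : series R) n :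
  (m%:~R * a) n = m%:~R * a n.
Proof.
have H (k : nat) : (k%:~R * a) n = k%:~R * a n.
  by rewrite -!pmulrn !mulr_natl coefsMn.
case: m => m; first exact: H.
by rewrite NegzE !rmorphN !mulNr coefsN H.
Qed.

Lemma twist_int_qX (g : nat -> int) (k : int) e :
  twist g (k%:~R * qq int ^+ e) = (g e * k)%:~R * qq int ^+ e.
Proof.
have C (m : int) n : (m%:~R * qq int ^+ e) n = m * (n == e)%:R.
  by rewrite coefs_intrM intz coefs_qX.
by apply: seriesP => n; rewrite -[LHS]/(g n * (k%:~R * qq int ^+ e) n) !C mulrA; case: eqP => [->|_] //; rewrite !mulr0.
Qed.

Lemma smap_euler (R S : comNzRingType) (f : {rmorphism R -> S}) k :
  smap f (euler R k) = euler S k.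
Proof.
rewrite /euler smap_dil; congr (dil k _); apply: seriesP => n.
rewrite -[LHS]/(smap f (\prod_(i < n) (1 + -1 * qq R ^+ (1 * i + 1))) n) rmorph_prod.
suff -> : \prod_(i < n) smap f (1 + -1 * qq R ^+ (1 * i + 1)) =
  \prod_(i < n) (1 + -1 * qq S ^+ (1 * i + 1)) by [].
by apply: eq_bigr => i _; rewrite rmorphD rmorphM rmorphN !rmorph1 rmorphXn /= smap_qq.
Qed.

Notation S11 := (series 'F_11).

Lemma char11 (a : S11) : a *+ 11 = 0.
Proof.
apply: seriesP => n; rewrite coefsMn -mulr_natl.
by have /andP[_ /eqP ->] : 11%N \in [pchar 'F_11] by []; rewrite mul0r.
Qed.

Lemma fermat11 (m : int) : m%:~R ^+ 11 = m%:~R :> 'F_11.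
Proof. by have := expf_card (m%:~R : 'F_11); rewrite card_Fp. Qed.

Lemma fermat11_series (m : int) : m%:~R ^+ 11 = m%:~R :> S11.
Proof.
have C k n : (k%:~R : S11) n = k%:~R * (1 : S11) n.
  by rewrite -coefs_intrM mulr1.
by apply: seriesP => n; rewrite -rmorphXn !C [X in X * _]rmorphXn fermat11.
Qed.

Lemma mulr2n_inj11 (x y : S11) : x *+ 2 = y *+ 2 -> x = y.
Proof.
move=> E; transitivity ((x *+ 2) *+ 6 - x *+ 11); first by ring.
by rewrite E char11 -(char11 y); ring.
Qed.

(** * Derivatives and Eisenstein series modulo 11 *)

Section Mod11.
Notation S := (smap (intmul (1 : 'F_11))).
Local Notation f k := (euler 'F_11 k).

(* E_2(q^2), phi(-q)^4 and phi(q)^4 generate a ring that is closed under theta. *)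
Definition P : S11 := S (Y 2).
Definition b : S11 := S (phi_minus ^+ 4).
Definition c : S11 := S (phi ^+ 4).

Lemma S_Y4 : S (Y 4) = P + b + c.
Proof. by rewrite /P /b /c Y2E; ring. Qed.

(** The integral identity for 6 theta, multiplied by 2, the inverse of 6 modulo 11. *)
Lemma theta_b : theta b = 2 * b * (P + 2 * b - 4 * c).
Proof.
have := congr1 S theta_phi_minus_quartic.
have -> : S (phi_minus ^+ 4 * (Y 4 + phi_minus ^+ 4 - phi ^+ 4 *+ 5)) =
  b * (P + b + c + b - c *+ 5) by rewrite -S_Y4 /b /c; ring.
rewrite rmorphMn /= smap_theta -/b => E.
transitivity (theta b *+ 6 *+ 2 - theta b *+ 11); first by ring.
by rewrite E char11; ring.
Qed.

Lemma theta_c : theta c = 2 * c * (P + 2 * c - 4 * b).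
Proof.
have := congr1 S theta_phi_quartic.
have -> : S (phi ^+ 4 * (Y 4 + phi ^+ 4 - phi_minus ^+ 4 *+ 5)) =
  c * (P + b + c + c - b *+ 5) by rewrite -S_Y4 /b /c; ring.
rewrite rmorphMn /= smap_theta -/c => E.
transitivity (theta c *+ 6 *+ 2 - theta c *+ 11); first by ring.
by rewrite E char11; ring.
Qed.

Lemma theta_P : theta P = P ^+ 2 - 4 * b ^+ 2 + 4 * b * c - 4 * c ^+ 2.
Proof.
have := congr1 S theta_Y2.
have -> : S (Y 2 ^+ 2 - (phi_minus ^+ 8 - phi_minus ^+ 4 * phi ^+ 4 + phi ^+ 8) *+ 4) =
  P ^+ 2 - (b ^+ 2 - b * c + c ^+ 2) *+ 4 by rewrite /P /b /c; ring.
rewrite rmorphMn /= smap_theta -/P => E.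
transitivity (theta P *+ 12 - theta P *+ 11); first by ring.
by rewrite E char11; ring.
Qed.

Lemma der_add (u v u' v' : S11) : theta u = u' -> theta v = v' -> theta (u + v) = u' + v'.
Proof. by move=> <- <-; rewrite raddfD. Qed.
Lemma der_opp (u u' : S11) : theta u = u' -> theta (- u) = - u'.
Proof. by move=> <-; rewrite raddfN. Qed.
Lemma der_mul (u v u' v' : S11) : theta u = u' -> theta v = v' -> theta (u * v) = u' * v + u * v'.
Proof. by move=> <- <-; rewrite thetaM. Qed.
Lemma der_exp (u u' : S11) n : theta u = u' -> theta (u ^+ n.+1) = u ^+ n * u' *+ n.+1.
Proof. by move=> <-; rewrite thetaX. Qed.

Ltac der := lazymatch goal with |- theta ?u = _ => lazymatch u with
  | P => apply theta_P | b => apply theta_b | c => apply theta_c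
  | 1 => apply theta1 | _%:R => apply theta_nat
  | _ ^+ _ => eapply der_exp; der | - _ => eapply der_opp; der
  | _ + _ => eapply der_add; der | _ * _ => eapply der_mul; der end end.

(** The identities below hold modulo 11 only, while [ring] works with integer constants. Each is
    therefore certified by its explicit quotient [r] by 11, the argument given to the tactics. *)
Lemma mod11_step (m w w' r k rhs : S11) : theta w = w' ->
  m * w' + k = rhs + r *+ 11 -> m * theta w + k = rhs.
Proof. by rewrite char11 addr0 => ->. Qed.

Ltac mod11_theta r := eapply (@mod11_step _ _ _ r); [der | ring].
Ltac mod11 r := rewrite -[RHS]addr0 -(char11 r); ring.

(* The Eisenstein series E_10(q^2) and E_12(q^2), which modulo 11 are 1 and E_2(q^2). *)
Definition E10 : S11 :=
  - b ^+ 5 - 3 * b ^+ 4 * c - b ^+ 3 * c ^+ 2 - b ^+ 2 * c ^+ 3 - 3 * b * c ^+ 4 - c ^+ 5.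
Definition H12 : S11 := 2 * b ^+ 6 + 5 * b ^+ 5 * c - b ^+ 3 * c ^+ 3 + 5 * b * c ^+ 5 + 2 * c ^+ 6.

(** A Serre derivative in weight 10, as - 10 / 12 = 1 modulo 11. Once [E10] is known to be 1 it says
    that the quasimodular [P] is the polynomial [H12] in [b] and [c]. *)
Lemma theta_E10 : 1%:R * theta E10 + P * E10 = H12.
Proof. by rewrite /E10 /H12; mod11_theta (- P * b ^+ 5 - 3 * P * b ^+ 4 * c - P * b ^+ 3 * c ^+ 2 - P * b ^+ 2 * c ^+ 3 - 3 * P * b * c ^+ 4 - P * c ^+ 5 - 2 * b ^+ 6 + b ^+ 5 * c + 8 * b ^+ 4 * c ^+ 2 + 3 * b ^+ 3 * c ^+ 3 + 8 * b ^+ 2 * c ^+ 4 + b * c ^+ 5 - 2 * c ^+ 6 : S11). Qed.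

Local Notation serreE w := (4%:R * theta w + 6 * P * w).
Local Notation serreF w := (8%:R * theta w + (4 * P + 3 * b - 6 * c) * w).

(* Iterates of 4 theta + 1 on the cube of euler 2, divided by that cube. By Jacobi's identity
   the fifth iterate is a Fermat power on each coefficient, hence trivial: this gives E10 = 1. *)
Local Notation E_1 := (- 5 * P : S11).
Lemma serreE1 : serreE (1 : S11) = E_1.
Proof. by mod11_theta (P : S11). Qed.

Local Notation E_2 := (5 * P ^+ 2 + 3 * b ^+ 2 - 3 * b * c + 3 * c ^+ 2 : S11).
Lemma serreE2 : serreE E_1 = E_2.
Proof. by mod11_theta (- 5 * P ^+ 2 + 7 * b ^+ 2 - 7 * b * c + 7 * c ^+ 2 : S11). Qed.

Local Notation E_3 := (4 * P ^+ 3 + 5 * P * b ^+ 2 - 5 * P * b * c + 5 * P * c ^+ 2 - 3 * b ^+ 3 - b ^+ 2 * c - b * c ^+ 2 - 3 * c ^+ 3 : S11).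
Lemma serreE3 : serreE E_2 = E_3.
Proof. by mod11_theta (6 * P ^+ 3 - 9 * P * b ^+ 2 + 9 * P * b * c - 9 * P * c ^+ 2 + 9 * b ^+ 3 - 13 * b ^+ 2 * c - 13 * b * c ^+ 2 + 9 * c ^+ 3 : S11). Qed.

Local Notation E_4 := (- 5 * P ^+ 4 + 4 * P ^+ 2 * b ^+ 2 - 4 * P ^+ 2 * b * c + 4 * P ^+ 2 * c ^+ 2 + 4 * P * b ^+ 3 + 5 * P * b ^+ 2 * c + 5 * P * b * c ^+ 2 + 4 * P * c ^+ 3 - 4 * b ^+ 4 - 3 * b ^+ 3 * c - b ^+ 2 * c ^+ 2 - 3 * b * c ^+ 3 - 4 * c ^+ 4 : S11).
Lemma serreE4 : serreE E_3 = E_4.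
Proof. by mod11_theta (7 * P ^+ 4 - 6 * P ^+ 2 * b ^+ 2 + 6 * P ^+ 2 * b * c - 6 * P ^+ 2 * c ^+ 2 + 6 * P * b ^+ 3 - 25 * P * b ^+ 2 * c - 25 * P * b * c ^+ 2 + 6 * P * c ^+ 3 - 20 * b ^+ 4 + 41 * b ^+ 3 * c - 13 * b ^+ 2 * c ^+ 2 + 41 * b * c ^+ 3 - 20 * c ^+ 4 : S11). Qed.

(** The powers of [P] disappear as in Bol's identity: in the r-th derivative of a form of weight k
    their coefficients contain k + r - 1, here 3/2 + 4 = 11/2. *)
Lemma serreE5 : serreE E_4 = - b ^+ 5 - 3 * b ^+ 4 * c - b ^+ 3 * c ^+ 2 - b ^+ 2 * c ^+ 3 - 3 * b * c ^+ 4 - c ^+ 5.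
Proof. by mod11_theta (- 10 * P ^+ 5 + 40 * P ^+ 3 * b ^+ 2 - 40 * P ^+ 3 * b * c + 40 * P ^+ 3 * c ^+ 2 + 24 * P ^+ 2 * b ^+ 3 - 2 * P ^+ 2 * b ^+ 2 * c - 2 * P ^+ 2 * b * c ^+ 2 + 24 * P ^+ 2 * c ^+ 3 - 8 * P * b ^+ 4 - 22 * P * b ^+ 3 * c - 82 * P * b ^+ 2 * c ^+ 2 - 22 * P * b * c ^+ 3 - 8 * P * c ^+ 4 - 29 * b ^+ 5 + 41 * b ^+ 4 * c + 19 * b ^+ 3 * c ^+ 2 + 19 * b ^+ 2 * c ^+ 3 + 41 * b * c ^+ 4 - 29 * c ^+ 5 : S11). Qed.

(* Iterates of 8 theta + 5 on f 1 ^+ 9 * f 2 ^+ 3, divided by that product. *)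
Local Notation F_1 := (4 * P + 3 * b + 5 * c : S11).
Lemma serreF1 : serreF (1 : S11) = F_1.
Proof. by mod11_theta (- c : S11). Qed.

Local Notation F_2 := (4 * P ^+ 2 - 5 * P * b - P * c - b ^+ 2 - 2 * b * c + 2 * c ^+ 2 : S11).
Lemma serreF2 : serreF F_1 = F_2.
Proof. by mod11_theta (4 * P ^+ 2 + 7 * P * b + 7 * P * c - 2 * b ^+ 2 - 35 * b * c : S11). Qed.

Local Notation F_3 := (3 * P ^+ 3 + 4 * P ^+ 2 * b + 3 * P ^+ 2 * c - 5 * P * b ^+ 2 + P * b * c - P * c ^+ 2 + 5 * b ^+ 3 - 2 * b ^+ 2 * c - 2 * b * c ^+ 2 + 5 * c ^+ 3 : S11).
Lemma serreF3 : serreF F_2 = F_3.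
Proof. by mod11_theta (7 * P ^+ 3 - 12 * P ^+ 2 * b - 5 * P ^+ 2 * c - 42 * P * b ^+ 2 + 54 * P * b * c - 19 * P * c ^+ 2 + 8 * b ^+ 3 + 6 * b ^+ 2 * c - 4 * b * c ^+ 2 + 13 * c ^+ 3 : S11). Qed.

Local Notation F_4 := (- 4 * P ^+ 4 - P ^+ 3 * b + 2 * P ^+ 3 * c - 5 * P ^+ 2 * b ^+ 2 + P ^+ 2 * b * c - P ^+ 2 * c ^+ 2 - P * b ^+ 3 - 4 * P * b ^+ 2 * c - 4 * P * b * c ^+ 2 - P * c ^+ 3 - 5 * b ^+ 4 - 2 * b ^+ 2 * c ^+ 2 + 4 * b * c ^+ 3 - 2 * c ^+ 4 : S11).
Lemma serreF4 : serreF F_3 = F_4.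
Proof. by mod11_theta (8 * P ^+ 4 + 14 * P ^+ 3 * b + 8 * P ^+ 3 * c - 33 * P ^+ 2 * b ^+ 2 - 12 * P ^+ 2 * b * c - 23 * P ^+ 2 * c ^+ 2 - 30 * P * b ^+ 3 + 55 * P * b ^+ 2 * c - 7 * P * b * c ^+ 2 + P * c ^+ 3 + 60 * b ^+ 4 - 108 * b ^+ 3 * c + 56 * b ^+ 2 * c ^+ 2 - 91 * b * c ^+ 3 + 44 * c ^+ 4 : S11). Qed.

Local Notation F_5 := (- P ^+ 5 - P ^+ 4 * b + 2 * P ^+ 4 * c - 3 * P ^+ 3 * b ^+ 2 + 5 * P ^+ 3 * b * c - 5 * P ^+ 3 * c ^+ 2 - 2 * P ^+ 2 * b ^+ 3 + 3 * P ^+ 2 * b ^+ 2 * c + 3 * P ^+ 2 * b * c ^+ 2 - 2 * P ^+ 2 * c ^+ 3 + 2 * P * b ^+ 4 + 3 * P * b ^+ 2 * c ^+ 2 + 5 * P * b * c ^+ 3 + 3 * P * c ^+ 4 + 4 * b ^+ 5 - 2 * b ^+ 4 * c - 5 * b ^+ 2 * c ^+ 3 + 2 * b * c ^+ 4 - 3 * c ^+ 5 : S11).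
Lemma serreF5 : serreF F_4 = F_5.
Proof. by mod11_theta (- 13 * P ^+ 5 - 5 * P ^+ 4 * b + 10 * P ^+ 4 * c + 20 * P ^+ 3 * b ^+ 2 - 47 * P ^+ 3 * b * c + 47 * P ^+ 3 * c ^+ 2 - 27 * P ^+ 2 * b ^+ 3 + 10 * P ^+ 2 * b ^+ 2 * c + 12 * P ^+ 2 * b * c ^+ 2 - 28 * P ^+ 2 * c ^+ 3 - 11 * P * b ^+ 4 - 18 * P * b ^+ 3 * c + 99 * P * b ^+ 2 * c ^+ 2 + 32 * P * b * c ^+ 3 - 15 * P * c ^+ 4 - 57 * b ^+ 5 + 128 * b ^+ 4 * c + 14 * b ^+ 3 * c ^+ 2 - 41 * b ^+ 2 * c ^+ 3 + 64 * b * c ^+ 4 - 19 * c ^+ 5 : S11). Qed.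

Local Notation F_6 := (5 * b ^+ 6 + b ^+ 5 * c + 3 * b ^+ 4 * c ^+ 2 + 2 * b ^+ 2 * c ^+ 4 + 2 * b * c ^+ 5 + 3 * c ^+ 6 : S11).
(** The same disappearance of [P]: the weight is 6 and 6 + 6 - 1 = 11. *)
Lemma serreF6 : serreF F_5 = F_6.
Proof. by mod11_theta (- 4 * P ^+ 6 - 5 * P ^+ 5 * b + 10 * P ^+ 5 * c - 5 * P ^+ 4 * b ^+ 2 + 8 * P ^+ 4 * b * c - 8 * P ^+ 4 * c ^+ 2 - 19 * P ^+ 3 * b ^+ 3 + 7 * P ^+ 3 * b ^+ 2 * c + 93 * P ^+ 3 * b * c ^+ 2 - 62 * P ^+ 3 * c ^+ 3 + 22 * P ^+ 2 * b ^+ 4 - 33 * P ^+ 2 * b ^+ 3 * c + 81 * P ^+ 2 * b ^+ 2 * c ^+ 2 - 20 * P ^+ 2 * b * c ^+ 3 + 48 * P ^+ 2 * c ^+ 4 + 66 * P * b ^+ 5 - 92 * P * b ^+ 4 * c - 5 * P * b ^+ 3 * c ^+ 2 - 117 * P * b ^+ 2 * c ^+ 3 - 71 * P * b * c ^+ 4 + 22 * P * c ^+ 5 + 53 * b ^+ 6 - 125 * b ^+ 5 * c + 27 * b ^+ 4 * c ^+ 2 + 51 * b ^+ 3 * c ^+ 3 - 26 * b ^+ 2 * c ^+ 4 + 91 * b * c ^+ 5 - 51 * c ^+ 6 : S11). Qed.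

Local Notation F_7 := (5 * P * b ^+ 6 + P * b ^+ 5 * c + 3 * P * b ^+ 4 * c ^+ 2 + 2 * P * b ^+ 2 * c ^+ 4 + 2 * P * b * c ^+ 5 + 3 * P * c ^+ 6 - 4 * b ^+ 7 - 3 * b ^+ 6 * c + b ^+ 5 * c ^+ 2 - 4 * b ^+ 3 * c ^+ 4 + b ^+ 2 * c ^+ 5 + 5 * b * c ^+ 6 - 3 * c ^+ 7 : S11).
Lemma serreF7 : serreF F_6 = F_7.
Proof. by mod11_theta (45 * P * b ^+ 6 + 9 * P * b ^+ 5 * c + 27 * P * b ^+ 4 * c ^+ 2 + 18 * P * b ^+ 2 * c ^+ 4 + 18 * P * b * c ^+ 5 + 27 * P * c ^+ 6 + 89 * b ^+ 7 - 168 * b ^+ 6 * c - 26 * b ^+ 5 * c ^+ 2 - 54 * b ^+ 4 * c ^+ 3 - 34 * b ^+ 3 * c ^+ 4 - 53 * b ^+ 2 * c ^+ 5 - 88 * b * c ^+ 6 + 51 * c ^+ 7 : S11). Qed.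

Local Notation F_8 := (P ^+ 2 * b ^+ 6 - 2 * P ^+ 2 * b ^+ 5 * c + 5 * P ^+ 2 * b ^+ 4 * c ^+ 2 - 4 * P ^+ 2 * b ^+ 2 * c ^+ 4 - 4 * P ^+ 2 * b * c ^+ 5 + 5 * P ^+ 2 * c ^+ 6 + 5 * P * b ^+ 7 + P * b ^+ 6 * c - 4 * P * b ^+ 5 * c ^+ 2 + 5 * P * b ^+ 3 * c ^+ 4 - 4 * P * b ^+ 2 * c ^+ 5 + 2 * P * b * c ^+ 6 + P * c ^+ 7 - b ^+ 8 + 5 * b ^+ 6 * c ^+ 2 - 5 * b ^+ 4 * c ^+ 4 + 5 * b ^+ 3 * c ^+ 5 - 3 * b * c ^+ 7 - 2 * c ^+ 8 : S11).
Lemma serreF8 : serreF F_7 = F_8.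
Proof. by mod11_theta (49 * P ^+ 2 * b ^+ 6 + 10 * P ^+ 2 * b ^+ 5 * c + 29 * P ^+ 2 * b ^+ 4 * c ^+ 2 + 20 * P ^+ 2 * b ^+ 2 * c ^+ 4 + 20 * P ^+ 2 * b * c ^+ 5 + 29 * P ^+ 2 * c ^+ 6 + 46 * P * b ^+ 7 - 200 * P * b ^+ 6 * c - 15 * P * b ^+ 5 * c ^+ 2 - 54 * P * b ^+ 4 * c ^+ 3 - 77 * P * b ^+ 3 * c ^+ 4 - 42 * P * b ^+ 2 * c ^+ 5 - 35 * P * b * c ^+ 6 + 19 * P * c ^+ 7 - 97 * b ^+ 8 + 141 * b ^+ 7 * c + 80 * b ^+ 6 * c ^+ 2 - 18 * b ^+ 5 * c ^+ 3 + 43 * b ^+ 4 * c ^+ 4 + 2 * b ^+ 3 * c ^+ 5 - 165 * b ^+ 2 * c ^+ 6 + 180 * b * c ^+ 7 - 68 * c ^+ 8 : S11). Qed.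

Local Notation F_9 := (- 5 * P ^+ 3 * b ^+ 6 - P ^+ 3 * b ^+ 5 * c - 3 * P ^+ 3 * b ^+ 4 * c ^+ 2 - 2 * P ^+ 3 * b ^+ 2 * c ^+ 4 - 2 * P ^+ 3 * b * c ^+ 5 - 3 * P ^+ 3 * c ^+ 6 + P ^+ 2 * b ^+ 7 - 2 * P ^+ 2 * b ^+ 6 * c - 3 * P ^+ 2 * b ^+ 5 * c ^+ 2 + P ^+ 2 * b ^+ 3 * c ^+ 4 - 3 * P ^+ 2 * b ^+ 2 * c ^+ 5 - 4 * P ^+ 2 * b * c ^+ 6 - 2 * P ^+ 2 * c ^+ 7 + 4 * P * b ^+ 8 + 2 * P * b ^+ 6 * c ^+ 2 - 2 * P * b ^+ 4 * c ^+ 4 + 2 * P * b ^+ 3 * c ^+ 5 + P * b * c ^+ 7 - 3 * P * c ^+ 8 - b ^+ 9 - 3 * b ^+ 8 * c + 5 * b ^+ 7 * c ^+ 2 + 3 * b ^+ 6 * c ^+ 3 - b ^+ 5 * c ^+ 4 - 4 * b ^+ 4 * c ^+ 5 - 3 * b ^+ 3 * c ^+ 6 + 2 * b ^+ 2 * c ^+ 7 - 4 * b * c ^+ 8 - 4 * c ^+ 9 : S11).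
Lemma serreF9 : serreF F_8 = F_9.
Proof. by mod11_theta (11 * P ^+ 3 * b ^+ 6 - 21 * P ^+ 3 * b ^+ 5 * c + 53 * P ^+ 3 * b ^+ 4 * c ^+ 2 - 42 * P ^+ 3 * b ^+ 2 * c ^+ 4 - 42 * P ^+ 3 * b * c ^+ 5 + 53 * P ^+ 3 * c ^+ 6 + 74 * P ^+ 2 * b ^+ 7 - 42 * P ^+ 2 * b ^+ 6 * c + 10 * P ^+ 2 * b ^+ 5 * c ^+ 2 - 90 * P ^+ 2 * b ^+ 4 * c ^+ 3 + 125 * P ^+ 2 * b ^+ 3 * c ^+ 4 + 61 * P ^+ 2 * b ^+ 2 * c ^+ 5 - 183 * P ^+ 2 * b * c ^+ 6 + 96 * P ^+ 2 * c ^+ 7 + 85 * P * b ^+ 8 - 177 * P * b ^+ 7 * c - 32 * P * b ^+ 6 * c ^+ 2 + 136 * P * b ^+ 5 * c ^+ 3 - 137 * P * b ^+ 4 * c ^+ 4 + 120 * P * b ^+ 3 * c ^+ 5 - 102 * P * b ^+ 2 * c ^+ 6 - 2 * P * b * c ^+ 7 - 33 * P * c ^+ 8 - 38 * b ^+ 9 + 59 * b ^+ 8 * c + 30 * b ^+ 7 * c ^+ 2 - 163 * b ^+ 6 * c ^+ 3 + 54 * b ^+ 5 * c ^+ 4 - 13 * b ^+ 4 * c ^+ 5 - 49 * b ^+ 3 * c ^+ 6 + 127 * b ^+ 2 * c ^+ 7 + 48 * b * c ^+ 8 - 48 * c ^+ 9 : S11). Qed.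

Local Notation F_10 := (- 4 * P ^+ 4 * b ^+ 6 - 3 * P ^+ 4 * b ^+ 5 * c + 2 * P ^+ 4 * b ^+ 4 * c ^+ 2 + 5 * P ^+ 4 * b ^+ 2 * c ^+ 4 + 5 * P ^+ 4 * b * c ^+ 5 + 2 * P ^+ 4 * c ^+ 6 + 4 * P ^+ 3 * b ^+ 7 + 3 * P ^+ 3 * b ^+ 6 * c - P ^+ 3 * b ^+ 5 * c ^+ 2 + 4 * P ^+ 3 * b ^+ 3 * c ^+ 4 - P ^+ 3 * b ^+ 2 * c ^+ 5 - 5 * P ^+ 3 * b * c ^+ 6 + 3 * P ^+ 3 * c ^+ 7 + 2 * P ^+ 2 * b ^+ 8 + P ^+ 2 * b ^+ 6 * c ^+ 2 - P ^+ 2 * b ^+ 4 * c ^+ 4 + P ^+ 2 * b ^+ 3 * c ^+ 5 - 5 * P ^+ 2 * b * c ^+ 7 + 4 * P ^+ 2 * c ^+ 8 - P * b ^+ 9 - 3 * P * b ^+ 8 * c + 5 * P * b ^+ 7 * c ^+ 2 + 3 * P * b ^+ 6 * c ^+ 3 - P * b ^+ 5 * c ^+ 4 - 4 * P * b ^+ 4 * c ^+ 5 - 3 * P * b ^+ 3 * c ^+ 6 + 2 * P * b ^+ 2 * c ^+ 7 - 4 * P * b * c ^+ 8 - 4 * P * c ^+ 9 - b ^+ 10 + 4 * b ^+ 9 * c + b ^+ 8 * c ^+ 2 + 4 * b ^+ 7 * c ^+ 3 + 3 * b ^+ 6 * c ^+ 4 + b ^+ 5 * c ^+ 5 + 5 *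 b ^+ 4 * c ^+ 6 - 4 * b ^+ 3 * c ^+ 7 + 5 * b ^+ 2 * c ^+ 8 + b * c ^+ 9 + 2 * c ^+ 10 : S11).
Lemma serreF10 : serreF F_9 = F_10.
Proof. by mod11_theta (- 56 * P ^+ 4 * b ^+ 6 - 11 * P ^+ 4 * b ^+ 5 * c - 34 * P ^+ 4 * b ^+ 4 * c ^+ 2 - 23 * P ^+ 4 * b ^+ 2 * c ^+ 4 - 23 * P ^+ 4 * b * c ^+ 5 - 34 * P ^+ 4 * c ^+ 6 - 77 * P ^+ 3 * b ^+ 7 + 144 * P ^+ 3 * b ^+ 6 * c - 10 * P ^+ 3 * b ^+ 5 * c ^+ 2 + 54 * P ^+ 3 * b ^+ 4 * c ^+ 3 + 46 * P ^+ 3 * b ^+ 3 * c ^+ 4 + 17 * P ^+ 3 * b ^+ 2 * c ^+ 5 + 40 * P ^+ 3 * b * c ^+ 6 - 75 * P ^+ 3 * c ^+ 7 + 115 * P ^+ 2 * b ^+ 8 - 100 * P ^+ 2 * b ^+ 7 * c + 142 * P ^+ 2 * b ^+ 6 * c ^+ 2 + 54 * P ^+ 2 * b ^+ 5 * c ^+ 3 + 4 * P ^+ 2 * b ^+ 4 * c ^+ 4 + 88 * P ^+ 2 * b ^+ 3 * c ^+ 5 + 146 * P ^+ 2 * b ^+ 2 * c ^+ 6 + 41 * P ^+ 2 * b * c ^+ 7 - 52 * P ^+ 2 * c ^+ 8 + 75 * P * b ^+ 9 - 211 * P * b ^+ 8 * c + 79 * P * b ^+ 7 * c ^+ 2 -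 25 * P * b ^+ 6 * c ^+ 3 + 21 * P * b ^+ 5 * c ^+ 4 - 46 * P * b ^+ 4 * c ^+ 5 - 47 * P * b ^+ 3 * c ^+ 6 - 5 * P * b ^+ 2 * c ^+ 7 + 111 * P * b * c ^+ 8 - 110 * P * c ^+ 9 - 38 * b ^+ 10 + 11 * b ^+ 9 * c + 160 * b ^+ 8 * c ^+ 2 - 171 * b ^+ 7 * c ^+ 3 - 72 * b ^+ 6 * c ^+ 4 + 75 * b ^+ 5 * c ^+ 5 + 126 * b ^+ 4 * c ^+ 6 - 76 * b ^+ 3 * c ^+ 7 + 201 * b ^+ 2 * c ^+ 8 + 129 * b * c ^+ 9 - 94 * c ^+ 10 : S11). Qed.

(* F_10 is the sum of the P ^+ i * V_i. *)
Local Notation V_0 := (- b ^+ 10 + 4 * b ^+ 9 * c + b ^+ 8 * c ^+ 2 + 4 * b ^+ 7 * c ^+ 3 + 3 * b ^+ 6 * c ^+ 4 + b ^+ 5 * c ^+ 5 + 5 * b ^+ 4 * c ^+ 6 - 4 * b ^+ 3 * c ^+ 7 + 5 * b ^+ 2 * c ^+ 8 + b * c ^+ 9 + 2 * c ^+ 10).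
Local Notation V_1 := (- b ^+ 9 - 3 * b ^+ 8 * c + 5 * b ^+ 7 * c ^+ 2 + 3 * b ^+ 6 * c ^+ 3 - b ^+ 5 * c ^+ 4 - 4 * b ^+ 4 * c ^+ 5 - 3 * b ^+ 3 * c ^+ 6 + 2 * b ^+ 2 * c ^+ 7 - 4 * b * c ^+ 8 - 4 * c ^+ 9).
Local Notation V_2 := (2 * b ^+ 8 + b ^+ 6 * c ^+ 2 - b ^+ 4 * c ^+ 4 + b ^+ 3 * c ^+ 5 - 5 * b * c ^+ 7 + 4 * c ^+ 8).
Local Notation V_3 := (4 * b ^+ 7 + 3 * b ^+ 6 * c - b ^+ 5 * c ^+ 2 + 4 * b ^+ 3 * c ^+ 4 - b ^+ 2 * c ^+ 5 - 5 * b * c ^+ 6 + 3 * c ^+ 7).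
Local Notation V_4 := (- 4 * b ^+ 6 - 3 * b ^+ 5 * c + 2 * b ^+ 4 * c ^+ 2 + 5 * b ^+ 2 * c ^+ 4 + 5 * b * c ^+ 5 + 2 * c ^+ 6).
(** For E10 = 1 and H12 = P the left side is 1 - F_10. The powers of [E10] and [H12] make every term
    homogeneous of degree 30 in [b] and [c], so the congruence becomes a polynomial identity over
    F_11. The right side is arranged as a product of powers of (c - b) b^4 c and (c - b) b c, which
    are monomials in q, f_1, f_2. *)
Lemma hasse_identity :
  E10 ^+ 6 - V_0 * E10 ^+ 4 - H12 * V_1 * E10 ^+ 3 - H12 ^+ 2 * V_2 * E10 ^+ 2 -
  H12 ^+ 3 * V_3 * E10 - H12 ^+ 4 * V_4 = (c - b) * b ^+ 4 * c * ((c - b) * b * c) ^+ 8.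
Proof. by rewrite /E10 /H12; mod11 (8 * b ^+ 30 + 87 * b ^+ 29 * c + 368 * b ^+ 28 * c ^+ 2 + 733 * b ^+ 27 * c ^+ 3 + 604 * b ^+ 26 * c ^+ 4 + 60 * b ^+ 25 * c ^+ 5 + 554 * b ^+ 24 * c ^+ 6 + 2560 * b ^+ 23 * c ^+ 7 + 3829 * b ^+ 22 * c ^+ 8 + 2768 * b ^+ 21 * c ^+ 9 + 2229 * b ^+ 20 * c ^+ 10 + 4449 * b ^+ 19 * c ^+ 11 + 6506 * b ^+ 18 * c ^+ 12 + 6295 * b ^+ 17 * c ^+ 13 + 5893 * b ^+ 16 * c ^+ 14 + 6114 * b ^+ 15 * c ^+ 15 + 4517 * b ^+ 14 * c ^+ 16 + 2892 * b ^+ 13 * c ^+ 17 + 3237 * b ^+ 12 * c ^+ 18 + 3653 * b ^+ 11 * c ^+ 19 + 1450 * b ^+ 10 * c ^+ 20 - 1321 * b ^+ 9 * c ^+ 21 - 1649 * b ^+ 8 * c ^+ 22 - 416 * b ^+ 7 * c ^+ 23 - 23 * b ^+ 6 * c ^+ 24 - 688 * b ^+ 5 * c ^+ 25 - 1032 * b ^+ 4 * c ^+ 26 - 670 * b ^+ 3 * c ^+ 27 - 230 * b ^+ 2 * c ^+ 28 - 41 * b * c ^+ 29 - 3 * c ^+ 30 : S11). Qed.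

Lemma twist_mul_step (a w l : S11) k m : is_logder a l ->
  twist (fun n => (k * n + m)%:R) (a * w) = a * (k%:R * theta w + (k%:R * l + m%:R) * w).
Proof. by move=> al; rewrite twist_linear thetaM al; ring. Qed.

Lemma is_logder_S k n : is_logder (f k ^+ n) (S (el k) *+ n).
Proof.
apply: logderX; rewrite /is_logder -(smap_euler (intmul 1)) -smap_theta.
by rewrite (el_logder k) rmorphM.
Qed.

Lemma jacobi_odd :
  ssum (fun j : int => ((-1) ^+ absz j * (2 * j + 1))%:~R * qq int ^+ theta_exp 1 1 j) =
  euler int 2 ^+ 3 *+ 2.
Proof.
rewrite -jacobi -[RHS]mulr_natl -ssumMl; last exact: summable_theta.
have s1 : summable (fun j : int => sg j * qq int ^+ theta_exp 1 1 j) by exact: summable_theta.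
have z : ssum (fun j : int => sg j * qq int ^+ theta_exp 1 1 j) = 0.
  apply: (@ssum_odd_involution (fun j => - 1 - j)) => // j; first by ring.
  rewrite /theta_exp sgD !sgN [sg 1]expr1 mulN1r -mulNr; congr (_ * _ ^+ absz _); ring.
rewrite -[RHS]addr0 -z -ssumD //; last first.
  by apply: summableMl; exact: summable_theta.
by apply: eq_ssum => j; rewrite rmorphM rmorphXn rmorphN1 /sg; ring.
Qed.

(** Since 4 (j^2 + j) + 1 = (2 j + 1)^2, the twist turns the coefficient 2 j + 1 of Jacobi's series
    into its eleventh power, which is unchanged modulo 11. *)
Lemma twist_jacobi :
  twist (fun n => (4 * n + 1)%:R ^+ 5) (f 2 ^+ 3) = f 2 ^+ 3 :> S11.
Proof.
pose T k := ssum (fun j : int => ((-1) ^+ absz j * (2 * j + 1) ^+ k)%:~R * qq int ^+ theta_exp 1 1 j).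
have sT k : summable (fun j : int => ((-1) ^+ absz j * (2 * j + 1) ^+ k)%:~R * qq int ^+ theta_exp 1 1 j).
  exact: summable_theta.
have ET1 : T 1 = euler int 2 ^+ 3 *+ 2.
  by rewrite -jacobi_odd; apply: eq_ssum => j; rewrite expr1.
have ET11 : twist (fun n => (4 * n + 1)%:R ^+ 5) (T 1) = T 11.
  rewrite (@ssum_morph _ _ (twist _)) //; last by move=> n a; apply: eqmodq_twist.
  apply: eq_ssum => j; rewrite [LHS]twist_int_qX; congr (_%:~R * _).
  have -> : (4 * theta_exp 1 1 j + 1)%:R = (2 * j + 1) ^+ 2 :> int.
    rewrite natz /theta_exp; have := @theta_exp_ge0 1 1 j isT; nia.
  by ring.
have S11E : S (T 11) = S (T 1).
  have sc k : S (T k) = ssum (fun j => (((-1) ^+ absz j)%:~R * (2 * j + 1)%:~R ^+ k) * qq 'F_11 ^+ theta_exp 1 1 j).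
    rewrite (@ssum_morph _ _ (smap _)) //; last first.
      by move=> n a /(eqmodq_smap (intmul (1 : 'F_11))); rewrite rmorph0.
    by apply: eq_ssum => j; rewrite /= rmorphM rmorph_int rmorphXn /= smap_qq rmorphM; congr (_ * _ * _); exact: rmorphXn.
  rewrite !sc; apply: eq_ssum => j; congr (_ * _ * _).
  by rewrite expr1 fermat11_series.
have H : twist (fun n => (4 * n + 1)%:R ^+ 5) (S (T 1)) = S (T 1).
  rewrite -[RHS]S11E -ET11 smap_twist; apply: eq_twist => n /=.
  by rewrite rmorphXn rmorph_nat.
rewrite ET1 rmorphMn rmorphXn /= smap_euler in H; rewrite raddfMn /= in H.
exact: mulr2n_inj11.
Qed.

Lemma E10_eq1 : E10 = 1.
Proof.
apply: (@sreg _ (f 2 ^+ 3)); first by rewrite coefsX0 ?euler_coef0.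
rewrite mulr1 -[RHS]twist_jacobi -[X in twist _ X]mulr1 -twist_iter /=.
have step w : twist (fun n => (4 * n + 1)%:R) (f 2 ^+ 3 * w) = f 2 ^+ 3 * (4%:R * theta w + 6 * P * w).
  rewrite (twist_mul_step _ _ _ (is_logder_S 2 3)); congr (_ * (_ + _ * _)).
  have -> : P = 2 + S (el 2) *+ 24 by rewrite /P /Y; ring.
  rewrite -[LHS]addr0 -(char11 (1 + S (el 2) *+ 12)); ring.
by rewrite step serreE1 step serreE2 step serreE3 step serreE4 step serreE5.
Qed.

Lemma P_H12 : P = H12.
Proof. by rewrite -theta_E10 E10_eq1 theta1 mulr0 add0r mulr1. Qed.

Lemma bcE : (c - b) * f 2 ^+ 4 = qq _ * f 4 ^+ 8 *+ 16 /\ b * f 2 ^+ 4 = f 1 ^+ 8 /\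
  c * (f 1 ^+ 8 * f 4 ^+ 8) = f 2 ^+ 20.
Proof.
rewrite -!(smap_euler (intmul (1 : 'F_11))) -(smap_qq (intmul (1 : 'F_11))) /b /c.
split; [|split].
- transitivity (S ((phi ^+ 4 - phi_minus ^+ 4) * euler int 2 ^+ 4)); first by ring.
  by rewrite phi_quarticB; ring.
- transitivity (S ((phi_minus * euler int 2) ^+ 4)); first by ring.
  by rewrite phi_minusE; ring.
- transitivity (S ((phi * (euler int 1 ^+ 2 * euler int 4 ^+ 2)) ^+ 4)); first by ring.
  by rewrite phiE; ring.
Qed.

Lemma abcE : (c - b) * b * c = qq _ * f 2 ^+ 12 *+ 16.
Proof.
have [Ea [Eb Ec]] := bcE.
apply: (@sreg _ (f 2 ^+ 8 * (f 1 ^+ 8 * f 4 ^+ 8))); first by rewrite !coefsM1 ?coefsX0 ?euler_coef0.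
transitivity (((c - b) * f 2 ^+ 4) * (b * f 2 ^+ 4) * (c * (f 1 ^+ 8 * f 4 ^+ 8))); first by ring.
by rewrite Ea Eb Ec; ring.
Qed.

Lemma ab4cE : (c - b) * b ^+ 4 * c = qq _ * f 1 ^+ 24 *+ 16.
Proof.
have [_ [Eb _]] := bcE.
apply: (@sreg _ (f 2 ^+ 12)); first by rewrite ?coefsX0 ?euler_coef0.
transitivity (((c - b) * b * c) * (b * f 2 ^+ 4) ^+ 3); first by ring.
by rewrite Eb abcE; ring.
Qed.

Lemma logder_F_coef : 8%:R * (S (el 1) *+ 9 + S (el 2) *+ 3) + 5%:R = 4 * P + 3 * b - 6 * c.
Proof.
have E1 : S (Y 1) = P + b - 2 * c by rewrite /P /b /c Y1E Y2E; ring.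
transitivity (S (Y 1) *+ 3 + P); last by rewrite E1; ring.
by rewrite /P /Y; ring.
Qed.

#[local] Opaque P b c E10 H12.

(* The operator a - (8 theta + 5)^10 a keeps exactly the terms q^n with 11 | 8 n + 5. *)
Lemma F_eq :
  f 1 ^+ 9 * f 2 ^+ 3 - twist (fun n => (8 * n + 5)%:R ^+ 10) (f 1 ^+ 9 * f 2 ^+ 3) =
  qq _ ^+ 9 * (f 1 ^+ 33 * f 2 ^+ 99) *+ 9.
Proof.
set F := f 1 ^+ 9 * f 2 ^+ 3.
have lF : is_logder F (S (el 1) *+ 9 + S (el 2) *+ 3) by apply: logderM; exact: is_logder_S.
have step w : twist (fun n => (8 * n + 5)%:R) (F * w) = F * (8%:R * theta w + (4 * P + 3 * b - 6 * c) * w).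
  by rewrite (twist_mul_step _ _ _ lF) logder_F_coef.
have FV : twist (fun n => (8 * n + 5)%:R ^+ 10) F = F * F_10.
  rewrite -[X in twist _ X]mulr1 -twist_iter /= step serreF1 step serreF2 step serreF3 step serreF4.
  by rewrite step serreF5 step serreF6 step serreF7 step serreF8 step serreF9 step serreF10.
have E := hasse_identity; rewrite E10_eq1 -P_H12 !expr1n !mulr1 in E.
have ER : (c - b) * b ^+ 4 * c * ((c - b) * b * c) ^+ 8 =
    (qq _ * f 1 ^+ 24 *+ 16) * (qq _ * f 2 ^+ 12 *+ 16) ^+ 8.
  by congr (_ * _ ^+ 8); [exact: ab4cE | exact: abcE].
rewrite FV; transitivity (F * (1 - V_0 - P * V_1 - P ^+ 2 * V_2 -
  P ^+ 3 * V_3 - P ^+ 4 * V_4)); first by ring.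
rewrite E ER /F; move: (f 1) (f 2) (qq 'F_11) => u v w.
(* The constant 16^9 modulo 11: 16 = 5, repeated squaring gives 5^8 = 4, and 5 * 4 = 20 = 9. *)
have red11 (z : S11) m k : z *+ (m + 11 * k) = z *+ m.
  by rewrite mulrnDr mulnC mulrnA char11 addr0.
have e8 (z : S11) : z ^+ 8 = ((z ^+ 2) ^+ 2) ^+ 2 by ring.
have r16 (z : S11) : z *+ 16 = z *+ 5 by exact: (red11 z 5 1).
have P8 (z : S11) : (z *+ 16) ^+ 8 = z ^+ 8 *+ 4.
  rewrite r16 !e8; have -> : (z *+ 5) ^+ 2 = z ^+ 2 *+ 3.
    by rewrite -(red11 _ 3 2); ring.
  have -> : (z ^+ 2 *+ 3) ^+ 2 = (z ^+ 2) ^+ 2 *+ 9 by ring.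
  by rewrite -(red11 _ 4 7); ring.
transitivity (u ^+ 9 * v ^+ 3 * ((w * u ^+ 24 *+ 5) * ((w * v ^+ 12) ^+ 8 *+ 4))).
  by congr (_ * (_ * _)); [exact: r16 | exact: P8].
transitivity (w ^+ 9 * (u ^+ 33 * v ^+ 99) *+ 20); last exact: (red11 _ 9 1).
by ring.
Qed.

End Mod11.

(** * The Frobenius congruence for Euler products *)

Section Frobenius.
Variables (p : nat) (R : comNzRingType).
Hypothesis pR : p \in [pchar R].

Lemma pchar_series : p \in [pchar series R].
Proof.
have /andP[pp /eqP p0] := pR; rewrite inE pp /=; apply/eqP/seriesP => n.
by rewrite coefsMn -mulr_natl p0 mul0r.
Qed.

Lemma iprodX (u : nat -> series R) n : tame u ->
  iprod u ^+ n = iprod (fun i => u i ^+ n) /\ tame (fun i => u i ^+ n).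
Proof.
move=> tu; elim: n => [|n [IH1 IH2]].
  have E : (fun i => u i ^+ 0) = (fun=> 1) by apply/funext => i; rewrite expr0.
  rewrite E; split; last by move=> i.
  by apply: seriesP => n; rewrite /= big1.
have -> : (fun i => u i ^+ n.+1) = (fun i => u i * u i ^+ n).
  by apply/funext => i; rewrite exprS.
by rewrite exprS IH1 iprodM //; split=> //; apply: tameM.
Qed.

Lemma euler_frobenius k : (0 < k)%N -> euler R k ^+ p = euler R (p * k).
Proof.
move=> k0; have /andP[pp _] := pR; have p0 := prime_gt0 pp.
have pn : [pchar series R].-nat p by rewrite pnatE // pchar_series.
rewrite !eulerE ?muln_gt0 ?p0 // /qprod.
have [-> _] := iprodX p (@tame_qprod R (-1) k k k0 k0).
apply: eq_iprod => i; rewrite exprDn_pchar // expr1n !mulN1r exprNn_pchar // -exprM.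
by congr (1 - _ ^+ _); lia.
Qed.

End Frobenius.

Section U11.
Local Notation f k := (euler 'F_11 k).

(* Modulo 11, gser * dil 11 (f 1) is f 1 ^+ 9 * f 2 ^+ 3. *)
Definition gser (R : comNzRingType) : series R := sinv (euler R 1 ^+ 2) * euler R 2 ^+ 3.

Lemma gserE (R : comNzRingType) : euler R 1 ^+ 2 * gser R = euler R 2 ^+ 3.
Proof. by rewrite mulrA sinvP ?mul1r // coefsX0 ?euler_coef0. Qed.

Lemma pchar11 : 11%N \in [pchar 'F_11]. Proof. by []. Qed.

(** By Frobenius f_1^33 f_2^99 is f_1^3 f_2^9 at q^11, so the extraction reads it off, and one f_1
    cancels against the denominator f_11. *)
Theorem ext11_gser : ext 11 9 (gser 'F_11) = f 1 ^+ 2 * f 2 ^+ 9 *+ 9.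
Proof.
have fr1 : f 1 ^+ 11 = dil 11 (f 1) by rewrite (euler_frobenius pchar11) // dil_euler.
have fr2 : f 2 ^+ 11 = dil 11 (f 2) by rewrite (euler_frobenius pchar11) // dil_euler.
have E : dil 11 (f 1) * gser 'F_11 = f 1 ^+ 9 * f 2 ^+ 3.
  by rewrite -fr1 -gserE; ring.
apply: (@sreg _ (f 1)); first exact: euler_coef0.
rewrite -(ext_mul_dil (gser 'F_11) (f 1) (_ : 9 < 11)%N) // E.
apply: seriesP => n; rewrite -[LHS]/((f 1 ^+ 9 * f 2 ^+ 3) (11 * n + 9)%N).
have := congr1 (fun s => coefs s (11 * n + 9)) F_eq.
rewrite coefsB; have -> : twist (fun n => (8 * n + 5)%:R ^+ 10) (f 1 ^+ 9 * f 2 ^+ 3) (11 * n + 9)%N = 0.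
  rewrite /= (_ : (8 * (11 * n + 9) + 5 = 11 * (8 * n + 7))%N); last by lia.
  by rewrite natrM; have /andP[_ /eqP ->] := pchar11; rewrite mul0r expr0n mul0r.
rewrite subr0 => ->.
have -> : f 1 ^+ 33 * f 2 ^+ 99 = dil 11 (f 1 ^+ 3 * f 2 ^+ 9).
  transitivity (dil 11 (f 1) ^+ 3 * dil 11 (f 2) ^+ 9); last by ring.
  by rewrite -fr1 -fr2; ring.
have -> : f 1 * (f 1 ^+ 2 * f 2 ^+ 9 *+ 9) = f 1 ^+ 3 * f 2 ^+ 9 *+ 9 by ring.
by rewrite !coefsMn coefs_qXM leq_addl addnK coefs_dilM.
Qed.

End U11.

Lemma smap_gser (R S : comNzRingType) (f : {rmorphism R -> S}) :
  smap f (gser R) = gser S.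
Proof.
apply: (@sreg _ (euler S 1 ^+ 2)); first by rewrite coefsX0 ?euler_coef0.
by rewrite gserE -!(smap_euler f) -rmorphXn -rmorphM /= gserE rmorphXn.
Qed.

(** * The congruence modulo 5 *)

Section Mod5.
Local Notation S := (smap (intmul (1 : 'F_5))).
Local Notation f k := (euler 'F_5 k).

Lemma pchar5 : 5%N \in [pchar 'F_5]. Proof. by []. Qed.

(** Modulo 5 the exponent j^2 + j is 0, 1 or 2, and it is 1 only when j = 2, where the coefficient 2
    j + 1 is divisible by 5. *)
Lemma jacobi_mod5 n : (n %% 5 != 0)%N -> (n %% 5 != 2)%N -> (f 2 ^+ 3) n = 0.
Proof.
move=> n0 n2.
have : (f 2 ^+ 3 *+ 2) n = 0.
  have -> : f 2 ^+ 3 *+ 2 = S (euler int 2 ^+ 3 *+ 2).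
    by rewrite -(smap_euler (intmul (1 : 'F_5))); ring.
  rewrite -jacobi_odd.
  rewrite (@ssum_morph _ _ (smap _)) //; first last.
  - exact: summable_theta.
  - by move=> m a /(eqmodq_smap (intmul (1 : 'F_5))); rewrite rmorph0.
  rewrite /= fsbig1 // => j _; rewrite -[LHS]/((((-1) ^+ absz j * (2 * j + 1))%:~R * qq int ^+ theta_exp 1 1 j) n)%:~R.
  rewrite coefs_intrM coefs_qX; case: eqP => [nE|_]; last by rewrite mulr0.
  rewrite mulr1 intz rmorphM /=.
  have [k ->] : exists k, 2 * j + 1 = 5 * k.
    exists ((2 * j + 1) %/ 5)%Z; rewrite nE /theta_exp in n0 n2.
    have jE := divz_eq j 5; have j5 : (j %% 5)%Z \in [:: 0; 1; 2; 3; 4].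
      by rewrite !inE; lia.
    move: j5 jE; move: (j %/ 5)%Z (j %% 5)%Z => k r; rewrite !inE.
    by case/or4P => [||| /orP[]] /eqP -> jE; rewrite jE in n0 n2 *; nia.
  by rewrite rmorphM /= (_ : 5%:~R = 0) ?mul0r ?mulr0 //; have /andP[_ /eqP] := pchar5.
rewrite coefsMn -mulr_natl => /eqP; rewrite mulf_eq0 => /orP[//|/eqP//].
Qed.

(** Modulo 5 the exponents of f_1^3 lie in the classes 0, 1 and those of f_2^3 in the classes 0, 2;
    no sum is 4. *)
Lemma ext5_gser : ext 5 4 (gser 'F_5) = 0.
Proof.
have fr : f 1 ^+ 5 = dil 5 (f 1) by rewrite (euler_frobenius pchar5) // dil_euler.
have E : dil 5 (f 1) * gser 'F_5 = f 1 ^+ 3 * f 2 ^+ 3.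
  by rewrite -fr -gserE; ring.
apply: (@sreg_eq0 _ (f 1)); first exact: euler_coef0.
rewrite -(ext_mul_dil (gser 'F_5) (f 1) (_ : 4 < 5)%N) // E.
apply: seriesP => n; rewrite -[LHS]/((f 1 ^+ 3 * f 2 ^+ 3) (5 * n + 4)%N) coefsM big1 // => i _.
have -> : (f 1 ^+ 3) i = (f 2 ^+ 3) (2 * i)%N.
  have -> : f 2 ^+ 3 = dil 2 (f 1 ^+ 3) by rewrite rmorphXn /= dil_euler.
  by rewrite coefs_dilM.
case: (boolP (((2 * i) %% 5 == 0) || ((2 * i) %% 5 == 2))%N) => [i5|].
  by rewrite (@jacobi_mod5 (5 * n + 4 - i)) ?mulr0 //; have := ltn_ord i; lia.
by rewrite negb_or => /andP[? ?]; rewrite jacobi_mod5 ?mul0r.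
Qed.

End Mod5.

(** * A Hecke operator on a ternary theta series *)

Section TernaryTheta.
Local Notation q := (qq int).
Local Notation f k := (euler int k).

Definition chi3 (u : int) : int :=
  if (u %% 3)%Z == 1 then 1 else if (u %% 3)%Z == 2 then -1 else 0.
Definition parity_sign (x : int) : int := (-1) ^+ absz x.

Definition ternary_form (p : int * int * int) : nat :=
  theta_exp 1 0 p.1.1 + theta_exp 1 0 p.1.2 + theta_exp 6 0 p.2.
(** The polynomial u v (u^2 - v^2) is harmonic, and its two monomials split the theta series into
    products of one-variable series. The parity sign of u makes the terms with u and v of equal
    parity cancel, leaving a Wronskian. *)
Definition ternary_weight (p : int * int * int) : int :=
  parity_sign p.2 * parity_sign p.1.1 * chi3 p.1.1 * chi3 p.1.2 *
  (p.1.1 * p.1.2 * (p.1.1 ^+ 2 - p.1.2 ^+ 2)).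

Definition ternary_theta : series int :=
  ssum (fun p => (ternary_weight p)%:~R * q ^+ ternary_form p).

(** Up to sign an integer prime to 3 is 6 a + 1 if odd and 2 (3 a + 1) if even. *)
Lemma ssum_chi3 (G : int -> series int) : summable G ->
  (forall a, G (3 * a) = 0) -> (forall u, G (- u) = G u) ->
  ssum G = (ssum (fun a => G (6 * a + 1)) + ssum (fun a => G (2 * (3 * a + 1)))) *+ 2.
Proof.
move=> sG G3 GN.
pose h (t : int + int + int + int + int) : int := match t with
  | inl (inl (inl (inl a))) => 6 * a + 1 | inl (inl (inl (inr a))) => - (6 * a + 1)
  | inl (inl (inr a)) => 2 * (3 * a + 1) | inl (inr a) => - (2 * (3 * a + 1))
  | inr a => 3 * a end.
have bh : bijective h.
  pose g (u : int) : int + int + int + int + int := let r := (u %% 6)%Z in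
    if r == 1 then inl (inl (inl (inl (u %/ 6)%Z))) else
    if r == 5 then inl (inl (inl (inr (- u %/ 6)%Z))) else
    if r == 2 then inl (inl (inr (u %/ 6)%Z)) else
    if r == 4 then inl (inr (- u %/ 6)%Z) else inr (u %/ 3)%Z.
  exists g.
    move=> [[[[a|a]|a]|a]|a]; rewrite /g /h /=.
    - have -> : ((6 * a + 1) %% 6)%Z = 1 by lia.
      by do 4! congr inl; lia.
    - have -> : ((- (6 * a + 1)) %% 6)%Z = 5 by lia.
      by congr (inl (inl (inl (inr _)))); lia.
    - have -> : ((2 * (3 * a + 1)) %% 6)%Z = 2 by lia.
      by congr (inl (inl (inr _))); lia.
    - have -> : ((- (2 * (3 * a + 1))) %% 6)%Z = 4 by lia.
      by congr (inl (inr _)); lia.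
    - by do 4! (rewrite ifF; last by lia); congr inr; lia.
  by move=> u; rewrite /g /h /=; do ! case: ifP => ?; lia.
have s5 := summable_reindex bh sG.
have s4 := summable_inl s5; have s3 := summable_inl s4; have s2 := summable_inl s3.
rewrite (reindex_ssum G bh) (ssum_sum s5) (ssum_sum s4) (ssum_sum s3) (ssum_sum s2).
have -> : ssum ((G \o h) \o inr) = 0.
  by rewrite -[RHS](ssum0 int int); apply: eq_ssum => a; apply: G3.
have -> : ssum (((G \o h) \o inl) \o inr) = ssum (fun a => G (2 * (3 * a + 1))).
  by apply: eq_ssum => a; rewrite /= GN.
have -> : ssum ((((G \o h \o inl) \o inl) \o inl) \o inr) = ssum (fun a => G (6 * a + 1)).
  by apply: eq_ssum => a; rewrite /= GN.
have -> : ssum ((((G \o h \o inl) \o inl) \o inl) \o inl) = ssum (fun a => G (6 * a + 1)) by [].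
have -> : ssum (((G \o h \o inl) \o inl) \o inr) = ssum (fun a => G (2 * (3 * a + 1))) by [].
by ring.
Qed.

Definition chi_theta (s : int -> int) k : series int :=
  ssum (fun u : int => (s u * chi3 u * u ^+ k)%:~R * q ^+ theta_exp 1 0 u).
Definition theta_O k : series int :=
  ssum (fun a : int => ((6 * a + 1) ^+ k)%:~R * q ^+ theta_exp 1 0 (6 * a + 1)).
Definition theta_E k : series int :=
  ssum (fun a : int => ((2 * (3 * a + 1)) ^+ k)%:~R * q ^+ theta_exp 1 0 (2 * (3 * a + 1))).

Lemma chi3N u : chi3 (- u) = - chi3 u.
Proof. by rewrite /chi3; do ! case: ifP => ?; lia. Qed.

Lemma chi3_eq0 a : chi3 (3 * a) = 0.
Proof. by rewrite /chi3 modzMr. Qed.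

Lemma summable_chi s k :
  summable (fun u : int => (s u * chi3 u * u ^+ k)%:~R * q ^+ theta_exp 1 0 u).
Proof. exact: summable_theta. Qed.

Lemma summable_sparse (c : int -> series int) (h : int -> int) :
  (forall a, (absz a <= (absz (h a)).+1)%N) ->
  summable (fun a => c a * q ^+ theta_exp 1 0 (h a)).
Proof.
move=> ha; apply: (@summable_int _ _ 3) => a; rewrite mulrC; apply: eqmodq_qX0.
by have := ha a; rewrite /theta_exp; move: (h a) => j; nia.
Qed.

Lemma chi_thetaE s k so se : odd k -> (forall u, s (- u) = s u) ->
  (forall a, s (6 * a + 1) = so) -> (forall a, s (2 * (3 * a + 1)) = se) ->
  chi_theta s k = (so%:~R * theta_O k - se%:~R * theta_E k) *+ 2.
Proof.
move=> k2 sN sO sE; rewrite /chi_theta ssum_chi3; first last.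
- move=> u; rewrite sN chi3N exprNn -signr_odd k2 expr1 /theta_exp sqrrN !mul0r !addr0.
  by congr (_%:~R * _); ring.
- by move=> a; rewrite chi3_eq0 mulr0 !mul0r.
- exact: summable_chi.
congr (_ *+ 2); rewrite -mulNr -rmorphN -!ssumMl; first last.
- by apply: summable_sparse => a; lia.
- by apply: summable_sparse => a; lia.
congr (_ + _); apply: eq_ssum => a.
  rewrite sO mulrA -rmorphM; congr (_%:~R * _).
  have -> : chi3 (6 * a + 1) = 1 by rewrite /chi3 ifT //; lia.
  by rewrite mulr1.
rewrite sE mulrA -rmorphM; congr (_%:~R * _).
have -> : chi3 (2 * (3 * a + 1)) = -1; last by ring.
by rewrite /chi3 ifF ?ifT //; lia.
Qed.

Lemma twist_theta (R : comNzRingType) (a : series R) : twist (fun n => n%:R) a = theta a.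
Proof. by apply: seriesP => n; rewrite /= mulr_natl. Qed.

Lemma theta_sqr_sum (c h : int -> int) : 
  summable (fun a => (c a)%:~R * q ^+ theta_exp 1 0 (h a)) ->
  theta (ssum (fun a => (c a)%:~R * q ^+ theta_exp 1 0 (h a))) =
  ssum (fun a => (h a ^+ 2 * c a)%:~R * q ^+ theta_exp 1 0 (h a)).
Proof.
move=> sc; rewrite -twist_theta (@ssum_morph _ _ (twist _)) //; last first.
  by move=> n a; apply: eqmodq_twist.
apply: eq_ssum => a; rewrite [LHS]twist_int_qX; congr ((_ * _)%:~R * _).
by rewrite natz /theta_exp; lia.
Qed.

Lemma theta_O3 : theta (theta_O 1) = theta_O 3.
Proof.
rewrite theta_sqr_sum; first by apply: eq_ssum => a; congr (_%:~R * _); ring.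
by apply: summable_sparse => a; lia.
Qed.

Lemma theta_E3 : theta (theta_E 1) = theta_E 3.
Proof.
rewrite theta_sqr_sum; first by apply: eq_ssum => a; congr (_%:~R * _); ring.
by apply: summable_sparse => a; lia.
Qed.

Lemma theta_O1 : theta_O 1 = q * dil 12 theta_T2.
Proof.
rewrite dil_theta //; last exact: summable_theta.
rewrite -ssumMl; last first.
  by apply: (@summable_int _ _ 2) => j; rewrite mulrC; apply: eqmodq_qX0; rewrite /theta_exp; nia.
apply: eq_ssum => a; rewrite expr1 mulrCA -exprS; congr (_ * _ ^+ _).
by have := @theta_exp_ge0 3 1 a isT; rewrite /theta_exp; nia.
Qed.

Lemma theta_E1 : theta_E 1 = q ^+ 4 * dil 12 theta_T1 *+ 2.
Proof.
rewrite dil_theta //; last exact: summable_theta.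
rewrite -mulrnAl -ssumMl; last first.
  by apply: (@summable_int _ _ 2) => j; rewrite mulrC; apply: eqmodq_qX0; rewrite /theta_exp; nia.
apply: eq_ssum => a.
have -> : q ^+ theta_exp 1 0 (2 * (3 * a + 1)) = q ^+ 4 * q ^+ (12 * theta_exp 3 2 a).
  rewrite -exprD; congr (_ ^+ _).
  by have := @theta_exp_ge0 3 2 a isT; rewrite /theta_exp; nia.
by move: (q ^+ (12 * _)) => z; ring.
Qed.

(** The left side is the Wronskian of q T2(q^12) and 2 q^4 T1(q^12), which is -6 q^5 times the right
    side of [euler_pow10] at q^12. *)
Lemma theta_OE : theta_O 3 * theta_E 1 - theta_E 3 * theta_O 1 =
  - (q ^+ 5 * dil 6 (f 2 ^+ 10) *+ 6).
Proof.
have -> : f 2 ^+ 10 = dil 2 (f 1 ^+ 10) by rewrite rmorphXn /= dil_euler.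
rewrite dil_dil // euler_pow10 -theta_O3 -theta_E3 theta_O1 theta_E1.
have tq := @theta_qX int 1; rewrite expr1 in tq.
rewrite raddfMn /= (thetaM q) (thetaM (q ^+ 4)) (theta_qX _ 4) tq !theta_dil.
move: (theta theta_T1) (theta theta_T2) theta_T1 theta_T2 => t1 t2 u1 u2.
by ring.
Qed.

(** The sum over x is phi(-q^6), the sum over (u, v) is 8 times the Wronskian of [theta_OE], and
    f_1^2 f_2^9 = phi(-q) f_2^10. *)
Lemma ternary_thetaE : ternary_theta = - (q ^+ 5 * dil 6 (f 1 ^+ 2 * f 2 ^+ 9) *+ 48).
Proof.
have sz s k := @summable_chi s k.
have s6 : summable (fun x : int => (parity_sign x)%:~R * q ^+ theta_exp 6 0 x) by exact: summable_theta.
pose one (_ : int) : int := 1.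
have E6 : ssum (fun x : int => (parity_sign x)%:~R * q ^+ theta_exp 6 0 x) = dil 6 phi_minus.
  rewrite /phi_minus (eq_ssum (F := fun j => sg j * _) (G := fun j => (parity_sign j)%:~R * q ^+ theta_exp 1 0 j)).
    rewrite dil_theta //; last exact: summable_theta.
    by apply: eq_ssum => j; congr (_ * _ ^+ _); rewrite /theta_exp; lia.
  by move=> j; rewrite sgE.
have E : ternary_theta =
  (chi_theta parity_sign 3 * chi_theta one 1 - chi_theta parity_sign 1 * chi_theta one 3) * dil 6 phi_minus.
  rewrite (ssum_mul (sz parity_sign 3) (sz one 1)) (ssum_mul (sz parity_sign 1) (sz one 3)).
  have m1 := summable_mul (sz parity_sign 3) (sz one 1).
  have m2 := summable_mul (sz parity_sign 1) (sz one 3).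
  rewrite -[X in _ - X]mul1r -mulNr -ssumMl // -ssumD //; last exact: summableMl.
  rewrite -E6 (ssum_mul _ s6); last by apply: summableD => //; exact: summableMl.
  apply: eq_ssum => -[[u v] x]; rewrite /ternary_weight /ternary_form /one /= !exprD.
  by rewrite !(rmorphM, rmorphB, rmorphXn) /=; ring.
have sO a : parity_sign (6 * a + 1) = -1.
  by rewrite /parity_sign -signr_odd (_ : odd _ = true) //; lia.
have sE a : parity_sign (2 * (3 * a + 1)) = 1.
  by rewrite /parity_sign -signr_odd (_ : odd _ = false) //; lia.
have sN u : parity_sign (- u) = parity_sign u by rewrite /parity_sign abszN.
rewrite E (@chi_thetaE parity_sign 3 _ _ isT sN sO sE) (@chi_thetaE parity_sign 1 _ _ isT sN sO sE).
rewrite (@chi_thetaE one 3 1 1) // (@chi_thetaE one 1 1 1) //.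
transitivity ((theta_O 3 * theta_E 1 - theta_E 3 * theta_O 1) * dil 6 phi_minus *+ 8).
  by rewrite rmorphN rmorph1; ring.
rewrite theta_OE; have -> : f 1 ^+ 2 * f 2 ^+ 9 = phi_minus * f 2 ^+ 10.
  by rewrite -phi_minusE; ring.
transitivity (- (q ^+ 5 * (dil 6 phi_minus * dil 6 (f 2 ^+ 10)) *+ 48)); first by ring.
by congr (- (_ * _ *+ _)); rewrite -rmorphM.
Qed.

End TernaryTheta.

(** * Vectors of norm 25 n as images under similitudes *)

Section Hecke25.
Local Notation Z3 := (int * int * int)%type.
Local Notation Q := ternary_form.
Local Notation wt := ternary_weight.

Lemma ternary_formE (p : Z3) :
  (Q p)%:Z = p.1.1 ^+ 2 + p.1.2 ^+ 2 + 6 * p.2 ^+ 2.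
Proof. by rewrite /Q /theta_exp; nia. Qed.

Definition level (n : nat) : set Z3 := [set p | Q p = n]%classic.

(** A vector of norm n contributes to the coefficient of q^n in a product of three theta series, so
    summability of that product bounds the level set. *)
Lemma finite_level n : finite_set (level n).
Proof.
have s1 := summable_sqr.
have s6 : summable (fun x : int => qq int ^+ theta_exp 6 0 x).
  have := @summable_theta int (fun=> 1) 6 0 isT isT.
  by congr summable; apply/funext => j; rewrite mul1r.
have [r Fr] := summable_mul (summable_mul s1 s1) s6 n.+1.
apply: (@sub_finite_set _ _ [set` r]%classic); last exact: finite_seq.
move=> p /= pn; apply: contrapT => /negP /Fr /(_ n (ltnSn n)).
by rewrite -!exprD coefs_qX coefs0 -/(Q p) pn eqxx => /eqP; rewrite oner_eq0.
Qed.

Definition level_sum n : int := \sum_(p \in level n) wt p.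

Lemma ternary_theta_coef n : ternary_theta n = level_sum n.
Proof.
rewrite -[LHS]/(\sum_(p \in [set: Z3]) ((wt p)%:~R * qq int ^+ Q p) n).
rewrite /level_sum [RHS]fsbig_mkcond; apply: eq_fsbigr => p _.
rewrite coefs_intrM coefs_qX intz /patch.
have -> : (p \in level n) = (n == Q p) by apply/idP/idP => [/set_mem <-|/eqP ->]; [exact: eqxx | exact: mem_set].
by case: eqP; rewrite ?mulr1 ?mulr0.
Qed.

(* Representatives of the similitudes of norm 25 modulo isometries. *)
Definition sim25 (i : nat) (p : Z3) : Z3 :=
  let: (u, v, x) := p in
  match i with
  | 0 => (- 5 * u, - v - 12 * x, - 2 * v + x)
  | 1 => (- 5 * u, - v - 12 * x, 2 * v - x)
  | 2 => (- u - 12 * x, - 5 * v, - 2 * u + x)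
  | 3 => (- u - 12 * x, - 5 * v, 2 * u - x)
  | 4 => (- 4 * u - 3 * v, - 3 * u + 4 * v, - 5 * x)
  | 5 => (- 4 * u - 3 * v, 3 * u - 4 * v, - 5 * x)
  | _ => (5 * u, 5 * v, 5 * x)
  end.

Lemma sim25_form i p : Q (sim25 i p) = (25 * Q p)%N.
Proof.
suff : (Q (sim25 i p))%:Z = (25 * Q p)%N%:Z by case.
rewrite PoszM !ternary_formE; case: p => [[u v] x].
by case: i => [|[|[|[|[|[|i]]]]]] /=; ring.
Qed.

Lemma sqr_mod5 (u : int) : (exists2 t, u = 5 * t & u ^+ 2 = 25 * t ^+ 2) \/
  (exists2 t, u ^+ 2 = 5 * t + 1 \/ u ^+ 2 = 5 * t - 1 & forall s, u <> 5 * s).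
Proof.
have uE := divz_eq u 5; have r5 : (u %% 5)%Z \in [:: 0; 1; 2; 3; 4] by rewrite !inE; lia.
move: r5 uE; move: (u %/ 5)%Z (u %% 5)%Z => k r; rewrite !inE.
case/or4P => [|||/orP[]] /eqP -> uE.
- by left; exists k; lia.
- by right; exists (5 * k ^+ 2 + 2 * k); [left; lia | lia].
- by right; exists (5 * k ^+ 2 + 4 * k + 1); [right; lia | lia].
- by right; exists (5 * k ^+ 2 + 6 * k + 2); [right; lia | lia].
- by right; exists (5 * k ^+ 2 + 8 * k + 3); [left; lia | lia].
Qed.

Lemma dvd25_mul (a b m : int) : a * b = 25 * m -> (forall s t, ~ (a = 5 * s /\ b = 5 * t)) ->
  (exists k, a = 25 * k) \/ (exists k, b = 25 * k).
Proof.
move=> E ab; have dvdP (d c : int) : (d %| c)%Z -> exists k, c = d * k.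
  by move=> /dvdzP[k ->]; exists k; rewrite mulrC.
have E25 : (25 %| a * b)%Z by rewrite E dvdz_mulr.
have p5 (c : int) : ~~ (5 %| c)%Z -> coprimez 25 c.
  by move=> c5; rewrite coprimezE -[absz 25]/(5 ^ 2)%N coprime_pexpl // prime_coprime.
case: (boolP (5 %| a)%Z) => [/dvdP[s as_]|/p5 a5].
  have b5 : ~~ (5 %| b)%Z by apply/negP => /dvdP[t bt]; apply: (ab s t).
  by left; apply: dvdP; rewrite -(Gauss_dvdzl _ (p5 _ b5)).
by right; apply: dvdP; rewrite -(Gauss_dvdzr _ a5).
Qed.

Variable n : nat.
Hypothesis n5 : (n %% 5 == 2)%N || (n %% 5 == 3)%N.

Lemma not_sqr_mod5 (u m : int) : n%:Z <> u ^+ 2 + 5 * m.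
Proof.
move=> E; have : (n%:Z = 5 * (n %/ 5)%N%:Z + 2 \/ n%:Z = 5 * (n %/ 5)%N%:Z + 3) by lia.
move: (n %/ 5)%N%:Z => k; rewrite E.
by case: (sqr_mod5 u) => [[t _ ->]|[t [->|->] _]]; lia.
Qed.

(** Modulo 5 the form is a sum of three squares, and squares are 0, 1 or -1, so either all
    coordinates of [y] are divisible by 5 or exactly one is. In the second case the binary form in
    the other two splits into linear factors modulo 25; 5 cannot divide both factors, so 25 divides
    one of them, and the corresponding similitude can be inverted. *)
Lemma sim25_surj y : level (25 * n) y -> exists (i : 'I_7) p, y = sim25 i p.
Proof.
case: y => [[u v] x] yn.
have E : u ^+ 2 + v ^+ 2 + 6 * x ^+ 2 = 25 * n%:Z.
  by have /(congr1 Posz) := yn; rewrite ternary_formE PoszM.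
(* The factorization rests on 12^2 = 144 = -6 modulo 25. *)
have dv (a b t : int) : a ^+ 2 + 6 * b ^+ 2 = 25 * t ->
   (a + 12 * b) * (a - 12 * b) = 25 * (t - 6 * b ^+ 2).
  move=> H; transitivity (25 * t - 150 * b ^+ 2); last by ring.
  by rewrite -H; ring.
case: (sqr_mod5 u) => [[u1 Eu0 Eu]|[u1 Eu nu]]; case: (sqr_mod5 v) => [[v1 Ev0 Ev]|[v1 Ev nv]];
  case: (sqr_mod5 x) => [[x1 Ex0 Ex]|[x1 Ex nx]]; try by (exfalso; lia).
- by exists (inord 6), (u1, v1, x1); rewrite /sim25 inordK // Eu0 Ev0 Ex0.
- have [] := @dvd25_mul (v + 12 * x) (v - 12 * x) (n%:Z - u1 ^+ 2 - 6 * x ^+ 2).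
  + by rewrite (dv v x (n%:Z - u1 ^+ 2)) //; lia.
  + by move=> s t [H1 H2]; apply: (nv (3 * s + 3 * t - v)); lia.
  + move=> [k Ek]; exists (inord 0), (- u1, - k, x - 2 * k); rewrite /sim25 inordK //.
    by congr (_, _, _); lia.
  + move=> [k Ek]; exists (inord 1), (- u1, - k, - x - 2 * k); rewrite /sim25 inordK //.
    by congr (_, _, _); lia.
- have [] := @dvd25_mul (u + 12 * x) (u - 12 * x) (n%:Z - v1 ^+ 2 - 6 * x ^+ 2).
  + by rewrite (dv u x (n%:Z - v1 ^+ 2)) //; lia.
  + by move=> s t [H1 H2]; apply: (nu (3 * s + 3 * t - u)); lia.
  + move=> [k Ek]; exists (inord 2), (- k, - v1, x - 2 * k); rewrite /sim25 inordK //.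
    by congr (_, _, _); lia.
  + move=> [k Ek]; exists (inord 3), (- k, - v1, - x - 2 * k); rewrite /sim25 inordK //.
    by congr (_, _, _); lia.
(* Here u^2 + v^2 splits modulo 25 because 16 + 9 = 25. *)
- have [] := @dvd25_mul (4 * u + 3 * v) (4 * u - 3 * v) (16 * n%:Z - 96 * x1 ^+ 2 - v ^+ 2).
  + have -> : (4 * u + 3 * v) * (4 * u - 3 * v) = 16 * u ^+ 2 - 9 * v ^+ 2 by ring.
    by lia.
  + by move=> s t [H1 H2]; apply: (nu (2 * s + 2 * t - 3 * u)); lia.
  + move=> [k Ek]; exists (inord 4), (- k, u + v - 7 * k, - x1); rewrite /sim25 inordK //.
    by congr (_, _, _); lia.
  + move=> [k Ek]; exists (inord 5), (- k, u - v - 7 * k, - x1); rewrite /sim25 inordK //.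
    by congr (_, _, _); lia.
Qed.

(** Recovers from an image under a similitude which of the seven was applied, by means of the linear
    factors of [sim25_surj]. *)
Definition sim25_class (y : Z3) : nat :=
  let: (u, v, x) := y in
  if (5 %| u)%Z then
    if (5 %| v)%Z then 6 else if (25 %| v + 12 * x)%Z then 0 else 1
  else if (5 %| v)%Z then if (25 %| u + 12 * x)%Z then 2 else 3
  else if (25 %| 4 * u + 3 * v)%Z then 4 else 5.

(** If a vector of norm n satisfied two of the class conditions after a similitude, one of v + 12 x,
    u + 12 x, 2 u - v would be divisible by 5; then n would be a square modulo 5, against the
    hypothesis on n. *)
Lemma sim25_classK (i : 'I_7) p : level n p -> sim25_class (sim25 i p) = i.
Proof.
case: p => [[u v] x] pn.
have E : n%:Z = u ^+ 2 + v ^+ 2 + 6 * x ^+ 2 by rewrite -(congr1 Posz pn) ternary_formE.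
have nvx t : v + 12 * x <> 5 * t.
  move=> H; apply: (@not_sqr_mod5 u (5 * t ^+ 2 - 24 * t * x + 30 * x ^+ 2)).
  by rewrite E (_ : v = 5 * t - 12 * x); [ring | lia].
have nux t : u + 12 * x <> 5 * t.
  move=> H; apply: (@not_sqr_mod5 v (5 * t ^+ 2 - 24 * t * x + 30 * x ^+ 2)).
  by rewrite E (_ : u = 5 * t - 12 * x); [ring | lia].
have nuv t : 2 * u - v <> 5 * t.
  move=> H; apply: (@not_sqr_mod5 x (u ^+ 2 - 4 * t * u + 5 * t ^+ 2 + x ^+ 2)).
  by rewrite E (_ : v = 2 * u - 5 * t); [ring | lia].
have dvd5 (c : int) : (forall t, c <> 5 * t) -> (5 %| c)%Z = false.
  by move=> H; apply/negP => /dvdzP[t ct]; apply: (H t); rewrite ct mulrC.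
have dvd25 (c : int) : (forall t, c <> 5 * t) -> (25 %| c)%Z = false.
  by move=> H; apply/negP => /dvdzP[t ct]; apply: (H (5 * t)); rewrite ct; ring.
have d5 (c t : int) : c = 5 * t -> (5 %| c)%Z by move=> ->; rewrite dvdz_mulr.
have d25 (c t : int) : c = 25 * t -> (25 %| c)%Z by move=> ->; rewrite dvdz_mulr.
case: i => [[|[|[|[|[|[|[|i]]]]]]] i7] //; rewrite /sim25 /sim25_class /=.
- rewrite (d5 _ (- u)) ?dvd5 ?(d25 _ (- v)) //; try ring.
  by move=> t H; apply: (nvx (- t)); lia.
- rewrite (d5 _ (- u)) ?dvd5 ?dvd25 //; try ring.
    by move=> t H; apply: (nvx (2 * t + 12 * x - 9 * v)); lia.
  by move=> t H; apply: (nvx (- t)); lia.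
- rewrite (d5 (- 5 * v) (- v)) ?dvd5 ?(d25 _ (- u)) //; try ring.
  by move=> t H; apply: (nux (- t)); lia.
- rewrite (d5 (- 5 * v) (- v)) ?dvd5 ?dvd25 //; try ring.
    by move=> t H; apply: (nux (2 * t + 12 * x - 9 * u)); lia.
  by move=> t H; apply: (nux (- t)); lia.
- rewrite !dvd5 ?(d25 _ (- u)) //; try ring.
    by move=> t H; apply: (nuv (t + u - v)); lia.
  by move=> t H; apply: (nuv (2 * t + 2 * u + v)); lia.
- rewrite !dvd5 ?dvd25 //.
  + by move=> t H; apply: (nuv (4 * t + 6 * u + 19 * v)); lia.
  + by move=> t H; apply: (nuv (- t + u - v)); lia.
  by move=> t H; apply: (nuv (2 * t + 2 * u + v)); lia.
- by rewrite (d5 _ u) ?(d5 _ v).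
Qed.

Lemma sim25_inj (i : 'I_7) : injective (sim25 i).
Proof.
move=> [[u v] x] [[u' v'] x']; case: i => [[|[|[|[|[|[|[|i]]]]]]] i7] //; rewrite /sim25 /=;
  by case=> E1 E2 E3; congr (_, _, _); lia.
Qed.

(** The seven images of the level set of n partition that of 25 n: [sim25_surj] covers it,
    [sim25_classK] separates the images, and each similitude is injective. *)
Lemma level_sum25 :
  level_sum (25 * n) = \sum_(i < 7) \sum_(p \in level n) wt (sim25 i p).
Proof.
pose h (ip : 'I_7 * Z3) := sim25 ip.1 ip.2.
rewrite /level_sum (@reindex_fsbig _ _ _ _ _ h ([set: 'I_7] `*` level n)%classic).
  rewrite -(@pair_fsbig _ _ _ _ _ [set: 'I_7]%classic (level n) (fun i p => wt (sim25 i p))).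
  - have -> : [set: 'I_7]%classic = [set` xpredT]%classic by apply/funext => i; apply/propext.
    by rewrite -(@bigfs _ _ _ _ (index_enum 'I_7) xpredT) ?index_enum_uniq // => i _; rewrite mem_index_enum.
  - exact: finite_finset.
  - exact: finite_level.
split.
- move=> [i p] [_ /= pn]; rewrite /level /= /h sim25_form; congr (_ * _)%N; exact: pn.
- move=> [i p] [j p'] /set_mem [_ /= pn] /set_mem [_ /= pn'] /= H.
  have ij : i = j by apply: val_inj; rewrite /= -(sim25_classK i pn) -(sim25_classK j pn') -/(h (i, p)) H.
  by rewrite ij in H *; congr (_, _); apply: sim25_inj H.
move=> y /= /[dup] yn /sim25_surj [i [p yE]]; exists (i, p) => //=; split=> //.
by move: yn; rewrite /level /= yE sim25_form => /eqP; rewrite eqn_pmul2l // => /eqP.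
Qed.

End Hecke25.

(** * Averaging the weight over symmetries of the form *)

Section LevelSymmetry.
Local Notation Z3 := (int * int * int)%type.
Local Notation Q := ternary_form.
Local Notation wt := ternary_weight.
Variable n : nat.

Lemma level_involution (g : Z3 -> Z3) (F : Z3 -> int) : involutive g ->
  (forall p, Q (g p) = Q p) -> \sum_(p \in level n) F p = \sum_(p \in level n) F (g p).
Proof.
move=> gK gQ; apply: reindex_fsbig; split.
- by move=> p pn; rewrite /level /= gQ.
- by move=> p p' _ _ /(can_inj gK).
- by move=> p pn; exists (g p); rewrite ?gK // /level /= gQ.
Qed.

Lemma level_sumD (F G : Z3 -> int) :
  \sum_(p \in level n) (F p + G p) = \sum_(p \in level n) F p + \sum_(p \in level n) G p.
Proof. exact/fsbig_split/finite_level. Qed.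

Lemma eq_level_sum (F G : Z3 -> int) : (forall p, level n p -> F p = G p) ->
  \sum_(p \in level n) F p = \sum_(p \in level n) G p.
Proof. by move=> FG; apply: eq_fsbigr => p /set_mem /FG. Qed.

Definition flip_u (p : Z3) : Z3 := (- p.1.1, p.1.2, p.2).
Definition flip_x (p : Z3) : Z3 := (p.1.1, p.1.2, - p.2).
Definition swap_uv (p : Z3) : Z3 := (p.1.2, p.1.1, p.2).

Lemma flip_uQ p : Q (flip_u p) = Q p.
Proof. by rewrite /Q /flip_u /theta_exp /= sqrrN !mul0r. Qed.
Lemma flip_xQ p : Q (flip_x p) = Q p.
Proof. by rewrite /Q /flip_x /theta_exp /= sqrrN !mul0r. Qed.
Lemma swap_uvQ p : Q (swap_uv p) = Q p.
Proof. by rewrite /Q /swap_uv /=; congr (_ + _)%N; rewrite addnC. Qed.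

Lemma parity_signN u : parity_sign (- u) = parity_sign u. Proof. by rewrite /parity_sign abszN. Qed.

Lemma wt_flip_x p : wt (flip_x p) = wt p.
Proof. by rewrite /wt /flip_x /= parity_signN. Qed.

Lemma wt_flip_v u v x : wt (u, - v, x) = wt (u, v, x).
Proof. by rewrite /wt /= chi3N sqrrN; ring. Qed.

Lemma parity_sign_congr u v s : u = v + 2 * s -> parity_sign u = parity_sign v.
Proof.
move=> ->; rewrite /parity_sign -signr_odd -[RHS]signr_odd; congr (_ ^+ nat_of_bool _); lia.
Qed.

Lemma parity_sign_congr1 u v s : u = v + 2 * s + 1 -> parity_sign u = - parity_sign v.
Proof.
move=> ->; rewrite /parity_sign -signr_odd -[in RHS]signr_odd.
have -> : odd (absz (v + 2 * s + 1)) = ~~ odd (absz v) by lia.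
by case: odd; rewrite ?expr0 ?expr1 ?opprK.
Qed.

Lemma chi3_congr u v s : u = v + 3 * s -> chi3 u = chi3 v.
Proof. by move=> ->; rewrite /chi3; do ! case: ifP => ?; lia. Qed.

Hypothesis n2 : odd n.

Lemma level_parity u v x : level n (u, v, x) -> exists s, u = v + 2 * s + 1.
Proof.
move=> pn; have E : n%:Z = u ^+ 2 + v ^+ 2 + 6 * x ^+ 2 by rewrite -(congr1 Posz pn) ternary_formE.
have uE := divz_eq u 2; have vE := divz_eq v 2.
move: (u %/ 2)%Z (v %/ 2)%Z uE vE => a b.
have : (u %% 2)%Z = 0 \/ (u %% 2)%Z = 1 by lia.
have : (v %% 2)%Z = 0 \/ (v %% 2)%Z = 1 by lia.
case=> ->; case=> -> uE vE.
- by move: E; rewrite uE vE; have := n2; lia.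
- by exists (a - b); lia.
- by exists (a - b - 1); lia.
- by move: E; rewrite uE vE; have := n2; lia.
Qed.

(** Exchanging u and v changes the sign of u^2 - v^2 and also the parity sign, because for odd n
    exactly one of u and v is odd. *)
Lemma wt_swap_uv p : level n p -> wt (swap_uv p) = wt p.
Proof.
case: p => [[u v] x] /level_parity[s /parity_sign_congr1 uv].
by rewrite /wt /swap_uv /= uv; ring.
Qed.

(** Term by term the weight of the image is not a multiple of the weight. Averaging over x -> -x
    removes the odd powers of x, and averaging over the exchange of u and v removes the term in u v
    x^2; the four transforms then add up to 4 * (-65) = -260 times the weight. *)
Lemma sum_sim25_0 : \sum_(p \in level n) wt (sim25 0 p) = -65 * level_sum n.
Proof.
set S := LHS; suff : S + S + (S + S) = -260 * level_sum n by lia.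
have E1 : S = \sum_(p \in level n) wt (sim25 0 (flip_x p)).
  by apply: level_involution; [by move=> [[u v] x]; rewrite /flip_x /= opprK | exact: flip_xQ].
have E2 : S = \sum_(p \in level n) wt (sim25 0 (swap_uv p)).
  by apply: level_involution; [by move=> [[u v] x] | exact: swap_uvQ].
have E3 : S = \sum_(p \in level n) wt (sim25 0 (swap_uv (flip_x p))).
  rewrite E2; apply: level_involution; [by move=> [[u v] x]; rewrite /flip_x /= opprK | exact: flip_xQ].
rewrite [X in X + (S + S)](congr2 +%R (erefl S) E1) (congr2 +%R E2 E3) /S -!level_sumD mulr_fsumr; apply: eq_level_sum => -[[u v] x] /level_parity[s uv].
rewrite /wt /flip_x /swap_uv /sim25 /=.
have c1 w : chi3 (- 5 * w) = chi3 w by apply: (@chi3_congr _ _ (- 2 * w)); ring.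
have c2 w t : chi3 (- w - 12 * t) = - chi3 w.
  by rewrite -chi3N; apply: (@chi3_congr _ _ (- 4 * t)); ring.
have c3 w t : parity_sign (- 2 * w + t) = parity_sign t by apply: (@parity_sign_congr _ _ (- w)); ring.
have c4 w : parity_sign (- 5 * w) = parity_sign w by apply: (@parity_sign_congr _ _ (- 3 * w)); ring.
rewrite !c1 !c2 !c3 !c4 !parity_signN (parity_sign_congr1 uv); ring.
Qed.

(** Here x is only scaled, and averaging over u -> -u is enough; 1054 = 2 * 527. *)
Lemma sum_sim25_4 : \sum_(p \in level n) wt (sim25 4 p) = 527 * level_sum n.
Proof.
set S := LHS; suff : S + S = 1054 * level_sum n by lia.
have E1 : S = \sum_(p \in level n) wt (sim25 4 (flip_u p)).
  by apply: level_involution; [by move=> [[u v] x]; rewrite /flip_u /= opprK | exact: flip_uQ].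
rewrite {2}E1 /S -!level_sumD mulr_fsumr; apply: eq_level_sum => -[[u v] x] /level_parity[s uv].
rewrite /wt /flip_u /sim25 /=.
have c1 : chi3 (- 4 * u - 3 * v) = - chi3 u.
  by rewrite -chi3N; apply: (@chi3_congr _ _ (- u - v)); ring.
have c2 : chi3 (- 3 * u + 4 * v) = chi3 v by apply: (@chi3_congr _ _ (v - u)); ring.
have c3 : chi3 (- 4 * - u - 3 * v) = chi3 u by apply: (@chi3_congr _ _ (u - v)); ring.
have c4 : chi3 (- 3 * - u + 4 * v) = chi3 v by apply: (@chi3_congr _ _ (v + u)); ring.
have d1 : parity_sign (- 5 * x) = parity_sign x by apply: (@parity_sign_congr _ _ (- 3 * x)); ring.
have d2 : parity_sign (- 4 * u - 3 * v) = parity_sign v by apply: (@parity_sign_congr _ _ (- 2 * u - 2 * v)); ring.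
have d3 : parity_sign (- 4 * - u - 3 * v) = parity_sign v by apply: (@parity_sign_congr _ _ (2 * u - 2 * v)); ring.
rewrite c1 c2 c3 c4 d1 d2 d3 (parity_sign_congr1 uv); ring.
Qed.

End LevelSymmetry.

(* The eigenvalue is 4 (-65) + 2 * 527 + 625 = 11 * 129. *)
Theorem hecke25 n : odd n -> (n %% 5 == 2)%N || (n %% 5 == 3)%N ->
  level_sum (25 * n) = 1419 * level_sum n.
Proof.
move=> n2 n5; have n25 : odd (25 * n) by rewrite oddM n2.
have L i p : level n p -> level (25 * n) (sim25 i p) by rewrite /level /= sim25_form => ->.
have E1 : \sum_(p \in level n) ternary_weight (sim25 1 p) = -65 * level_sum n.
  rewrite -sum_sim25_0 //; apply: eq_level_sum => -[[u v] x] _.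
  by rewrite -wt_flip_x /flip_x /sim25 /=; congr (ternary_weight (_, _, _)); ring.
have E2 : \sum_(p \in level n) ternary_weight (sim25 2 p) = -65 * level_sum n.
  rewrite -sum_sim25_0 // [RHS](@level_involution n swap_uv) //; last exact: swap_uvQ.
    by apply: eq_level_sum => p /(L 2%N) /(wt_swap_uv n25) <-; case: p => [[u v] x].
  by move=> [[u v] x].
have E3 : \sum_(p \in level n) ternary_weight (sim25 3 p) = -65 * level_sum n.
  rewrite -E2; apply: eq_level_sum => -[[u v] x] _.
  by rewrite -wt_flip_x /flip_x /sim25 /=; congr (ternary_weight (_, _, _)); ring.
have E5 : \sum_(p \in level n) ternary_weight (sim25 5 p) = 527 * level_sum n.
  rewrite -sum_sim25_4 //; apply: eq_level_sum => -[[u v] x] _.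
  by rewrite -wt_flip_v /sim25; congr (ternary_weight (_, _, _)); ring.
have E6 : \sum_(p \in level n) ternary_weight (sim25 6 p) = 625 * level_sum n.
  rewrite mulr_fsumr; apply: eq_level_sum => -[[u v] x] _.
  rewrite /ternary_weight /sim25 /=.
  have -> : parity_sign (5 * u) = parity_sign u by apply: (@parity_sign_congr _ _ (2 * u)); ring.
  have -> : parity_sign (5 * x) = parity_sign x by apply: (@parity_sign_congr _ _ (2 * x)); ring.
  have c5 w : chi3 (5 * w) = - chi3 w by rewrite -chi3N; apply: (@chi3_congr _ _ (2 * w)); ring.
  by rewrite !c5; ring.
rewrite level_sum25 // !big_ord_recl big_ord0 /= E1 E2 E3 E5 E6 sum_sim25_0 // sum_sim25_4 //.
ring.
Qed.

(** * Divisibility of the coefficients by 5 and by 11 *)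

Section Congruences.
Local Notation f k := (euler int k).

Lemma intr_Fp_eq0 p (z : int) : prime p -> (z%:~R == 0 :> 'F_p) = (p %| z)%Z.
Proof.
move=> pp; rewrite dvdzE /=; case: z => z.
  by rewrite -pmulrn -(dvdn_pcharf (pchar_Fp pp)).
by rewrite NegzE rmorphN /= oppr_eq0 -pmulrn -(dvdn_pcharf (pchar_Fp pp)).
Qed.

Lemma euler_2_9_mod11 e n : (6 * e + 5 = 25 * n)%N -> odd n ->
  (n %% 5 == 2)%N || (n %% 5 == 3)%N ->
  (11 %| (f 1 ^+ 2 * f 2 ^+ 9) e)%Z.
Proof.
move=> E n2 n5; have := hecke25 n2 n5; rewrite -!ternary_theta_coef -E.
have -> : ternary_theta (6 * e + 5)%N = - ((f 1 ^+ 2 * f 2 ^+ 9) e *+ 48).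
  rewrite ternary_thetaE; move: (f 1 ^+ 2 * _) => a.
  by rewrite coefsN coefsMn coefs_qXM leq_addl addnK coefs_dilM.
move: ((f 1 ^+ 2 * _) e) (ternary_theta n) => a t H.
rewrite -(Gauss_dvdzr _ (_ : coprimez 11 (- 48))) //; apply/dvdzP; exists (129 * t).
by move: H; lia.
Qed.

Theorem dvd55_gser k m : (m = 1375 * k + 1054 \/ m = 1375 * k + 779)%N ->
  (55 %| gser int m)%Z.
Proof.
move=> mE; have mapE (R : comNzRingType) : (gser int m)%:~R = gser R m.
  by rewrite -(smap_gser (intmul (1 : R))).
rewrite -[55]/(5 * 11 : int) Gauss_dvdz // -!intr_Fp_eq0 // !mapE; apply/andP; split.
  have -> : m = (5 * (m %/ 5) + 4)%N by lia.
  by rewrite -[_ (_ + 4)%N]/(ext 5 4 (gser 'F_5) _) ext5_gser.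
have [e [eE me]] : exists e, (e = 125 * k + 95 \/ e = 125 * k + 70)%N /\ m = (11 * e + 9)%N.
  by case: mE => mE; [exists (125 * k + 95)%N | exists (125 * k + 70)%N]; lia.
rewrite me -[_ (_ + 9)%N]/(ext 11 9 (gser 'F_11) e) ext11_gser coefsMn.
have -> : (euler 'F_11 1 ^+ 2 * euler 'F_11 2 ^+ 9) e = ((f 1 ^+ 2 * f 2 ^+ 9) e)%:~R.
  rewrite -!(smap_euler (intmul (1 : 'F_11))) -!rmorphXn -rmorphM //.
suff /eqP -> : ((f 1 ^+ 2 * f 2 ^+ 9) e)%:~R == 0 :> 'F_11 by rewrite mul0rn.
rewrite intr_Fp_eq0 //.
case: eE => eE; [apply: (@euler_2_9_mod11 e (30 * k + 23)%N) | apply: (@euler_2_9_mod11 e (30 * k + 17)%N)]; lia.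
Qed.

End Congruences.

(** * The even part of the generating function *)

Section NatSums.
Variable R : comNzRingType.

Lemma summable_nat (F : nat -> series R) c :
  (forall j, eqmodq (j - c)%N (F j) 0) -> summable F.
Proof.
move=> Fj n; exists (iota 0 (n + c)) => j; rewrite mem_iota add0n /= -leqNgt => jn.
by apply: eqmodqW (Fj j); rewrite leq_subRL; lia.
Qed.

Lemma ssum_recl (F : nat -> series R) : summable F -> ssum F = F 0%N + ssum (F \o succn).
Proof.
move=> sF; pose h (u : unit + nat) := if u is inr n then n.+1 else 0%N.
have bh : bijective h.
  exists (fun n => if n is n'.+1 then inr n' else inl tt) => [[[]|n]|[|n]] //.
rewrite (reindex_ssum _ bh) ssum_sum; last exact: summable_reindex.
congr (_ + _); apply: eqmodqP => n.
apply: eqmodq_trans (@ssum_seq _ _ _ n [:: tt] isT _) _; first by case.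
by rewrite big_seq1.
Qed.

End NatSums.

Section MockTheta.
Local Notation q := (qq int).
Local Notation f k := (euler int k).
Local Notation e := (theta_exp 1 1).

Definition odd_prod (c : series int) n : series int := \prod_(i < n) (1 + c * q ^+ (2 * i + 1)).
Local Notation A := (odd_prod 1).
Local Notation B n := (sinv (odd_prod (-1) n)).
Local Notation C n := (sinv (odd_prod 1 n)).

Lemma odd_prod0 c : odd_prod c 0 = 1. Proof. by rewrite /odd_prod big_ord0. Qed.
Lemma odd_prodS c n : odd_prod c n.+1 = odd_prod c n * (1 + c * q ^+ (2 * n + 1)).
Proof. by rewrite /odd_prod big_ord_recr. Qed.

Lemma odd_prod_coef0 c n : odd_prod c n 0 = 1.
Proof.
elim: n => [|n IH]; first by rewrite odd_prod0.
rewrite odd_prodS coefsM0 IH mul1r mulrC coefsD -(mulr1 (_ * c)) -mulrA coefs_qXM.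
by rewrite leqn0 addn1 addr0.
Qed.

Lemma odd_prodV c n : sinv (odd_prod c n) * odd_prod c n = 1.
Proof. by rewrite mulrC; apply/sinvP/odd_prod_coef0. Qed.

Lemma odd_prodVS c n : sinv (odd_prod c n.+1) * (1 + c * q ^+ (2 * n + 1)) = sinv (odd_prod c n).
Proof.
apply: (sreg (odd_prod_coef0 c n)); rewrite [RHS]mulrC odd_prodV.
transitivity (sinv (odd_prod c n.+1) * odd_prod c n.+1); last exact: odd_prodV.
move: (sinv _) => t; rewrite odd_prodS; ring.
Qed.

Lemma odd_prod_lim c n : eqmodq n.+1 (qprod c 2 1) (odd_prod c n).
Proof. by apply: iprod_trunc => //; apply: tame_qprod. Qed.

(** The weight q^n is replaced by q^(kn), which gives a family closed under a recurrence from k to k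
    + 2. *)
Definition mock_shift k : series int := ssum (fun n => q ^+ (k * n) * A n).
Definition mock := mock_shift 1.
Local Notation H := mock.
Local Notation S k := (mock_shift k).

Lemma summable_mock k : (0 < k)%N -> summable (fun n => q ^+ (k * n) * A n).
Proof.
move=> k0; apply: (@summable_nat _ _ 0) => j; apply: eqmodq_qX0.
by rewrite subn0 leq_pmull.
Qed.

(** Split off n = 0 and expand the last factor of A(n+1) = A(n) (1 + q^(2n+1)); its second term
    changes q^(kn) into q^((k+2)n). *)
Lemma mock_shift_rec k : (0 < k)%N -> (1 - q ^+ k) * S k = 1 + q ^+ k.+1 * S k.+2.
Proof.
move=> k0; have sk := summable_mock k0.
have s2 := @summable_mock k.+2 isT.
have E : S k = 1 + (q ^+ k * S k + q ^+ k.+1 * S k.+2).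
  rewrite {1}/mock_shift ssum_recl // muln0 expr0 mul1r odd_prod0; congr (_ + _).
  rewrite -!ssumMl // -ssumD; try exact: summableMl.
  apply: eq_ssum => n; rewrite /= odd_prodS mul1r.
  have -> : (k.+2 * n = k * n + 2 * n)%N by lia.
  by rewrite mulnS exprS !exprD; ring.
by rewrite mulrBl mul1r {1}E; ring.
Qed.

(** The recurrence iterated over k = 1, 3, 5, ... The remainder has order at least n^2 + n, so in
    the limit H is a sum of q^(j^2+j) divided by products of factors 1 - q^(2i+1). *)
Lemma mock_partial n :
  H = \sum_(j < n) q ^+ e j * B j.+1 + q ^+ e n * B n * S n.*2.+1.
Proof.
elim: n => [|n IH].
  have B0 : B 0 = 1.
    by have := odd_prodV (-1) 0; move: (sinv _) => t; rewrite odd_prod0 mulr1.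
  by rewrite big_ord0 add0r B0 /theta_exp expr0 !mul1r.
rewrite big_ord_recr /= -addrA [LHS]IH; congr (_ + _).
rewrite -odd_prodVS; have := mock_shift_rec (ltn0Sn n.*2).
have -> : (2 * n + 1 = n.*2.+1)%N by lia.
have -> : e n.+1 = (e n + n.*2.+2)%N by rewrite /theta_exp; lia.
rewrite mulNr mul1r doubleS exprD => E.
transitivity (q ^+ e n * B n.+1 * ((1 - q ^+ n.*2.+1) * S n.*2.+1)); first by ring.
by rewrite E; ring.
Qed.

Lemma leq_theta_exp11 (j : int) : (absz j <= (e j).+1)%N.
Proof. by rewrite /theta_exp; nia. Qed.
Lemma leq_theta_exp11_nat (n : nat) : (n <= e n)%N.
Proof. by rewrite /theta_exp; nia. Qed.

Lemma summable_mockE : summable (fun j : nat => q ^+ e j * B j.+1).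
Proof.
by apply: (@summable_nat _ _ 0) => j; apply: eqmodq_qX0; rewrite subn0 leq_theta_exp11_nat.
Qed.

Lemma mock_trunc n : eqmodq n H (\sum_(j < n) q ^+ e j * B j.+1).
Proof.
rewrite (mock_partial n) -[X in eqmodq _ _ X]addr0; apply: eqmodqD => //.
by rewrite -mulrA; apply/eqmodq_qX0/leq_theta_exp11_nat.
Qed.

Lemma mockE : H = ssum (fun j : nat => q ^+ e j * B j.+1).
Proof.
apply: eqmodqP => n; apply: (eqmodq_trans (@mock_trunc n)); apply: eqmodq_sym.
rewrite -(big_mkord xpredT (fun j => q ^+ e j%:Z * B j.+1)) /index_iota subn0.
apply: ssum_seq; first exact: iota_uniq.
move=> j; rewrite mem_iota add0n /= -leqNgt => nj.
by apply: eqmodq_qX0; apply: leq_trans nj (leq_theta_exp11_nat j).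
Qed.

(* W n interpolates between alt mock (n = 0) and psi2sum divided by the limit of
   odd_prod 1 (n -> oo). *)
Definition W n : series int := ssum (fun m : nat => q ^+ e (m%:Z - n%:Z) * C m.+1).

Lemma summable_W n : summable (fun m : nat => q ^+ e (m%:Z - n%:Z) * C m.+1).
Proof.
apply: (@summable_nat _ _ n.+1) => j; apply: eqmodq_qX0.
have := leq_theta_exp11 (j%:Z - n%:Z); lia.
Qed.

Lemma W0 : W 0 = alt H.
Proof.
rewrite mockE (@ssum_morph _ _ (@alt int)) //; first last.
- exact: summable_mockE.
- by move=> n a /eqmodq_alt; rewrite rmorph0.
apply: eq_ssum => m; rewrite subr0 /= rmorphM /= alt_qq.
congr (_ * _).
  have -> : e m = (m * m.+1)%N by rewrite /theta_exp; lia.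
  by rewrite -signr_odd oddM /= andbN mul1r.
apply: (sreg (odd_prod_coef0 1 m.+1)); rewrite mulrC odd_prodV.
have <- : alt (odd_prod (-1) m.+1) = odd_prod 1 m.+1.
  rewrite /odd_prod rmorph_prod; apply: eq_bigr => i _.
  by rewrite rmorphD rmorph1 rmorphM rmorphN1 /= alt_qq -signr_odd oddD oddM /=; ring.
by rewrite -rmorphM mulrC odd_prodV rmorph1.
Qed.

(** Replacing C(m+1) by C(m+2) (1 + q^(2m+3)) splits W(n) into a shift of W(n+1) and q^(2n+1) times
    a shift of W(n). The missing terms m = 0 combine through C(1) (1 + q) = 1. *)
Lemma W_rec n : W n * (1 - q ^+ (2 * n + 1)) = W n.+1 - q ^+ e n.
Proof.
have sn := @summable_W n; have sn1 := @summable_W n.+1.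
have E1 := ssum_recl sn; have E2 := ssum_recl sn1.
pose G (m : nat) := q ^+ e (m%:Z - n%:Z) * C m.+2.
have sG : summable G.
  apply: (@summable_nat _ _ n.+1) => j; apply: eqmodq_qX0.
  have := leq_theta_exp11 (j%:Z - n%:Z); lia.
have eG : ssum G = W n.+1 - q ^+ e n * C 1.
  rewrite /W E2 /= (_ : e (0 - n.+1%:Z) = e n); last by rewrite /theta_exp; lia.
  rewrite [X in X - _]addrC addrK; apply: eq_ssum => m; rewrite /G /=.
  by congr (q ^+ e _ * _); lia.
have eK : ssum (fun m : nat => q ^+ (2 * n + 1) * (q ^+ e (m.+1%:Z - n%:Z) * C m.+2)) =
    q ^+ (2 * n + 1) * (W n - q ^+ e (- n%:Z) * C 1).
  rewrite ssumMl; last first.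
    apply: (@summable_nat _ _ n.+1) => j; apply: eqmodq_qX0.
    have := leq_theta_exp11 (j.+1%:Z - n%:Z); lia.
  by rewrite /W {1}E1 /= sub0r [X in X - _]addrC addrK.
have WE : W n = ssum G + ssum (fun m : nat => q ^+ (2 * n + 1) * (q ^+ e (m.+1%:Z - n%:Z) * C m.+2)).
  rewrite -ssumD //; last first.
    apply: summableMl; apply: (@summable_nat _ _ n.+1) => j; apply: eqmodq_qX0.
    have := leq_theta_exp11 (j.+1%:Z - n%:Z); lia.
  apply: eq_ssum => m; rewrite /G -(odd_prodVS 1 m.+1) mul1r mulrA -exprD.
  have -> : (2 * n + 1 + e (m.+1%:Z - n%:Z) = e (m%:Z - n%:Z) + (2 * m.+1 + 1))%N.
    by rewrite /theta_exp; nia.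
  by move: (sinv _) => t; rewrite [in RHS]exprD; ring.
have C1 : C 1 * (1 + q) = 1.
  by have := odd_prodV 1 1; rewrite {2}odd_prodS odd_prod0 !mul1r.
have -> : W n * (1 - q ^+ (2 * n + 1)) = W n - q ^+ (2 * n + 1) * W n by ring.
rewrite {1}WE eG eK.
have eN : q ^+ (2 * n + 1) * q ^+ e (- n%:Z) = q ^+ e n * q.
  by rewrite -exprD -exprSr; congr (q ^+ _); rewrite /theta_exp; nia.
transitivity (W n.+1 - q ^+ e n * C 1 - q ^+ (2 * n + 1) * q ^+ e (- n%:Z) * C 1); first by ring.
rewrite eN; transitivity (W n.+1 - q ^+ e n * (C 1 * (1 + q))); first by ring.
by rewrite C1 mulr1.
Qed.

Lemma W_partial n :
  (alt H + \sum_(j < n) q ^+ e j * B j.+1) * odd_prod (-1) n = W n.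
Proof.
elim: n => [|n IH].
  by rewrite big_ord0 odd_prod0 mulr1 addr0 W0.
rewrite big_ord_recr /= addrA [_ * odd_prod _ n.+1]mulrDl -mulrA odd_prodV mulr1.
by rewrite odd_prodS mulrA IH mulN1r W_rec subrK.
Qed.

(** With j = m - 2 n, only |j| <= n matters modulo q^n, and then m >= n, so C(m+1) agrees with the
    inverse of the infinite product. In the limit j runs over all integers; this is how the
    one-sided sum becomes a full theta series. *)
Lemma W_lim n : eqmodq n (W (2 * n) * qprod 1 2 1) psi2sum.
Proof.
pose F (m : nat) := q ^+ e (m%:Z - (2 * n)%:Z) * (C m.+1 * qprod 1 2 1).
have -> : W (2 * n) * qprod 1 2 1 = ssum F.
  by rewrite mulrC -ssumMl; [apply: eq_ssum => m; rewrite /F; ring | exact: summable_W].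
apply: eqmodq_trans (@ssum_seq _ _ F n (iota n (2 * n)) (iota_uniq _ _) _) _.
  move=> m; rewrite mem_iota => mn; apply: eqmodq_qX0.
  by rewrite /theta_exp; nia.
apply/eqmodq_sym.
apply: eqmodq_trans (@ssum_seq _ _ _ n [seq i%:Z - (2 * n)%:Z | i <- iota n (2 * n)] _ _) _.
- by rewrite map_inj_uniq ?iota_uniq // => i j; lia.
- move=> j jn; rewrite -[q ^+ _]mulr1; apply: eqmodq_qX0.
  rewrite leqNgt; apply: contra jn => jn; apply/mapP; exists (absz (j + (2 * n)%:Z)).
    by rewrite mem_iota; move: jn; rewrite /theta_exp; nia.
  by move: jn; rewrite /theta_exp; nia.
rewrite big_map big_seq [X in eqmodq _ _ X]big_seq.
apply: (big_ind2 (fun a b => eqmodq n a b)) => [//|a b c d ab cd|m]; first exact: eqmodqD.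
rewrite mem_iota => /andP[nm _]; rewrite -[X in eqmodq _ X _]mulr1 /F; apply: eqmodqM => //.
rewrite -[X in eqmodq _ X _](odd_prodV 1 m.+1); apply: eqmodqM => //; apply/eqmodq_sym.
apply: eqmodqW (@odd_prod_lim 1 m.+1); lia.
Qed.

(** The limit of [W_partial]: the partial sums tend to H, [odd_prod (-1)] to its infinite product,
    and [W] is evaluated by [W_lim]. *)
Lemma mock_even : H + alt H = dil 2 (gser int) *+ 2.
Proof.
have E : (H + alt H) * qprod (-1) 2 1 * qprod 1 2 1 = psi2sum.
  apply: eqmodqP => n; apply: eqmodq_trans (@W_lim n).
  apply: eqmodqM => //; rewrite -W_partial addrC; apply: eqmodqM.
    by apply: eqmodqD => //; apply: eqmodqW (@mock_trunc (2 * n)); lia.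
  by apply: eqmodqW (@odd_prod_lim _ (2 * n)); lia.
apply: (@sreg _ (f 2 ^+ 2)); first by rewrite coefsX0 ?euler_coef0.
have G : f 2 ^+ 2 * dil 2 (gser int) = f 4 ^+ 3.
  by have := congr1 (dil 2) (gserE int); rewrite rmorphM !rmorphXn /= !dil_euler.
have f2E : f 2 = qprod 1 2 1 * qprod (-1) 2 1 * f 4.
  by rewrite (@euler_odd _ 2) // qprod_sqr.
transitivity ((H + alt H) * f 2 * f 2); first by ring.
rewrite {1}f2E; transitivity ((H + alt H) * qprod (-1) 2 1 * qprod 1 2 1 * f 2 * f 4); first by ring.
rewrite E psi2; transitivity (f 4 ^+ 3 *+ 2); first by ring.
by rewrite -G; ring.
Qed.

Theorem mock_gser m : H (2 * m)%N = gser int m.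
Proof.
have := congr1 (fun s : series int => s (2 * m)%N) mock_even.
rewrite coefsD coefsMn coefs_dilM //.
have -> : alt H (2 * m)%N = H (2 * m)%N.
  by rewrite -[LHS]/((-1) ^+ (2 * m) * H (2 * m)%N) exprM sqrrN !expr1n mul1r.
by move: (H _) (gser int m) => a b; lia.
Qed.

End MockTheta.

Local Open Scope nat_scope.

(** * Symmetric shapes and one-shell arrays *)

Lemma sum_ltn n m : m <= n -> \sum_(j < n) (j < m) = m.
Proof.
move=> mn; rewrite -(subnKC mn) big_split_ord /= [X in _ + X]big1 ?addn0 => [|j _].
  by rewrite -[RHS]card_ord -sum1_card; apply: eq_bigr => j _; rewrite ltn_ord.
by rewrite ltnNge leq_addr.
Qed.

(** The number of true values of a downward closed predicate is its threshold; heights of columns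
    are compared with membership in the diagram in this way. *)
Lemma ltn_sum_down n (P : pred nat) : (forall i j, i <= j -> P j -> P i) ->
  (forall i, P i -> i < n) -> forall i, (i < \sum_(j < n) P j) = P i.
Proof.
move=> Pdown Pn i; have exN : exists m, ~~ P m by exists n; apply/negP => /Pn; rewrite ltnn.
have [m Pm mmin] := ex_minnP exN.
have PE j : P j = (j < m).
  apply/idP/idP => [Pj|jm]; last by apply: contraTT jm => /mmin; rewrite -leqNgt.
  by rewrite ltnNge; apply: contra Pm => /Pdown; apply.
have mn : m <= n by apply: mmin; apply/negP => /Pn; rewrite ltnn.
by rewrite PE; congr (_ < _); under eq_bigr => j _ do rewrite PE; rewrite sum_ltn.
Qed.

(** The relation moved one step along the diagonal and bordered by a symmetric hook of 2 k + 1
    cells. *)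
Definition hook_rel k (P : rel nat) : rel nat := fun x y =>
  if x is x'.+1 then if y is y'.+1 then P x' y' else x <= k else y <= k.

Lemma sum_hook_rel n k (P : rel nat) : k < n -> (forall x y, P x y -> (x < k) && (y < k)) ->
  \sum_(x < n) \sum_(y < n) hook_rel k P x y = \sum_(x < n) \sum_(y < n) P x y + k.*2.+1.
Proof.
case: n => // n kn Pk; have kn' : k <= n := kn; rewrite big_ord_recl (@sum_ltn n.+1 k.+1) //.
under eq_bigr => x _ do rewrite big_ord_recl /=.
rewrite big_split /= (@sum_ltn n k) // [in RHS]big_ord_recr /=.
have P0 x y : (k <= x) || (k <= y) -> P x y = false by apply: contraTF => /Pk; lia.
rewrite [X in _ + X + _]big1 => [|y _]; last by rewrite P0 // kn'.
under [in RHS]eq_bigr => x _ do rewrite big_ord_recr /= P0 ?kn' ?orbT // addn0.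
by rewrite addn0; move: (\sum_(i < n) _) => t; lia.
Qed.

Section Shapes.
Variable n : nat.
Local Notation shape := {set 'I_n * 'I_n}.
Implicit Types S T : shape.

(** Membership at arbitrary natural coordinates, false outside the square, so that diagonal shifts
    carry no bounds. *)
Definition cell S x y : bool :=
  [exists u in S, (u.1 == x :> nat) && (u.2 == y :> nat)].

Lemma cellE S (x y : 'I_n) : cell S x y = ((x, y) \in S).
Proof.
apply/existsP/idP => [[[a b] /= /and3P[ab /eqP/val_inj <- /eqP/val_inj <-]]|xy] //.
by exists (x, y); rewrite xy !eqxx.
Qed.

Lemma cell_ltn S x y : cell S x y -> (x < n) && (y < n).
Proof. by case/existsP => -[a b] /= /and3P[_ /eqP <- /eqP <-]; rewrite !ltn_ord. Qed.

Lemma shape_ext S T : (forall x y, cell S x y = cell T x y) -> S = T.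
Proof. by move=> ST; apply/setP => -[x y]; rewrite -!cellE. Qed.

Definition shape_of (P : rel nat) : shape := [set u : 'I_n * 'I_n | P u.1 u.2].

Lemma card_shape_of P : #|shape_of P| = \sum_(x < n) \sum_(y < n) P x y.
Proof.
rewrite pair_bigA -sum1_card big_mkcond; apply: eq_bigr => -[x y] _ /=.
by rewrite inE /=; case: (P x y).
Qed.

Lemma card_shape S : #|S| = \sum_(x < n) \sum_(y < n) cell S x y.
Proof.
rewrite -card_shape_of; congr #|pred_of_set _|; apply/setP => -[x y].
by rewrite inE /= cellE.
Qed.

Lemma cell_shape_of P x y : cell (shape_of P) x y = [&& x < n, y < n & P x y].
Proof.
case: (boolP ((x < n) && (y < n))) => [/andP[xn yn]|xyn].
  by rewrite (cellE _ (Ordinal xn) (Ordinal yn)) inE xn yn.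
rewrite andbA (negbTE xyn); apply/negbTE; apply: contra xyn; exact: cell_ltn.
Qed.

(* Diagrams of self-conjugate partitions. *)
Definition sym_shape S : bool := [forall u in S, forall v : 'I_n * 'I_n,
  (v.1 <= u.1) && (v.2 <= u.2) ==> (v \in S) && ((v.2, v.1) \in S)].

Lemma sym_shapeP S : reflect ((forall x y, cell S x y = cell S y x) /\
    (forall x y x' y', x' <= x -> y' <= y -> cell S x y -> cell S x' y')) (sym_shape S).
Proof.
apply: (iffP idP) => [H|[Ssym Sdown]].
  have D x y x' y' : x' <= x -> y' <= y -> cell S x y -> cell S x' y' && cell S y' x'.
    move=> x'x y'y Sxy; have /andP[xn yn] := cell_ltn Sxy.
    move: Sxy; rewrite (cellE _ (Ordinal xn) (Ordinal yn)).
    rewrite (cellE _ (Ordinal (leq_ltn_trans x'x xn)) (Ordinal (leq_ltn_trans y'y yn))).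
    rewrite (cellE _ (Ordinal (leq_ltn_trans y'y yn)) (Ordinal (leq_ltn_trans x'x xn))).
    move=> /(forall_inP H) /forallP /(_ (Ordinal (leq_ltn_trans x'x xn), Ordinal (leq_ltn_trans y'y yn))).
    by rewrite /= x'x y'y.
  split=> [x y|x y x' y' x'x y'y /(D _ _ _ _ x'x y'y) /andP[]//].
  by apply/idP/idP => /(D _ _ _ _ (leqnn _) (leqnn _)) /andP[].
apply/forall_inP => -[x y] /=; rewrite -cellE => Sxy; apply/forallP => -[x' y'] /=.
by apply/implyP => /andP[xx yy]; rewrite -!cellE [cell S y' x']Ssym (Sdown _ _ _ _ xx yy Sxy).
Qed.

Lemma sym_shape_ltn S k x y : sym_shape S -> ~~ cell S 0 k -> cell S x y -> (x < k) && (y < k).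
Proof.
move=> /sym_shapeP[Ssym Sdown] Sk Sxy; rewrite !ltnNge; apply/andP; split; apply: contra Sk => Sk.
  by rewrite Ssym; apply: Sdown Sxy.
exact: Sdown Sxy.
Qed.

Definition add_hook k S := shape_of (hook_rel k (cell S)).
Definition remove_hook S := shape_of (fun x y => cell S x.+1 y.+1).

Section Hook.
Variables (k : nat) (S : shape).
Hypothesis symS : sym_shape S.

Lemma sym_remove_hook : sym_shape (remove_hook S).
Proof.
have /sym_shapeP[Ssym Sdown] := symS.
apply/sym_shapeP; split=> [x y|x y x' y' xx yy].
  by rewrite !cell_shape_of [cell S x.+1 _]Ssym andbCA.
rewrite !cell_shape_of => /and3P[xn yn Sxy]; apply/and3P; split; try lia.
by apply: Sdown Sxy.
Qed.

Hypothesis kn : k < n.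

Lemma cell_add_hook0 y : cell (add_hook k S) 0 y = (y <= k).
Proof. by rewrite cell_shape_of /hook_rel; lia. Qed.

Lemma remove_hookK : cell S 0 k -> ~~ cell S 0 k.+1 -> add_hook k (remove_hook S) = S.
Proof.
have /sym_shapeP[Ssym Sdown] := symS => Sk Sk1.
have S0 y : cell S 0 y = (y <= k).
  apply/idP/idP => [Sy|yk]; last exact: Sdown Sk.
  by have := sym_shape_ltn symS Sk1 Sy; lia.
apply: shape_ext => x y; rewrite cell_shape_of /hook_rel.
case: x y => [|x] [|y].
- by rewrite S0; lia.
- by rewrite S0; lia.
- by rewrite Ssym S0; lia.
rewrite cell_shape_of; case: (boolP (cell S _ _)) => [/cell_ltn|]; lia.
Qed.

Hypothesis Sk : ~~ cell S 0 k.

Lemma add_hookK : remove_hook (add_hook k S) = S.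
Proof.
apply: shape_ext => x y; rewrite !cell_shape_of /hook_rel.
case: (boolP (cell S x y)) => [/(sym_shape_ltn symS Sk)|]; lia.
Qed.

Lemma sym_add_hook : sym_shape (add_hook k S).
Proof.
have /sym_shapeP[Ssym Sdown] := symS.
apply/sym_shapeP; split=> [x y|x y x' y' xx yy].
  by rewrite !cell_shape_of andbCA /hook_rel; case: x y => [|x] [|y] //; rewrite Ssym.
rewrite !cell_shape_of /hook_rel => /and3P[xn yn Sxy]; apply/and3P; split; try lia.
case: x x' y y' xx yy Sxy {xn yn} => [|x] [|x'] [|y] [|y'] //; try lia.
- by move=> _ ? /(sym_shape_ltn symS Sk); lia.
- by move=> ? _ /(sym_shape_ltn symS Sk); lia.
- by move=> ? ?; apply: Sdown.
Qed.

Lemma card_add_hook : #|add_hook k S| = #|S| + k.*2.+1.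
Proof.
rewrite card_shape_of (sum_hook_rel kn (fun x y => @sym_shape_ltn S k x y symS Sk)).
by rewrite card_shape.
Qed.

End Hook.

(** Removing the outer hook is a bijection from the symmetric shapes with first row of length k + 1
    onto those with first row of length at most k. *)
Lemma sum_hook k (R : nmodType) (G : shape -> R) : k < n ->
  (\sum_(S | [&& sym_shape S, cell S 0 k & ~~ cell S 0 k.+1]) G S =
   \sum_(S | sym_shape S && ~~ cell S 0 k) G (add_hook k S))%R.
Proof.
move=> kn; rewrite (reindex_onto (add_hook k) remove_hook); last first.
  by move=> S /and3P[? ? ?]; apply: remove_hookK.
apply: eq_bigl => S; apply/andP/andP => [[/and3P[symS Sk Sk1] /eqP SE]|[symS Sk]].
  rewrite -{1 2}SE sym_remove_hook //; split=> //.
  rewrite cell_shape_of; apply: contra Sk1 => /and3P[_ _].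
  by have /sym_shapeP[_ Sdown] := symS; apply: Sdown.
by rewrite sym_add_hook // !cell_add_hook0 // add_hookK // ltnn leqnn.
Qed.

(** Such a shape is determined by its diagonal hooks, of distinct odd lengths below 2 k. In the
    induction the shapes with first row of length exactly k + 1 supply the term q^(2k+1) of the new
    factor. *)
Lemma sum_shape k : k <= n ->
  (\sum_(S | sym_shape S && ~~ cell S 0 k) qq int ^+ #|S| = odd_prod 1 k)%R.
Proof.
elim: k => [|k IH] kn.
  rewrite odd_prod0 (big_pred1 (@finset.set0 ('I_n * 'I_n)%type)) ?cards0 // => S.
  apply/idP/eqP => [/andP[symS S0]|->].
    by apply: shape_ext => x y; apply/idP/idP => [/(sym_shape_ltn symS S0)//|/existsP[u]]; rewrite inE.
  have c0 x y : cell (finset.set0 : shape) x y = false.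
    by apply/negbTE/existsP => -[u]; rewrite inE.
  by rewrite c0; apply/andP; split=> //; apply/sym_shapeP; split=> [x y|x y x' y' _ _]; rewrite !c0.
rewrite (bigID (fun S => cell S 0 k)) /= odd_prodS -IH ?(ltnW kn) // mulrDr mulr1 addrC.
congr (_ + _)%R.
  apply: eq_bigl => S; apply/andP/andP => [[/andP[-> _]] //|[symS Sk]]; split=> //.
  by rewrite symS; apply: contra Sk; have /sym_shapeP[_ Sdown] := symS; apply: Sdown.
rewrite mul1r mulr_suml (eq_bigl (fun S => [&& sym_shape S, cell S 0 k & ~~ cell S 0 k.+1])); last first.
  by move=> S; rewrite andbAC -andbA.
rewrite sum_hook //; apply: eq_bigr => S /andP[symS Sk].
by rewrite card_add_hook // -exprD; congr (_ ^+ _)%R; lia.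
Qed.

End Shapes.

(** * Correspondence between one-shell arrays and symmetric shapes *)

Section Arrays.
Variable n : nat.
Local Notation shape := {set 'I_n.+1 * 'I_n.+1}.
Local Notation A := (array n.+1).
Implicit Types (S : shape) (p : A).

Definition part S x : nat := \sum_(z < n.+1) cell S x z.

(* Three-dimensional diagram of the array: a point of a one-shell symmetric diagram has a zero
   coordinate, and then the other two coordinates form a cell of S. *)
Definition shell S (x y z : nat) : bool :=
  if x == 0 then cell S y z else if y == 0 then cell S x z else (z == 0) && cell S x y.

(** A sum of n + 1 booleans is at most n + 1, so [inord] never falls back to its default value. *)
Definition array_of S : A := \matrix_(x, y) inord (\sum_(z < n.+1) shell S x y z).
Definition base p : shape := [set u : 'I_n.+1 * 'I_n.+1 | 0 < p u.1 u.2].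

Lemma array_ofE S x y : array_of S x y = \sum_(z < n.+1) shell S x y z :> nat.
Proof.
rewrite mxE inordK // ltnS -[X in _ <= X]card_ord -sum1_card; apply: leq_sum => z _.
exact: leq_b1.
Qed.

Section SymShape.
Variable S : shape.
Hypothesis symS : sym_shape S.

Let Ssym x y : cell S x y = cell S y x. Proof. by have /sym_shapeP[] := symS. Qed.
Let Sdown x y x' y' : x' <= x -> y' <= y -> cell S x y -> cell S x' y'.
Proof. by have /sym_shapeP[_] := symS; apply. Qed.

Lemma shell_swap23 x y z : shell S x z y = shell S x y z.
Proof. by rewrite /shell; case: x y z => [|x] [|y] [|z] //=; exact: Ssym. Qed.
Lemma shell_swap12 x y z : shell S y x z = shell S x y z.
Proof. by rewrite /shell; case: x y z => [|x] [|y] [|z] //=; rewrite Ssym. Qed.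
Lemma shell_rot x y z : shell S z x y = shell S x y z.
Proof. by rewrite shell_swap12 shell_swap23. Qed.

Lemma shell_down x x' y z : x' <= x -> shell S x y z -> shell S x' y z.
Proof.
rewrite /shell; case: x x' y z => [|x] [|x'] [|y] [|z] //= xx; try exact: Sdown.
by rewrite Ssym; apply: Sdown.
Qed.

Lemma shell_ltn x y z : shell S x y z -> z < n.+1.
Proof.
by rewrite /shell; case: ifP => _; [|case: ifP => _]; [| |case/andP => /eqP ->]; case/cell_ltn/andP.
Qed.

Lemma ltn_part x z : (z < part S x) = cell S x z.
Proof.
apply: (@ltn_sum_down n.+1 (cell S x)) => [i j ij|i /cell_ltn/andP[]//].
exact: Sdown.
Qed.

Lemma ltn_array_of x y z : (z < array_of S x y) = shell S x y z.
Proof.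
rewrite array_ofE; apply: (@ltn_sum_down n.+1 (shell S x y)) => [i j ij|i]; last exact: shell_ltn.
by rewrite -!(shell_rot x y); apply: shell_down.
Qed.

Lemma array_of_row (x y : 'I_n.+1) : x = 0 :> nat -> array_of S x y = part S y :> nat.
Proof. by move=> x0; rewrite array_ofE /shell x0. Qed.

Lemma array_of_sym (x y : 'I_n.+1) : array_of S x y = array_of S y x :> nat.
Proof. by rewrite !array_ofE; apply: eq_bigr => z _; rewrite shell_swap12. Qed.

Lemma plane_partition_array_of : is_plane_partition (array_of S).
Proof.
have D (i1 i2 j : 'I_n.+1) : i1 <= i2 -> array_of S i2 j <= array_of S i1 j.
  move=> ii; rewrite !array_ofE; apply: leq_sum => z _.
  by case: (boolP (shell S i2 j z)) => // /(shell_down ii) ->.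
apply/andP; split.
  by apply/'forall_'forall_forallP => i1 i2 j; apply/implyP/D.
apply/'forall_'forall_forallP => i j1 j2; apply/implyP.
by rewrite (array_of_sym i j2) (array_of_sym i j1); apply: D.
Qed.

Lemma totally_symmetric_array_of : totally_symmetric (array_of S).
Proof.
apply/'forall_'forall_forallP => x y z; rewrite /in_diagram !ltn_array_of.
rewrite (shell_rot x y z) -(shell_rot y z x) (shell_swap23 x y z) (shell_swap12 x y z).
by rewrite (shell_swap23 z x y) (shell_rot x y z) !eqxx.
Qed.

Lemma one_shell_array_of : one_shell (array_of S).
Proof.
have scj (l : 'I_n.+1 -> 'I_n.+2) : (forall j, l j = part S j :> nat) -> self_conjugate l.
  move=> lE; apply/forallP => k; rewrite lE -sum1_card big_mkcond; apply/eqP/eq_bigr => j _.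
  by rewrite inE lE ltn_part Ssym; case: cell.
apply/and3P; split; apply/forallP => i.
- by apply/implyP => /eqP i0; apply: scj => j; apply: array_of_row.
- by apply/implyP => /eqP i0; apply: scj => j; rewrite array_of_sym; apply: array_of_row.
apply/forallP => j; apply/implyP => /and3P[i0 j0]; rewrite -lt0n => p0.
rewrite eqn_leq p0 andbT leqNgt ltn_array_of /shell; case: (nat_of_ord i) i0 => // i' _.
by case: (nat_of_ord j) j0.
Qed.

Lemma base_array_of : base (array_of S) = S.
Proof.
apply/setP => -[x y]; rewrite inE /= ltn_array_of -cellE /shell.
by case: (nat_of_ord x) => [|x']; case: (nat_of_ord y) => [|y'] //=; rewrite Ssym.
Qed.

(** Inclusion-exclusion on the solid diagram: three copies of [S] in the coordinate planes, which
    meet pairwise in axes of [part S 0] points, all through the origin. *)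
Lemma weight_array_of : cell S 0 0 -> weight (array_of S) + 3 * part S 0 = 3 * #|S| + 1.
Proof.
move=> S0; have cE : #|S| = part S 0 + \sum_(x < n) part S x.+1 by rewrite card_shape big_ord_recl.
have r0 : part S 0 = 1 + \sum_(x < n) cell S x.+1 0.
  by rewrite /part big_ord_recl S0; congr (_ + _); apply: eq_bigr => x _; rewrite Ssym.
have rE : \sum_(x < n) part S x.+1 =
    \sum_(x < n) cell S x.+1 0 + \sum_(x < n) \sum_(y < n) cell S x.+1 y.+1.
  by rewrite -big_split; apply: eq_bigr => x _; rewrite /part big_ord_recl.
have -> : weight (array_of S) = #|S| + \sum_(x < n) (part S x.+1 + \sum_(y < n) cell S x.+1 y.+1).
  rewrite /weight big_ord_recl cE; congr (_ + _).
    transitivity (\sum_(x < n.+1) part S x); last by rewrite big_ord_recl.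
    by apply: eq_bigr => y _; rewrite array_of_row.
  apply: eq_bigr => x _; rewrite big_ord_recl; congr (_ + _).
    by rewrite array_of_sym array_of_row.
  by apply: eq_bigr => y _; rewrite array_ofE big_ord_recl !lift0 big1 ?addn0.
rewrite big_split /=; move: cE r0 rE.
move: #|S| (part S 0) (\sum_(x < n) part S x.+1) (\sum_(x < n) cell S x.+1 0).
by move: (\sum_(x < n) _) => a b c d e; lia.
Qed.

Lemma part_eq k : (part S 0 == k.+1) = cell S 0 k && ~~ cell S 0 k.+1.
Proof. by rewrite -!ltn_part; lia. Qed.

End SymShape.

Lemma weight_array_of0 S : sym_shape S -> ~~ cell S 0 0 -> weight (array_of S) = 0.
Proof.
move=> symS S0; apply: big1 => x _; apply: big1 => y _; rewrite array_ofE.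
have c0 a b : cell S a b = false by apply/negbTE/negP => /(sym_shape_ltn symS S0).
by apply: big1 => z _; rewrite /shell !c0 andbF !if_same.
Qed.

Section ShellArray.
Variable p : A.
Hypotheses (pp : is_plane_partition p) (ts : totally_symmetric p) (os : one_shell p).

Let tsP (x y z : 'I_n.+1) :
  [/\ (y < p x z) = (z < p x y), (z < p y x) = (z < p x y) & (x < p y z) = (z < p x y)].
Proof.
have /'forall_'forall_forallP /(_ x y z) := ts.
by rewrite /in_diagram => /and5P[/eqP -> /eqP -> /eqP -> _ _].
Qed.

Lemma sym_shape_base : sym_shape (base p).
Proof.
have /andP[/'forall_'forall_forallP p1 /'forall_'forall_forallP p2] := pp.
apply/forall_inP => -[x y]; rewrite inE => /= pxy; apply/forallP => -[x' y'] /=.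
apply/implyP => /andP[xx yy]; rewrite !inE /=.
have [_ -> _] := tsP x' y' ord0; rewrite andbb.
apply: leq_trans pxy _; apply: leq_trans (implyP (p1 x' x y) xx) _.
exact: (implyP (p2 x' y' y) yy).
Qed.

Lemma array_of_base : array_of (base p) = p.
Proof.
have cE (x y : 'I_n.+1) : cell (base p) x y = (0 < p x y) by rewrite cellE inE.
have /and3P[_ _ /'forall_forallP os1] := os.
apply/matrixP => x y; apply: val_inj; rewrite /= array_ofE -[RHS](@sum_ltn n.+1); last first.
  by rewrite -ltnS; apply: ltn_ord.
apply: eq_bigr => z _; congr nat_of_bool; rewrite /shell.
have [p23 p12 p3] := tsP x y z.
case: eqP => [x0|/eqP x0]; first by rewrite cE -p3 x0.
case: eqP => [y0|/eqP y0]; first by rewrite cE -p23 y0.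
rewrite cE; have := implyP (os1 x y); rewrite !lt0n x0 y0 /=.
by case: (nat_of_ord (p x y)) => [|[|c]] H //; [rewrite andbF | rewrite andbT ltnS leqn0 | have := H isT].
Qed.

End ShellArray.

(** An array is determined by its support, the base. The condition on the cell (0, 0) excludes the
    empty shape, whose array has weight 0. *)
Lemma f_sum_shape : f n.+1 = \sum_(S | [&& sym_shape S, cell S 0 0 &
  3 * #|S| + 1 == n.+1 + 3 * part S 0]) 1.
Proof.
rewrite /f -sum1dep_card (reindex_onto array_of base); last first.
  by move=> p /and4P[pp ts os _]; apply: array_of_base.
apply: eq_bigl => S; apply/andP/and3P => [[/and4P[pp ts os /eqP w] /eqP SE]|[symS S0 w]].
  have symS : sym_shape S by rewrite -SE sym_shape_base.
  case: (boolP (cell S 0 0)) => [S0|/(weight_array_of0 symS)]; last by rewrite w.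
  by rewrite symS -(weight_array_of symS S0) w.
rewrite plane_partition_array_of // totally_symmetric_array_of // one_shell_array_of //.
rewrite base_array_of //; split=> //=.
by have := weight_array_of symS S0; rewrite (eqP w) => /addIn ->.
Qed.

(** The shapes are sorted by first row length k + 1 and the outer hook is removed. The size drops by
    2 k + 1, so the weight 3 |S| + 1 - 3 (k + 1) becomes 3 (|S| + k) + 1 for the smaller shape; k is
    the exponent of the factor q^k in H. *)
Lemma f_sum_fitting : f n.+1 = \sum_(k < n.+1)
  \sum_(S : shape | sym_shape S && ~~ cell S 0 k) (3 * (#|S| + k) + 1 == n.+1).
Proof.
rewrite f_sum_shape (partition_big (fun S => inord (part S 0).-1 : 'I_n.+1) xpredT) //.
apply: eq_bigr => k _.
transitivity (\sum_(S : shape | [&& sym_shape S, cell S 0 k & ~~ cell S 0 k.+1])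
    (3 * #|S| + 1 == n.+1 + 3 * k.+1)).
  rewrite [RHS]big_mkcond [LHS]big_mkcond; apply: eq_bigr => S _ /=.
  case: (boolP (sym_shape S)) => //= symS; rewrite -part_eq // -ltn_part //.
  have pn : part S 0 <= n.+1.
    by rewrite -[X in _ <= X]card_ord -sum1_card; apply: leq_sum => z _; exact: leq_b1.
  rewrite -val_eqE /= inordK; last by lia.
  case: (eqVneq (part S 0) k.+1) => [->|pk] /=; first by rewrite eqxx andbT; case: eqP.
  by rewrite andbAC (_ : (0 < part S 0) && ((part S 0).-1 == k) = false) //; lia.
have := @sum_hook _ k nat (fun S => (3 * #|S| + 1 == n.+1 + 3 * k.+1) : nat) (ltn_ord k).
rewrite -[LHS]/(\sum_(S | _) _) => ->; apply: eq_bigr => S /andP[symS Sk].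
by rewrite card_add_hook //; congr nat_of_bool; apply/eqP/eqP; lia.
Qed.

End Arrays.

Lemma f_mock s : (f (3 * s + 1))%:Z = mock s.
Proof.
rewrite addn1 f_sum_fitting.
have sm := @summable_mock 1 isT.
(* The terms with k > s do not reach q^s; the longer range of indices is the one that counting in a
   square of side 3 s + 1 produces. *)
rewrite (@ssum_seq _ _ (fun k => qq int ^+ (1 * k) * odd_prod 1 k)%R s.+1 (iota 0 (3 * s).+1) (iota_uniq _ _)) //; last first.
  move=> k; rewrite mem_iota => ks; apply: eqmodq_qX0; lia.
rewrite -[iota _ _]/(index_iota 0 (3 * s).+1) big_mkord coefs_sum.
rewrite (big_morph Posz PoszD (erefl _)); apply: eq_bigr => k _.
rewrite -(sum_shape (ltnW (ltn_ord k))) mulr_sumr coefs_sum.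
rewrite (big_morph Posz PoszD (erefl _)); apply: eq_bigr => S _.
rewrite -exprD coefs_qX mul1n; case: eqP; case: eqP => //; lia.
Qed.

Lemma f_eq0 N : 0 < N -> N %% 3 != 1 -> f N = 0.
Proof.
case: N => // n _ n3; rewrite f_sum_fitting; apply: big1 => k _; apply: big1 => S _.
by case: eqP => // E; move: n3; rewrite -E; lia.
Qed.

Lemma dvd55_f N : 0 < N -> (forall m, N = 6 * m + 1 -> (55 %| gser int m)%Z) ->
  N %% 2 = 1 -> f N = 0 %[mod 55].
Proof.
move=> N0 dvd N2; case: (boolP (N %% 3 == 1)) => N3; last by rewrite f_eq0.
have NE : N = 6 * (N %/ 6) + 1 by lia.
have := dvd _ NE; rewrite -mock_gser -f_mock mulnA -NE dvdzE /= => /eqP ->.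
by rewrite mod0n.
Qed.

Theorem theorem1p3 (n : nat) :
  f (2750 * n + 825) = 0 %[mod 55] /\ f (2750 * n + 1925) = 0 %[mod 55].
Proof.
split; apply: dvd55_f => [|m E|]; try lia.
(* The equation with 6 m + 1 forces n = 2 modulo 3 here and n = 1 modulo 3 in the second case, so
   that k is the quotient of n by 3. *)
- by apply: (@dvd55_gser (n %/ 3)); left; lia.
- by apply: (@dvd55_gser (n %/ 3)); right; lia.
Qed.
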